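(* Let $\mathbf{k}$ be a field containing the field of real algebraic numbers. Let $d\ge 4$ and let $C\subset\mathbb{P}^2$ be the cuspidal cubic $C=V(xy^2-z^3)$. Fix $\underline{n}=(n_2,\dots,n_{2d-1})$ with integers $n_i\ge2$ for each $i\in\{2,\dots,2d-1\}$ and all the $n_i$ pairwise distinct (and set $n_1=2$). Denote by $\lambda\in\mathbb{R}$ the eigenvalue $\lambda_{d,\underline{n}}$ realising the spectral radius of the de Jonquières matrix $J_d^{\underline{n}}$ and set $$q_1^0=q_1=\tfrac{1}{\lambda-1}(2-\lambda),\qquad q_1^1=p_1=\tfrac{1}{\lambda-1}(2\lambda-1),$$ $$q_i^0=q_i=\tfrac{1}{\lambda-1}\Bigl(3\tfrac{\lambda}{\lambda^{n_i}+1}-(\lambda+1)\Bigr),\qquad q_i^j=\tfrac{1}{\lambda-1}\Bigl(3\tfrac{\lambda^{j+1}}{\lambda^{n_i}+1}-(\lambda+1)\Bigr),\quad 2\le i\le 2d-1,\ 1\le j\le n_i-1,$$ where these numbers are identified with the corresponding points of $C^*\cong\mathbb{A}^1$. Then there exists a de Jonquières map $j_d^{\underline{n}}\in\mathrm{Bir}_d(\mathbb{P}^2)$ with base points $p_1,\ p_2=q_2^{n_2-1},\dots,p_{2d-1}=q_{2d-1}^{n_{2d-1}-1}$, orbits $O(q_i)=\{q_i^j\mid 0\le j\le n_i-1\}$ ($1\le i\le 2d-1$) and dynamical degree $\lambda$.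
   Context: $C^*=C\setminus\{[1:0:0]\}$ is the set of smooth points of $C$, identified with $\mathbb{A}^1$ via $t\mapsto[t^3:1:t]$. A de Jonquières map of degree $d$ is a map $j_d\in\mathrm{Bir}(\mathbb{P}^2)$ of degree $d$ with a base point $p_1$ of multiplicity $d-1$ and base points $p_2,\dots,p_{2d-1}$ of multiplicity $1$; the base points of its inverse are denoted $q_1$ (of multiplicity $d-1$) and $q_2,\dots,q_{2d-1}$ (of multiplicity 1). For a birational map $f$ of $\mathbb{P}^2$ all of whose base points $p_1,\dots,p_r$ and all of whose inverse's base points $q_1,\dots,q_r$ are proper (not infinitely near), such that $f^{n_i-1}(q_i)=p_i$ for all $i$ and the points $f^s(q_t)$, $1\le t\le r$, $0\le s\le n_t-1$, are pairwise distinct, the tuple $(n_1,\dots,n_r)$ is called the orbit data of $f$ and $O(q_t)=\{f^s(q_t)\mid 0\le s\le n_t-1\}$ the orbit of $q_t$. Here $f^s(q_i)=q_i^s$. The dynamical degree of $f\in\mathrm{Bir}(\mathbb{P}^2)$ is $\lim_n(\deg f^n)^{1/n}$, and $\mathrm{Bir}_d(\mathbb{P}^2)$ is the set of birational maps of $\mathbb{P}^2$ of degree $d$. De Jonquières matrix: $J_d^{\underline{n}}$ is the square integer matrix of size $3+\sum_{i=2}^{2d-1}n_i$ representing, in the ordered basis $e_0,\ e_{1,0},e_{1,1},\ e_{2,0},\dots,e_{2,n_2-1},\ \dots,\ e_{2d-1,0},\dots,e_{2d-1,n_{2d-1}-1}$, the linear map (columns are images of basis vectors) $e_0\mapsto d\,e_0-(d-1)e_{1,0}-\sum_{i=2}^{2d-1}e_{i,0}$;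 $e_{1,0}\mapsto e_{1,1}$; $e_{1,1}\mapsto(d-1)e_0-(d-2)e_{1,0}-\sum_{i=2}^{2d-1}e_{i,0}$; $e_{i,k}\mapsto e_{i,k+1}$ for $2\le i\le 2d-1$, $0\le k<n_i-1$; $e_{i,n_i-1}\mapsto e_0-e_{1,0}-e_{i,0}$ for $2\le i\le 2d-1$. For $d\ge4$ and $n_i\ge2$ its spectral radius is attained by a real eigenvalue $\lambda_{d,\underline n}>2$, which is the root of largest absolute value of $(X^2-(d-1)X-1)\prod_{i=2}^{2d-1}(X^{n_i}+1)+X\sum_{i=2}^{2d-1}\prod_{j\ne i}(X^{n_j}+1)$ (product over $j\in\{2,\dots,2d-1\}\setminus\{i\}$). *)

(* Defs.v *)
From HB Require Import structures.
From mathcomp Require Import all_boot all_order all_algebra.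
From mathcomp Require Import boolp reals complex.
From mathcomp Require mpoly exp sequences.

Set Implicit Arguments.
Unset Strict Implicit.
Unset Printing Implicit Defensive.

Import Order.TTheory GRing.Theory Num.Theory.

Local Open Scope ring_scope.

Definition algebraic_real (R : realType) : {pred R} :=
  [pred x : R | `[< algebraicOver (ratr : rat -> R) x >]].

Lemma algebraic_real_divring (R : realType) :
  divring_closed (@algebraic_real R).
Proof.
split=> [|x y /asboolP ax /asboolP ay|x y /asboolP ax /asboolP ay];
  apply/asboolP.
- exact: algebraic1.
- exact: algebraic_sub.
- exact: algebraic_div.
Qed.

HB.instance Definition _ (R : realType) :=
  GRing.isDivringClosed.Build R (@algebraic_real R)
    (@algebraic_real_divring R).

Record realAlg (R : realType) :=
  RealAlg { realAlg_val :> R; realAlg_valP : realAlg_val \in @algebraic_real R }.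

HB.instance Definition _ (R : realType) := [isSub for @realAlg_val R].
HB.instance Definition _ (R : realType) := [Choice of realAlg R by <:].
HB.instance Definition _ (R : realType) :=
  [SubChoice_isSubIntegralDomain of realAlg R by <:].
HB.instance Definition _ (R : realType) :=
  [SubIntegralDomain_isSubField of realAlg R by <:].

(* Points of P^2(k) are represented by nonzero vectors of 'rV[k]_3, up to
   [proj_eq]; the coordinates 0, 1, 2 are x, y, z. *)
Definition proj_eq (k : fieldType) (u v : 'rV[k]_3) : Prop :=
  exists2 c : k, c != 0 & v = c *: u.

Definition proj_pt (k : fieldType) (x y z : k) : 'rV[k]_3 :=
  \row_(i < 3) [:: x; y; z]`_i.

Definition on_cuspidal_cubic (k : fieldType) (u : 'rV[k]_3) : Prop :=
  u 0 0 * u 0 1 ^+ 2 = u 0 2%:R ^+ 3.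

Definition cusp_pt (k : fieldType) (t : k) : 'rV[k]_3 := proj_pt (t ^+ 3) 1 t.

Lemma cusp_ptP (k : fieldType) (u : 'rV[k]_3) : u != 0 ->
  on_cuspidal_cubic u /\ ~ proj_eq (proj_pt 1 0 0) u <->
  exists t, proj_eq (cusp_pt t) u.
Proof.
have i2 : (2%:R : 'I_3) = lift ord0 (lift ord0 ord0) by exact: val_inj.
have i1 : (1 : 'I_3) = lift ord0 ord0 by exact: val_inj.
have i0 : (0 : 'I_3) = ord0 by exact: val_inj.
move=> u0; split=> [[uC uN]|[t [c c0 ->]]].
  have y0 : u 0 1 != 0.
    apply: contra_notN uN => /eqP y0.
    have /eqP : u 0 2%:R ^+ 3 = 0 by rewrite -uC y0 expr0n mulr0.
    rewrite expf_eq0 /= => /eqP z0.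
    have uE : u = u 0 0 *: proj_pt 1 0 0.
      apply/rowP=> i; rewrite !mxE -[RHS]/(_ * _).
      case: i => -[|[|[|//]]] Hi /=; rewrite ?mulr1 ?mulr0.
      - by congr (u _ _); exact: val_inj.
      - by rewrite -y0; congr (u _ _); exact: val_inj.
      - by rewrite -z0; congr (u _ _); exact: val_inj.
    exists (u 0 0) => //; apply: contraNneq u0 => x0.
    by rewrite uE x0 scale0r.
  exists (u 0 2%:R / u 0 1), (u 0 1) => //.
  apply/rowP=> i; rewrite !mxE; case: i => -[|[|[|//]]] Hi /=.
  - transitivity (u 0 0); first by congr (u _ _); exact: val_inj.
    apply: (mulIf (expf_neq0 2 y0)); rewrite uC expr_div_n mulrAC -exprS.
    by rewrite mulrCA divff ?mulr1 // expf_neq0.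
  - by rewrite mulr1; congr (u _ _); exact: val_inj.
  - by rewrite mulrCA divff // mulr1; congr (u _ _); exact: val_inj.
split=> [|[e e0 /rowP/(_ 1)]]; rewrite /on_cuspidal_cubic !mxE /=; last first.
  by rewrite mulr1 mulr0 => /eqP; rewrite (negPf c0).
by rewrite mulr1 exprMn mulrAC -exprS.
Qed.

(* The notations of mpoly and of the analysis library cannot be imported
   together, hence the modules. *)
Module PlaneMaps.
Import mpoly.

Section Triples.
Variable k : fieldType.

(* A triple (T_0, T_1, T_2) of forms describes [x:y:z] |-> [T_0:T_1:T_2]. *)
Definition triple : Type := 3.-tuple {mpoly k[3]}.

Implicit Types (T S : triple) (x v : 'rV[k]_3) (m : nat).

Definition idT : triple := [tuple 'X_i | i < 3].

Definition compT T S : triple := [tuple tnth T i \mPo S | i < 3].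

Definition iterT T (s : nat) : triple := iter s (compT T) idT.

Definition evalT T x : 'rV[k]_3 := \row_i (tnth T i).@[x 0].

Definition same_map T S : Prop :=
  [/\ exists i, tnth T i != 0, exists i, tnth S i != 0
    & forall i j, tnth T i * tnth S j = tnth T j * tnth S i].

Definition base_pt T x : Prop := evalT T x = 0.

Definition taylor x (P : {mpoly k[3]}) : {mpoly k[3]} :=
  P \mPo [tuple 'X_i + (x 0 i)%:MP | i < 3].

Definition vanishes_to m T x : Prop :=
  forall (i : 'I_3) (mu : 'X_{1..3}), (mdeg mu < m)%N ->
    (taylor x (tnth T i))@_mu = 0.

(* The multiplicity at [x] of the linear system spanned by the T_i.  For a
   form P, the order of P(x + X) at X = 0, computed in the affine 3-space,
   is the multiplicity at [x] of the plane curve P = 0. *)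
Definition mult_at T x m : Prop := vanishes_to m T x /\ ~ vanishes_to m.+1 T x.

(* For a point [x] of multiplicity m, the exceptional curve over [x] is the
   set of the directions v modulo x, and the strict transform of the linear
   system cuts out on it the zeros of the parts of degree m of the T_i(x + X);
   their common zeros are the base points in the first neighbourhood of [x]. *)
Definition inf_near_base_pt T x m v : Prop :=
  (forall c : k, v <> c *: x) /\
  forall i : 'I_3, (pihomog mdeg m (taylor x (tnth T i))).@[v 0] = 0.

End Triples.

Definition mapT (k L : fieldType) (s : {rmorphism k -> L}) (T : triple k) :
  triple L := map_tuple (map_mpoly s) T.

(* The base points of T are exactly the [p i], with multiplicity m i.  They
   are all proper; as k need not be algebraically closed, the base points
   over all extensions of k are considered. *)
Definition proper_base_points (k : fieldType) (I : finType) (T : triple k)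
    (p : I -> 'rV[k]_3) (m : I -> nat) : Prop :=
  [/\ forall i, p i != 0 /\ mult_at T (p i) (m i),
      forall i j, proj_eq (p i) (p j) -> i = j,
      forall i, base_pt T (p i),
      forall (L : fieldType) (s : {rmorphism k -> L}) (x : 'rV[L]_3),
        x != 0 -> base_pt (mapT s T) x ->
        exists i, proj_eq (map_mx s (p i)) x
    & forall (L : fieldType) (s : {rmorphism k -> L}) (i : I) (v : 'rV[L]_3),
        ~ inf_near_base_pt (mapT s T) (map_mx s (p i)) (m i) v].

(* Rational maps are given by forms without common factor, so that [rdeg] is
   the degree of the map; the condition [ratmap_coprime] also forces the
   triple to be nonzero. *)
Record ratmap (k : fieldType) := RatMap {
  rdeg : nat;
  rtriple :> triple k;
  ratmap_homog : forall i, tnth rtriple i \is rdeg.-homog;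
  ratmap_coprime : forall H : {mpoly k[3]},
    (forall i, exists Q, tnth rtriple i = Q * H) -> exists c : k, H = c%:MP
}.

Record birmap (k : fieldType) := BirMap {
  bfwd :> ratmap k;
  bbwd : ratmap k;
  bfwdK : same_map (compT bbwd bfwd) (idT k);
  bbwdK : same_map (compT bfwd bbwd) (idT k)
}.

Section Birational.
Variable k : fieldType.
Implicit Types (f : birmap k) (x y : 'rV[k]_3).

(* f^s(x) = y, where x, f(x), ..., f^(s-1)(x) are not base points of f. *)
Fixpoint iter_at f (s : nat) x y : Prop :=
  if s is s'.+1 then
    exists z, [/\ iter_at f s' x z, ~ base_pt f z & proj_eq (evalT f z) y]
  else proj_eq x y.

Definition has_orbit_data (I : finType) f (n : I -> nat)
    (p q : I -> 'rV[k]_3) : Prop :=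
  (forall i, iter_at f (n i).-1 (q i) (p i)) /\
  forall (i j : I) (s t : nat) x y, (s < n i)%N -> (t < n j)%N ->
    iter_at f s (q i) x -> iter_at f t (q j) y -> proj_eq x y ->
    i = j /\ s = t.

(* The 2d-1 base points are indexed by option 'I_(2d-2): None stands for the
   index 1, and Some i, with 0 <= i < 2d-2, for the index i+2. *)
Definition dJ_mult (d : nat) (i : option 'I_(2 * d - 2)) : nat :=
  if i is Some _ then 1 else d.-1.

Definition proper_de_Jonquieres (d : nat) f
    (p q : option 'I_(2 * d - 2) -> 'rV[k]_3) : Prop :=
  [/\ rdeg f = d,
      proper_base_points f p (@dJ_mult d)
    & proper_base_points (bbwd f) q (@dJ_mult d)].

Definition iter_degree f (s e : nat) : Prop :=
  exists2 g : ratmap k, same_map g (iterT f s) & rdeg g = e.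

End Birational.
End PlaneMaps.
Export PlaneMaps.

Module DynamicalDegree.
Import boolp classical_sets topology normedtype sequences exp.
Import numFieldNormedType.Exports.
Local Open Scope classical_set_scope.

Definition has_dynamical_degree (k : fieldType) (R : realType) (f : birmap k)
    (l : R) : Prop :=
  exists2 deg : nat -> nat, forall s, iter_degree f s (deg s)
    & (fun s => ((deg s)%:R : R) `^ (s%:R^-1)) @ \oo --> l.

End DynamicalDegree.
Export DynamicalDegree.

Section DeJonquieresMatrix.
Variables (d : nat) (n : 'I_(2 * d - 2) -> nat).

Definition dJ_size : nat := (3 + \sum_i n i)%N.

(* Basis vectors: positions 0, 1, 2 are those of e_0, e_{1,0}, e_{1,1}; the
   others are those of the e_{i,k}, ordered lexicographically by tagnat. *)
Definition dJ_e0 : 'cV[int]_dJ_size := delta_mx (lshift _ 0) 0.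

Definition dJ_e1 (k : 'I_2) : 'cV[int]_dJ_size :=
  delta_mx (lshift _ (lift ord0 k)) 0.

Definition dJ_e (i : 'I_(2 * d - 2)) (k : nat) : 'cV[int]_dJ_size :=
  \col_r (if split r is inr s
          then (tagnat.sig1 s == i) && (tagnat.sig2 s == k :> nat)
          else false)%:R.

Definition dJ_image (c : 'I_dJ_size) : 'cV[int]_dJ_size :=
  match split c with
  | inl a =>
      match val a with
      | 0 => d%:Z *: dJ_e0 - (d%:Z - 1) *: dJ_e1 0 - \sum_i dJ_e i 0
      | 1 => dJ_e1 1
      | _ => (d%:Z - 1) *: dJ_e0 - (d%:Z - 2) *: dJ_e1 0 - \sum_i dJ_e i 0
      end
  | inr s =>
      let i := tagnat.sig1 s in
      let k := nat_of_ord (tagnat.sig2 s) in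
      if (k.+1 < n i)%N then dJ_e i k.+1 else dJ_e0 - dJ_e1 0 - dJ_e i 0
  end.

Definition dJ_matrix : 'M[int]_dJ_size := \matrix_(r, c) dJ_image c r 0.

Lemma dJ_matrix_delta c : dJ_matrix *m delta_mx c 0 = dJ_image c.
Proof.
apply/colP=> r; rewrite mxE (bigD1 c) //= big1 => [|j jc].
  by rewrite !mxE !eqxx mulr1 addr0.
by rewrite !mxE (negPf jc) mulr0.
Qed.

Lemma dJ_matrix_e0 : dJ_matrix *m dJ_e0 =
  d%:Z *: dJ_e0 - (d%:Z - 1) *: dJ_e1 0 - \sum_i dJ_e i 0.
Proof. by rewrite dJ_matrix_delta /dJ_image (unsplitK (inl 0)). Qed.

Lemma dJ_matrix_e10 : dJ_matrix *m dJ_e1 0 = dJ_e1 1.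
Proof. by rewrite dJ_matrix_delta /dJ_image (unsplitK (inl (lift ord0 0))). Qed.

Lemma dJ_matrix_e11 : dJ_matrix *m dJ_e1 1 =
  (d%:Z - 1) *: dJ_e0 - (d%:Z - 2) *: dJ_e1 0 - \sum_i dJ_e i 0.
Proof. by rewrite dJ_matrix_delta /dJ_image (unsplitK (inl (lift ord0 1))). Qed.

Lemma dJ_eE i (k : 'I_(n i)) :
  dJ_e i k = delta_mx (rshift 3 (tagnat.Rank i k)) 0.
Proof.
apply/colP=> r; rewrite !mxE eqxx andbT.
case: splitP => [a ra|s rs].
  by apply/esym/eqP; rewrite -val_eqE /= ra ltn_eqF // (leq_trans (ltn_ord a)) ?leq_addr.
have -> : r = rshift 3 s by apply: val_inj.
rewrite (inj_eq (@rshift_inj _ _)); congr (nat_of_bool _)%:R.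
rewrite -(can_eq (@tagnat.sigK _ n)) /tagnat.Rank tagnat.rankK /tagnat.sig2 /tagnat.sig1.
case: (tagnat.sig s) => i' k' /=.
apply/andP/eqP => [[/eqP e1 /eqP e2]|e].
  by subst i'; congr Tagged; apply: val_inj.
move: (e) => /(congr1 (@tag _ _)) /= e1; subst i'; move/eqP: e.
by rewrite -tag_eqE /tag_eq /= eqxx tagged_asE => /eqP ->.
Qed.

Lemma dJ_matrix_e i (k : 'I_(n i)) : dJ_matrix *m dJ_e i k =
  if (k.+1 < n i)%N then dJ_e i k.+1 else dJ_e0 - dJ_e1 0 - dJ_e i 0.
Proof.
rewrite dJ_eE dJ_matrix_delta /dJ_image (unsplitK (inr _)).
by rewrite /tagnat.sig1 /tagnat.sig2 /tagnat.Rank tagnat.rankK.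
Qed.

Definition dJ_orbit_length (i : option 'I_(2 * d - 2)) : nat :=
  if i is Some i' then n i' else 2.

(* The point q_i^j is cusp_pt (dJ_param l i j), where None is the index 1. *)
Definition dJ_param (F : fieldType) (l : F) (i : option 'I_(2 * d - 2))
    (j : nat) : F :=
  match i with
  | None => if j == 0%N then (l - 1)^-1 * (2 - l) else (l - 1)^-1 * (2 * l - 1)
  | Some i' =>
      (l - 1)^-1 * (3 * (l ^+ j.+1 / (l ^+ n i' + 1)) - (l + 1))
  end.

End DeJonquieresMatrix.

Definition spectral_radius_eigenvalue (R : realType) (N : nat) (A : 'M[int]_N)
    (l : R) : Prop :=
  eigenvalue (map_mx intr A : 'M[R]_N) l /\
  forall mu : R[i], eigenvalue (map_mx intr A : 'M[R[i]]_N) mu ->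
    `|mu| <= (l%:C)%C.

(* Main.v *)
(* A map with base points on the cuspidal cubic that preserves it restricts to
   an affine map t |-> l t + c of its smooth locus A^1.  Conversely, such a de
   Jonquieres map is written down explicitly: in coordinates (n, y) adapted to
   the pencil of lines through p_1, it acts on the parameter n of the pencil by
   n |-> l^2 n and on each line by a Moebius transformation whose coefficients
   are the even and odd parts of \prod_i (X - s_i), where s_i - h are the
   parameters of the simple base points and 2 h the one of p_1; the only
   constraint is the value of \sum_i s_i, which for the points of the statement
   is the eigenvalue equation of the de Jonquieres matrix.  The orbits are then
   read on A^1, where the q_i^j are pairwise distinct because l > 2 and the n_i
   are.

   The degrees of the iterates are the e_0-coordinates of the images of e_0 under
   the powers of the matrix: composing with the map contracts the curves over
   the q_i, and the multiplicities along the orbits tell which powers of their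
   equations split off.  That nothing else splits off is seen from the zeros
   of the resulting forms, which are all algebraic over k, whereas the curve of a
   common factor would have transcendental points.  Finally, pairing with the positive left eigenvector
   for l bounds these degrees from both sides by multiples of l^s. *)
Require Import Defs.
From HB Require Import structures.
From mathcomp Require Import all_boot all_order all_algebra.
From mathcomp Require Import reals.
From mathcomp Require Import all_field boolp complex ring lra zify.
From mathcomp Require mpoly exp sequences.

Set Implicit Arguments.
Unset Strict Implicit.
Unset Printing Implicit Defensive.

Import Order.TTheory GRing.Theory Num.Theory.

Local Open Scope ring_scope.

(** The coordinate [u = t + h] is behind the formulas. The parameters of three collinear points of
    the cubic add up to zero, so a line through [cusp_pt (2 * h)] meets the cubic again at [u] and
    [- u]: the cubic is the double cover [n = u^2] of the pencil. A point of the line of parameter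
    [n] is read, up to scalars, as [pS + u * 'X_1] in the quadratic extension generated by [u].
    There the map is multiplication by [\prod_i (u - s_i) = E(n) + u O(n)], which fixes the two
    points of the cubic, followed by [u |-> l * u]. Its determinant is the norm
    [\prod_i (n - s_i^2)], and its inverse, multiplication by the conjugate, is of the same kind.
    Written with forms it has degree [d + 1] unless a factor [pZ] splits off; the value of
    [\sum_i s_i] is what makes it split off. Orders at points are bounded below by germs and above
    by restriction to the cubic, where the map is affine and an order is the multiplicity of a root
    of a univariate polynomial. *)

Module CuspidalMaps.
Import mpoly.

(** * Forms in three variables and germs along the cuspidal cubic *)

Section Substitution.
Variable k : fieldType.

Definition vec3 (A : Type) (a b c : A) : 'I_3 -> A :=
  fun i => tnth [tuple a; b; c] i.

Lemma rmorph_mmap (R : nzRingType) (n : nat) (A B : comNzRingType)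
    (f : {rmorphism R -> A}) (v : 'I_n -> A) (g : {rmorphism A -> B})
    (P : {mpoly R[n]}) :
  g (mmap f v P) = mmap (g \o f) (g \o v) P.
Proof.
rewrite rmorph_sum; apply: eq_bigr => m _; rewrite rmorphM /mmap1 rmorph_prod.
by congr (_ * _); apply: eq_bigr => i _; rewrite rmorphXn.
Qed.

Lemma eq_mmap (R : nzRingType) (n : nat) (A : comNzRingType)
    (f f' : R -> A) (v v' : 'I_n -> A) (P : {mpoly R[n]}) :
  f =1 f' -> v =1 v' -> mmap f v P = mmap f' v' P.
Proof.
move=> ef ev; apply: eq_bigr => m _; rewrite ef; congr (_ * _).
by apply: eq_bigr => i _; rewrite ev.
Qed.

Lemma rmorph_mpolyE (R : nzRingType) (n : nat) (A : comNzRingType)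
    (g : {rmorphism {mpoly R[n]} -> A}) (P : {mpoly R[n]}) :
  g P = mmap (fun c => g c%:MP) (fun i => g 'X_i) P.
Proof.
rewrite {1}[P]mpolyE rmorph_sum; apply: eq_bigr => m _.
rewrite -mul_mpolyC rmorphM mpolyXE_id rmorph_prod; congr (_ * _).
by apply: eq_bigr => i _; rewrite rmorphXn.
Qed.

Lemma mmap_idE (n : nat) (R : comNzRingType) (P : {mpoly R[n]}) :
  mmap (@mpolyC n R) (fun i => 'X_i) P = P.
Proof. by rewrite -(rmorph_mpolyE idfun). Qed.

Lemma congr_mmap (R : nzRingType) (n : nat) (A : comNzRingType) (f : R -> A)
    (v v' : 'I_n -> A) (w : A) (P : {mpoly R[n]}) :
  (forall i, exists q, v i - v' i = q * w) ->
  exists q, mmap f v P - mmap f v' P = q * w.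
Proof.
move=> vv'; pose E a b := exists q : A, a - b = q * w.
have E0 a : E a a by exists 0; rewrite subrr mul0r.
have ED a b a' b' : E a b -> E a' b' -> E (a + a') (b + b').
  by case=> q1 e1 [q2 e2]; exists (q1 + q2); rewrite mulrDl -e1 -e2; ring.
have EM a b a' b' : E a b -> E a' b' -> E (a * a') (b * b').
  case=> q1 e1 [q2 e2]; exists (q1 * a' + b * q2).
  by rewrite mulrDl mulrAC -e1 -mulrA -e2; ring.
have EX a b j : E a b -> E (a ^+ j) (b ^+ j).
  by move=> Eab; elim: j => [|j IH]; rewrite ?exprS //; apply: EM.
apply: (big_ind2 E (E0 0) ED) => m _; apply: (EM _ _ _ _ (E0 _)).
by apply: (big_ind2 E (E0 1) EM) => i _; apply: EX; apply: vv'.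
Qed.

Lemma dhomog_mmap (A : comNzRingType) (f : k -> A) (d n : nat)
    (v : 'I_n -> A) (w : A) (P : {mpoly k[n]}) : P \is d.-homog ->
  mmap f (fun i => w * v i) P = w ^+ d * mmap f v P.
Proof.
move=> /dhomogP hP; rewrite /mmap mulr_sumr !big_seq; apply: eq_bigr => m mP.
rewrite mulrCA; congr (_ * _); rewrite /mmap1 -(hP m mP) /= mdegE -prodrXr.
by rewrite -big_split; apply: eq_bigr => i _; rewrite exprMn.
Qed.

End Substitution.

Lemma vec3_0 (A : Type) (a b c : A) : vec3 a b c 0 = a. Proof. by []. Qed.
Lemma vec3_1 (A : Type) (a b c : A) : vec3 a b c 1 = b. Proof. by []. Qed.
Lemma vec3_2 (A : Type) (a b c : A) : vec3 a b c 2%:R = c. Proof. by []. Qed.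
Definition vec3E := (vec3_0, vec3_1, vec3_2).

Lemma mmapXU (R A : nzRingType) (n : nat) (f : {rmorphism R -> A})
    (v : 'I_n -> A) i : mmap f v 'X_i = v i.
Proof. by rewrite mmapX mmap1U. Qed.

Lemma forall_I3 (P : 'I_3 -> Prop) : P 0 -> P 1 -> P 2%:R -> forall i, P i.
Proof.
by move=> P0 P1 P2 [[|[|[|//]]] i]; [move: P0|move: P1|move: P2];
  congr P; apply: val_inj.
Qed.

Lemma mulrXn_coprime (R : idomainType) (n : nat) (p q r : {poly R}) :
  ~~ root p 0 -> p * q = r * 'X^n -> exists r', q = r' * 'X^n.
Proof.
move=> p0; elim: n q r => [|n IH] q r; first by exists q; rewrite mulr1.
rewrite exprSr mulrA => e.
have : root (p * q) 0 by rewrite e rootM rootX eqxx orbT.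
rewrite rootM (negPf p0) => /factor_theorem[q'].
rewrite subr0 => qE; move: e; rewrite qE mulrA.
have X0 : 'X != 0 :> {poly R} by rewrite polyX_eq0.
by move=> /(mulIf X0)/IH[r' ->]; exists r'; rewrite mulrA.
Qed.

(** Orders in ['X] add up over a domain. The bound on the order of [p] is a non-divisibility because
    this is the form in which [vanish_div] receives it. *)
Lemma mulrXn_order (R : idomainType) (n m : nat) (p q r : {poly R}) :
  ~ (exists r' : {poly R}, p = r' * 'X^(m.+1)) -> p * q = r * 'X^n ->
  exists r', q = r' * 'X^(n - m).
Proof.
move=> pm e; have p0 : p != 0.
  by apply/eqP=> p0; case: pm; exists 0; rewrite p0 mul0r.
have [j [p' p'0 pE]] := multiplicity_XsubC p 0.
rewrite p0 subr0 /= in p'0 pE.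
have jm : (j <= m)%N.
  rewrite leqNgt; apply/negP=> mj; case: pm.
  by exists (p' * 'X^(j - m.+1)); rewrite -mulrA -exprD subnK.
have [nm|mn] := leqP n m.
  by exists q; rewrite (eqP (_ : n - m == 0)%N) ?mulr1 // subn_eq0.
have [|r' ->] := @mulrXn_coprime _ (n - j) p' q r p'0; last first.
  exists (r' * 'X^(m - j)); rewrite -mulrA -exprD; congr (_ * 'X^ _).
  by rewrite addnBAC ?subnKC // ltnW.
have Xj : 'X^j != 0 :> {poly R} by rewrite expf_neq0 // polyX_eq0.
apply: (mulIf Xj); rewrite -[RHS]mulrA -exprD subnK ?(leq_trans jm) 1?ltnW //.
by rewrite -e pE mulrAC.
Qed.

Lemma dvdXn_coef (R : comNzRingType) (p : {poly R}) n :
  (forall j, (j < n)%N -> p`_j = 0) -> exists q, p = q * 'X^n.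
Proof.
move=> pn; exists (drop_poly n p).
rewrite -{1}(poly_take_drop n p) (_ : take_poly n p = 0) ?add0r //.
by apply/polyP=> j; rewrite coef_take_poly coef0; case: ifP => // /pn.
Qed.

Section VanishingOrder.
Variable k : fieldType.
Local Notation S := {mpoly k[3]}.

(* A family of lines through the point [cusp_pt tau], of parameter 'X. *)
Definition cusp_germ (tau : k) : 'I_3 -> {poly S} :=
  vec3 ((tau%:MP ^+ 3)%:P * ('X_1)%:P + 'X * ('X_0)%:P) ('X_1)%:P
    (tau%:MP%:P * ('X_1)%:P + 'X * ('X_(2%:R))%:P).

Definition expand_at (tau : k) : S -> {poly S} :=
  mmap (polyC \o @mpolyC 3 k) (cusp_germ tau).

HB.instance Definition _ tau := GRing.RMorphism.copy (expand_at tau)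
  (mmap (polyC \o @mpolyC 3 k) (cusp_germ tau)).

(** The ideal of [cusp_pt tau] is generated by ['X_0 - tau^3 'X_1] and ['X_2 - tau 'X_1], which
    [expand_at] sends to ['X] times a variable. So this is membership in the [nu]-th power of the
    ideal, turned into divisibility in a domain, where orders can be subtracted. *)
Definition vanish (tau : k) (nu : nat) (P : S) : Prop :=
  exists Q, expand_at tau P = Q * 'X^nu.

Lemma vanish0 tau P : vanish tau 0 P.
Proof. by exists (expand_at tau P); rewrite mulr1. Qed.

Lemma vanish_le tau m n P : (m <= n)%N -> vanish tau n P -> vanish tau m P.
Proof.
move=> mn [Q e]; exists (Q * 'X^(n - m)).
by rewrite -mulrA -exprD subnK.
Qed.

Lemma vanish_mul tau m n P Q :
  vanish tau m P -> vanish tau n Q -> vanish tau (m + n) (P * Q).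
Proof.
move=> [p e] [q e']; exists (p * q).
by rewrite rmorphM /= e e' exprD mulrACA.
Qed.

Lemma vanish_div tau m n c P : ~ vanish tau m.+1 c -> vanish tau n (c * P) ->
  vanish tau (n - m) P.
Proof. by move=> cm [Q]; rewrite rmorphM /= => /(mulrXn_order cm). Qed.

Lemma poly_rmorph_ex (R A : comNzRingType) (g : {rmorphism R -> A}) (w : A) :
  exists psi : {rmorphism {poly R} -> A},
    (forall c, psi c%:P = g c) /\ psi 'X = w.
Proof.
exists (horner_eval w \o map_poly g); split=> [c|] /=.
  by rewrite map_polyC /horner_eval hornerC.
by rewrite map_polyX /horner_eval hornerX.
Qed.

Lemma rmorphMDM (A B : nzRingType) (g : {rmorphism A -> B}) x1 x2 x3 x4 :
  g (x1 * x2 + x3 * x4) = g x1 * g x2 + g x3 * g x4.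
Proof. by rewrite rmorphD !rmorphM. Qed.

(** A substitution that passes through the point modulo [w] factors through [expand_at], with
    ['X |-> w]. It serves with [w] an equation of a contracted curve, with [w = 'X - tau] on the
    cubic, and with [w = 'X] for composites. *)
Lemma vanish_subst (A : comNzRingType) (f : {rmorphism k -> A})
    (tau : k) (nu : nat) (P : S) (v : 'I_3 -> A) (w a b : A) :
    vanish tau nu P -> v 0 = f tau ^+ 3 * v 1 + w * a ->
    v 2%:R = f tau * v 1 + w * b ->
  exists q, mmap f v P = q * w ^+ nu.
Proof.
move=> [Q e] v0 v2.
have [psi [psiC psiX]] := poly_rmorph_ex (mmap f (vec3 a (v 1) b)) w.
exists (psi Q); rewrite -psiX -rmorphXn -rmorphM -e /expand_at rmorph_mmap.
apply: eq_mmap => [c|]; first by rewrite /= psiC /= mmapC.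
apply: forall_I3; rewrite /cusp_germ /= ?vec3E ?v0 ?v2.
- by rewrite rmorphMDM psiX !psiC rmorphXn /= mmapC !mmapXU !vec3E.
- by rewrite psiC /= mmapXU vec3E.
- by rewrite rmorphMDM psiX !psiC /= mmapC !mmapXU !vec3E.
Qed.

Definition cusp_restr : S -> {poly k} := mmap polyC (vec3 'X^3 1 'X).

HB.instance Definition _ := GRing.RMorphism.copy cusp_restr
  (mmap polyC (vec3 'X^3 1 'X)).

Lemma vanish_cusp_restr tau nu P : vanish tau nu P ->
  ('X - tau%:P) ^+ nu %| cusp_restr P.
Proof.
move=> vP; have [||q] := @vanish_subst _ polyC tau nu P (vec3 'X^3 1 'X)
  ('X - tau%:P) ('X ^+ 2 + tau%:P * 'X + tau%:P ^+ 2) 1 vP.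
- by rewrite !vec3E; ring.
- by rewrite !vec3E; ring.
- by rewrite -/(cusp_restr P) => ->; apply: dvdp_mull.
Qed.

End VanishingOrder.

Section Homogeneous.
Variable k : fieldType.
Local Notation S := {mpoly k[3]}.

(** Homogeneity becomes the equation P(T X) = T^d P(X) over [{poly S}], so that the degree of a
    quotient of forms follows by cancellation. *)
Definition dilate : S -> {poly S} :=
  mmap (polyC \o @mpolyC 3 k) (fun i => 'X * ('X_i)%:P).

HB.instance Definition _ := GRing.RMorphism.copy dilate
  (mmap (polyC \o @mpolyC 3 k) (fun i => 'X * ('X_i)%:P)).

Lemma dilateE (P : S) d : (dilate P)`_d = pihomog mdeg d P.
Proof.
rewrite /dilate /mmap /pihomog coef_sum [RHS]big_mkcond; apply: eq_bigr => m _.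
have -> : mmap1 (fun i : 'I_3 => 'X * ('X_i)%:P) m
    = 'X^(mdeg m) * ('X_[m] : S)%:P.
  rewrite /mmap1 mdegE -prodrXr mpolyXE_id rmorph_prod -big_split.
  by apply: eq_bigr => i _; rewrite exprMn rmorphXn.
rewrite /= mulrCA coefXnM -rmorphM coefC mul_mpolyC (eq_sym (mdeg m)).
case: (ltngtP d (mdeg m)) => [||->]; rewrite ?subnn //.
by move=> lt; rewrite subn_eq0 leqNgt lt.
Qed.

Lemma dilate_homog (P : S) d :
  P \is d.-homog <-> dilate P = 'X^d * P%:P.
Proof.
split=> [hP|e].
  apply/polyP=> j; rewrite dilateE coefXnM coefC subn_eq0.
  case: (ltngtP j d) => [jd|dj|->].
  - by rewrite (pihomog_ne0 _ hP) // gtn_eqF.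
  - by rewrite (pihomog_ne0 _ hP) // ltn_eqF.
  - exact: pihomog_dE.
rewrite homog_piE -dilateE e coefXnM ltnn subnn coefC eqxx; exact/eqP.
Qed.

Lemma mulfXn_cancel (D : idomainType) (x a b c : D) m n : x != 0 -> a != 0 ->
  (m <= n)%N -> x ^+ m * a * b = x ^+ n * (a * c) -> b = x ^+ (n - m) * c.
Proof.
move=> x0 a0 mn e; apply: (@mulfI _ (x ^+ m * a)).
  by rewrite mulf_neq0 ?expf_neq0.
by rewrite e mulrACA -exprD subnKC // mulrA.
Qed.

Lemma dhomog_div (c P : S) m n : c != 0 -> c \is m.-homog ->
  c * P \is n.-homog -> (m <= n)%N -> P \is (n - m).-homog.
Proof.
move=> c0 /dilate_homog hc /dilate_homog; rewrite rmorphM /= hc polyCM => e mn.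
apply/dilate_homog; apply: mulfXn_cancel mn e; first by rewrite polyX_eq0.
by rewrite polyC_eq0.
Qed.

End Homogeneous.

Section Prime.
Variable S : idomainType.

Definition divides (L P : S) := exists Q, P = Q * L.

Definition prime_elt (L : S) :=
  L != 0 /\ forall P Q, divides L (P * Q) -> divides L P \/ divides L Q.

Lemma prime_elt_cancel (L c P Q : S) m : prime_elt L -> ~ divides L c ->
  c * P = Q * L ^+ m -> divides (L ^+ m) P.
Proof.
move=> [L0 Lp] Lc; elim: m P Q => [|m IH] P Q.
  by move=> _; exists P; rewrite mulr1.
rewrite exprSr mulrA => e; have [|//|[P' PE]] := Lp c P; first by exists (Q * L ^+ m).
have [|P'' P'E] := IH P' Q; first by apply: (mulIf L0); rewrite -e PE mulrA.
by exists P''; rewrite PE P'E mulrA.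
Qed.

End Prime.

(** * Points defined over an algebraic extension *)

Section LinearForm.
Variable k : fieldType.
Local Notation S := {mpoly k[3]}.

Definition lin_form (b c : k) : S := 'X_0 - (b *: 'X_1 + c *: 'X_(2%:R)).

(** The form generates the kernel of the substitution that solves it for ['X_0], and this
    substitution takes values in a domain. *)
Lemma prime_lin_form b c : prime_elt (lin_form b c).
Proof.
pose v := vec3 (b *: 'X_1 + c *: 'X_(2%:R)) 'X_1 'X_(2%:R) : 'I_3 -> S.
pose e := mmap (@mpolyC 3 k) v.
have eL : e (lin_form b c) = 0.
  rewrite /e /lin_form raddfB /= raddfD /= !mmapZ !mmapXU /v !vec3E.
  by rewrite !mul_mpolyC subrr.
have dvdP P : e P = 0 -> divides (lin_form b c) P.
  move=> eP; have [|q] := @congr_mmap _ _ _ (@mpolyC 3 k) (fun i => 'X_i) v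
    (lin_form b c) P.
    apply: forall_I3; rewrite /v /= vec3E ?subrr; first by exists 1; rewrite mul1r.
      by exists 0; rewrite mul0r.
    by exists 0; rewrite mul0r.
  by rewrite mmap_idE -/(e P) eP subr0 => PE; exists q.
split=> [|P Q [R PQ]].
  apply/eqP=> L0; have := congr1 (mmap idfun (vec3 1 0 0)) L0.
  rewrite /lin_form raddfB /= raddfD /= !mmapZ !mmapXU !vec3E raddf0.
  by rewrite !mulr0 addr0 subr0 => /eqP; rewrite oner_eq0.
have /eqP := congr1 e PQ; rewrite /e !rmorphM /= -/e eL mulr0 mulf_eq0.
by case/orP=> /eqP/dvdP; [left|right].
Qed.

End LinearForm.

Lemma not_divides_rmorph (S A : idomainType) (g : {rmorphism S -> A}) L P :
  g L = 0 -> g P != 0 -> ~ divides L P.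
Proof. by move=> gL gP [Q PE]; move: gP; rewrite PE rmorphM gL mulr0 eqxx. Qed.

Section BinaryForm.
Variable k : fieldType.
Local Notation S := {mpoly k[3]}.

(** The homogenisation [Z^n P(N / Z)], in a shape that makes sense where [Z] vanishes; there only
    the coefficient of index [n] survives. *)
Definition bform (N Z : S) (n : nat) (P : {poly k}) : S :=
  \sum_(j < n.+1) P`_j *: (N ^+ j * Z ^+ (n - j)).

Lemma bform_rmorph (A : comNzRingType) (g : {rmorphism S -> A}) N Z n P :
  g (bform N Z n P)
    = \sum_(j < n.+1) g (P`_j)%:MP * (g N ^+ j * g Z ^+ (n - j)).
Proof.
rewrite rmorph_sum; apply: eq_bigr => j _.
by rewrite -mul_mpolyC !rmorphM !rmorphXn.
Qed.

Lemma bform_eval (A : comNzRingType) (g : {rmorphism S -> A})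
    N Z n (P : {poly k}) nu :
    (size P <= n.+1)%N -> g N = nu * g Z ->
  g (bform N Z n P) = g Z ^+ n * (map_poly (g \o @mpolyC 3 k) P).[nu].
Proof.
move=> sP gN; rewrite bform_rmorph.
rewrite (@horner_coef_wide _ n.+1) ?(leq_trans (size_poly _ _)) //.
rewrite mulr_sumr; apply: eq_bigr => j _; rewrite coef_map_id0 ?raddf0 //.
have -> : g Z ^+ n = g Z ^+ j * g Z ^+ (n - j).
  by rewrite -exprD subnKC // -ltnS.
by rewrite gN exprMn /=; ring.
Qed.

Lemma bform_Z0 (A : comNzRingType) (g : {rmorphism S -> A}) N Z n P :
  g Z = 0 -> g (bform N Z n P) = g (P`_n)%:MP * g N ^+ n.
Proof.
move=> gZ.
rewrite bform_rmorph big_ord_recr /= subnn mulr1 big1 => [|j _].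
  by rewrite add0r.
by rewrite gZ expr0n subn_eq0 leqNgt ltn_ord !mulr0.
Qed.

Lemma bform_homog N Z n P : N \is 1.-homog -> Z \is 1.-homog ->
  bform N Z n P \is n.-homog.
Proof.
move=> hN hZ; apply: rpred_sum => j _; apply: dhomogZ.
have : N ^+ j * Z ^+ (n - j) \is (1 * j + 1 * (n - j)).-homog.
  by apply: dhomogM; apply: dhomogMn.
by rewrite !mul1n subnKC // -ltnS.
Qed.

Lemma bformXsubC N Z n (P : {poly k}) r : (size P <= n.+1)%N ->
  bform N Z n.+1 (('X - r%:P) * P) = (N - r *: Z) * bform N Z n P.
Proof.
move=> sP; rewrite /bform mulr_sumr [LHS](eq_bigr (fun j : 'I_n.+2 =>
   ('X * P)`_j *: (N ^+ j * Z ^+ (n.+1 - j)) -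
   r *: (P`_j *: (N ^+ j * Z ^+ (n.+1 - j))))); last first.
  by move=> j _; rewrite mulrBl coefB coefCM scalerBl scalerA.
rewrite sumrB big_ord_recl coefXM eqxx scale0r add0r.
rewrite [X in _ - X]big_ord_recr /= [P`_n.+1]nth_default // scale0r scaler0.
rewrite addr0 -sumrB; apply: eq_bigr => j _.
rewrite coefXM /= subSS exprS subSn -1?ltnS // exprS.
by rewrite mulrBl -!mul_mpolyC; ring.
Qed.

Lemma bform_scale (A : comNzRingType) (g d : {rmorphism S -> A}) N Z n P w :
    (forall c, g c%:MP = d c%:MP) -> g N = w * d N -> g Z = w * d Z ->
  g (bform N Z n P) = w ^+ n * d (bform N Z n P).
Proof.
move=> gC gN gZ; rewrite (bform_rmorph g) (bform_rmorph d) mulr_sumr.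
apply: eq_bigr => j _.
have -> : w ^+ n = w ^+ j * w ^+ (n - j) by rewrite -exprD subnKC // -ltnS.
by rewrite gC gN gZ !exprMn; ring.
Qed.

End BinaryForm.

Section ProjectivelyAlgebraic.
Variables (k L : fieldType) (s : {rmorphism k -> L}).
Local Notation S := {mpoly k[3]}.
Implicit Type v : 'I_3 -> L.

Definition proj_algebraic v :=
  forall i j, v j != 0 -> algebraicOver s (v i / v j).

Lemma algebraic_sum (I : Type) (r : seq I) (p : pred I) (F : I -> L) :
  (forall i, p i -> algebraicOver s (F i)) ->
  algebraicOver s (\sum_(i <- r | p i) F i).
Proof.
move=> aF; elim/big_ind: _ => //; [exact: algebraic0|exact: algebraic_add].
Qed.

Lemma algebraic_prod (I : Type) (r : seq I) (p : pred I) (F : I -> L) :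
  (forall i, p i -> algebraicOver s (F i)) ->
  algebraicOver s (\prod_(i <- r | p i) F i).
Proof.
move=> aF; elim/big_ind: _ => //; [exact: algebraic1|exact: algebraic_mul].
Qed.

Lemma algebraic_mmap v (P : S) : (forall i, algebraicOver s (v i)) ->
  algebraicOver s (mmap s v P).
Proof.
move=> av; apply: algebraic_sum => m _; apply: algebraic_mul.
  exact: algebraic_id.
apply: algebraic_prod => i _.
by elim: (m i) => [|j IH]; [apply: algebraic1|rewrite exprS; apply: algebraic_mul].
Qed.

Lemma proj_algebraic_scale v v' c : (forall i, v i = c * v' i) ->
  (forall i, algebraicOver s (v' i)) -> proj_algebraic v.
Proof.
move=> vE av i j; rewrite !vE mulf_eq0 negb_or => /andP[c0 vj].
by rewrite -mulf_div divff // mul1r; apply: algebraic_div.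
Qed.

End ProjectivelyAlgebraic.

Lemma poly_root_ext (F : fieldType) (p : {poly F}) : (1 < size p)%N ->
  exists (L : fieldType) (s : {rmorphism F -> L}) (z : L),
    root (map_poly s p) z.
Proof.
have [n] := ubnP (size p); elim: n p => // n IH p sp p1.
have [irr|nirr] := pselect (irreducible_poly p).
  by have [L _ [z pz _]] := irredp_FAdjoin irr; exists L, (in_alg L), z.
have [q [q1 qp nqp]] : exists q : {poly F}, [/\ size q != 1%N, q %| p & ~~ (q %= p)].
  apply: contrapT => nq; apply: nirr; split=> // q q1 qp.
  by apply: contrapT => /negP nqp; apply: nq; exists q.
have p0 : p != 0 by rewrite -size_poly_gt0 ltnW.
have q0 : q != 0 by apply: contraTneq qp => ->; rewrite dvd0p.
have qs : (size q < size p)%N.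
  by rewrite ltn_neqAle dvdp_leq // andbT dvdp_size_eqp.
have [||L [s [z qz]]] := IH q.
- by rewrite (leq_trans qs).
- by rewrite ltn_neqAle eq_sym q1 size_poly_gt0.
exists L, s, z; move: qp; rewrite -(dvdp_map s) => /root_dvdp; exact.
Qed.

Section Coprime.
Variable k : fieldType.
Local Notation S := {mpoly k[3]}.

Lemma mpolyXU_neq0 (i : 'I_3) : 'X_i != 0 :> S.
Proof.
apply/eqP=> /(congr1 (mmap idfun (fun=> 1))).
by rewrite mmapXU raddf0 => /eqP; rewrite oner_eq0.
Qed.

(** An algebraic relation homogenises to a form in ['X_a] and ['X_b] that is zero, and setting
    ['X_a] to ['X] and ['X_b] to 1 gives the relation back. *)
Lemma generic_ratio_transcendental (a b : 'I_3) : a != b ->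
  ~ algebraicOver (@tofrac S \o @mpolyC 3 k) (tofrac 'X_a / tofrac 'X_b).
Proof.
move=> ab [p p0 /rootP pab].
have Xb0 : tofrac 'X_b != 0 :> {fraction S} by rewrite tofrac_eq0 mpolyXU_neq0.
have e : bform 'X_a 'X_b (size p) p = 0 :> S.
  apply/eqP; rewrite -tofrac_eq0; apply/eqP.
  rewrite (bform_eval (nu := tofrac 'X_a / tofrac 'X_b)) //.
    by rewrite pab mulr0.
  by rewrite divfK.
move: p0; suff -> : p = 0 by rewrite eqxx.
pose v i : {poly k} := if i == a then 'X else 1.
have := congr1 (mmap polyC v) e.
have ba : (b == a) = false by rewrite eq_sym (negPf ab).
rewrite (bform_eval (nu := 'X)) //; last first.
  by rewrite /= !mmapXU /v eqxx ba mulr1.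
rewrite /= mmapXU /v ba expr1n mul1r raddf0 => <-.
rewrite -[LHS]comp_polyXr /comp_poly; congr (_.[_]); apply: eq_map_poly => c.
by rewrite /= mmapC.
Qed.

(** One variable at a time: if [H] has positive degree in ['X_j], a root in ['X_j] over generic
    values of the other two variables is a common zero of the [F i] with a transcendental ratio of
    coordinates. So [H] involves none of the variables. *)
Lemma coprime_of_algebraic_zeros (F : 'I_3 -> S) :
    (forall (L : fieldType) (s : {rmorphism k -> L}) (v : 'I_3 -> L),
       (exists i, v i != 0) -> (forall i, mmap s v (F i) = 0) ->
       proj_algebraic s v) ->
  forall H : S, (forall i, exists Q, F i = Q * H) -> exists c : k, H = c%:MP.
Proof.
move=> algF H HF.
pose del j : 'I_3 -> S := fun i => if i == j then 0 else 'X_i.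
suff Hdel j : H = mmap (@mpolyC 3 k) (del j) H.
  exists (mmap idfun (fun=> 0) H).
  pose D j := mmap (@mpolyC 3 k) (del j).
  transitivity ((D 0 \o D 1) (D 2%:R H)).
    by rewrite /D /= -(Hdel 2%:R) -(Hdel 1) -(Hdel 0).
  rewrite /D (rmorph_mmap _ _ (_ \o _)).
  rewrite (rmorph_mmap idfun (fun=> 0) (@mpolyC 3 k)).
  apply: eq_mmap => [c|]; first by rewrite /= !mmapC.
  by apply: forall_I3; rewrite /= /del /= !(mmapXU, raddf0).
pose s0 := @tofrac S \o @mpolyC 3 k.
(* [p] is [H] seen as a polynomial in ['X_j] alone, the other two variables being scalars. *)
pose w i : {poly {fraction S}} := if i == j then 'X else (tofrac 'X_i)%:P.
pose p := mmap (polyC \o s0) w H.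
have [p1|p1] := leqP (size p) 1; last first.
  have [L [s1 [z /rootP pz]]] := poly_root_ext p1.
  pose v i := if i == j then z else s1 (tofrac 'X_i).
  have Hv : mmap (s1 \o s0) v H = 0.
    rewrite -pz -[_.[z]]/((horner_eval z \o map_poly s1) p) /p rmorph_mmap.
    apply: eq_mmap => [c|i] /=; rewrite /v /w.
      by rewrite map_polyC /horner_eval hornerC.
    by case: eqP => _; rewrite ?map_polyX ?map_polyC /horner_eval !hornerE.
  have vF i : mmap (s1 \o s0) v (F i) = 0.
    by have [Q ->] := HF i; rewrite rmorphM /= Hv mulr0.
  have [a [b [ab aj bj]]] : exists a b : 'I_3, [/\ a != b, a != j & b != j].
    move: j {w p p1 pz v Hv vF}; apply: forall_I3.
    - by exists 1, 2%:R.
    - by exists 0, 2%:R.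
    - by exists 0, 1.
  have vb : v b != 0.
    by rewrite /v (negPf bj) fmorph_eq0 tofrac_eq0 mpolyXU_neq0.
  have [|q q0] := algF _ _ v _ vF a b vb; first by exists b.
  rewrite /v (negPf aj) (negPf bj) -fmorph_div map_poly_comp fmorph_root => rq.
  by case: (generic_ratio_transcendental ab); exists q.
have [c pE] : exists c, p = c%:P by exists p`_0; apply: size1_polyC.
have pev x : p.[x] = mmap s0 (fun i => if i == j then x else tofrac 'X_i) H.
  rewrite -[LHS]/(horner_eval x p) /p rmorph_mmap; apply: eq_mmap => [a|i] /=.
    by rewrite /horner_eval hornerC.
  by rewrite /w; case: eqP => _; rewrite /horner_eval !hornerE.
apply/eqP; rewrite -tofrac_eq; apply/eqP.
transitivity p.[tofrac 'X_j].
  rewrite pev -{1}[H]mmap_idE rmorph_mmap; apply: eq_mmap => // i /=.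
  by case: eqP => [->|].
rewrite pE hornerC -[c](hornerC c 0) -pE pev rmorph_mmap; apply: eq_mmap => // i.
by rewrite /del /=; case: eqP; rewrite // raddf0.
Qed.

End Coprime.

(** * Even and odd parts of a polynomial with given roots *)

Section EvenOdd.
Variables (k : fieldType) (I : finType) (e : nat) (s : I -> k).
Hypothesis cardI : #|I| = e.+1.*2.

Definition root_poly : {poly k} := \prod_i ('X - (s i)%:P).
Definition even_part := even_poly root_poly.
Definition odd_part := odd_poly root_poly.
Definition odd_lead : k := odd_part`_e.
(** The even part is monic of degree [e + 1], so this multiple of it cancels the top coefficient of
    ['X * odd_part]. The drop of the degree to [e] becomes a division by [pZ] in [resF_E]. *)
Definition residual_part : {poly k} := 'X * odd_part - odd_lead *: even_part.

Lemma root_polyE : root_poly = \prod_(a <- [seq s i | i <- enum I]) ('X - a%:P).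
Proof. by rewrite /root_poly big_map big_enum. Qed.

Lemma size_roots : size [seq s i | i <- enum I] = e.+1.*2.
Proof. by rewrite size_map -cardE. Qed.

Lemma size_root_poly : size root_poly = e.+1.*2.+1.
Proof. by rewrite root_polyE size_prod_XsubC size_roots. Qed.

Lemma root_poly_monic : root_poly`_(e.+1.*2) = 1.
Proof.
have := lead_coef_prod_XsubC (index_enum I) xpredT s.
by rewrite lead_coefE -/root_poly size_root_poly.
Qed.

Lemma size_even_part : (size even_part <= e.+2)%N.
Proof.
by rewrite (leq_trans (size_even_poly _)) // size_root_poly uphalfE -doubleS doubleK.
Qed.

Lemma size_odd_part : (size odd_part <= e.+1)%N.
Proof.
rewrite (leq_trans (size_odd_poly _)) // size_root_poly.
by rewrite -uphalfE uphalf_double.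
Qed.

Lemma even_part_monic : even_part`_e.+1 = 1.
Proof. by rewrite coef_even_poly root_poly_monic. Qed.

Lemma odd_leadE : odd_lead = - \sum_i s i.
Proof.
rewrite /odd_lead coef_odd_poly root_polyE.
have := @coefPn_prod_XsubC k [seq s i | i <- enum I].
by rewrite size_roots => -> //; rewrite big_map big_enum.
Qed.

Lemma size_residual_part : (size residual_part <= e.+1)%N.
Proof.
apply/leq_sizeP=> j; rewrite leq_eqVlt => /predU1P[<-|ej].
  by rewrite coefB coefXM coefZ even_part_monic mulr1 subrr.
rewrite coefB coefXM coefZ !nth_default ?mulr0 ?if_same ?subr0 //.
  by rewrite (leq_trans size_even_part).
by case: j ej => // j /ltnSE/(leq_trans size_odd_part).
Qed.

Lemma root_poly_eval (R : comNzRingType) (g : {rmorphism k -> R}) x :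
  (map_poly g even_part).[x ^+ 2] + x * (map_poly g odd_part).[x ^+ 2]
  = \prod_i (x - g (s i)).
Proof.
have eo := poly_even_odd root_poly; have := congr1 (horner_eval x \o map_poly g) eo.
rewrite /= rmorphD rmorphM /= !map_comp_poly map_polyXn map_polyX /horner_eval.
rewrite hornerD hornerM !horner_comp hornerXn hornerX [X in _ + X]mulrC => ->.
rewrite rmorph_prod horner_prod; apply: eq_bigr => i _.
by rewrite rmorphB /= map_polyX map_polyC !hornerE.
Qed.

(** The norm of [root_poly] for the involution ['X |-> - 'X]; the number of roots being even, no
    sign appears. The identity is checked after ['X |-> 'X^2], where the left side becomes the
    product of the values at ['X] and [- 'X]. *)
Lemma even_odd_norm :
  even_part ^+ 2 - 'X * odd_part ^+ 2 = \prod_i ('X - (s i ^+ 2)%:P).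
Proof.
have X2i : injective (fun p : {poly k} => p \Po 'X^2).
  move=> p q pq; apply/polyP=> j.
  by have := congr1 (coefp (j * 2)) pq; rewrite /= !coef_comp_poly_Xn // dvdn_mull // mulnK.
apply: X2i; rewrite /= rmorphB rmorphXn rmorphM rmorphXn /= comp_polyX rmorph_prod.
rewrite (eq_bigr (fun i => ('X - (s i)%:P) * - (- 'X - (s i)%:P))); last first.
  move=> i _; rewrite rmorphB /= comp_polyX comp_polyC rmorphXn /=; ring.
rewrite big_split /= prodrN cardI -muln2 mulnC exprM sqrrN !expr1n mul1r.
rewrite -(root_poly_eval polyC 'X) -(root_poly_eval polyC (- 'X)) sqrrN.
by rewrite /comp_poly; ring.
Qed.

Lemma even_odd_norm_eval (R : comNzRingType) (g : {rmorphism k -> R}) x :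
  (map_poly g even_part).[x] ^+ 2 - x * (map_poly g odd_part).[x] ^+ 2
  = \prod_i (x - g (s i) ^+ 2).
Proof.
have := congr1 (horner_eval x \o map_poly g) even_odd_norm.
rewrite /= rmorphB rmorphXn rmorphM rmorphXn /= map_polyX rmorph_prod /horner_eval.
rewrite hornerD hornerN horner_exp hornerM horner_exp hornerX horner_prod => ->.
apply: eq_bigr => i _.
by rewrite rmorphB /= map_polyX map_polyC hornerD hornerN hornerX hornerC /= rmorphXn.
Qed.

Lemma residual_part_eval (R : comNzRingType) (g : {rmorphism k -> R}) x :
  (map_poly g residual_part).[x]
  = x * (map_poly g odd_part).[x] - g odd_lead * (map_poly g even_part).[x].
Proof.
rewrite /residual_part raddfB /= rmorphM /= map_polyX map_polyZ.
by rewrite hornerD hornerN hornerM hornerX hornerZ.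
Qed.

End EvenOdd.

(** * De Jonquieres maps preserving the cuspidal cubic *)

Lemma mpolyXU_homog (k : fieldType) (n : nat) (i : 'I_n) :
  ('X_i : {mpoly k[n]}) \is 1.-homog.
Proof. by rewrite dhomogX /= mdeg1. Qed.

Section Pencil.
Variables (k : fieldType) (h : k).
Local Notation S := {mpoly k[3]}.
Local Notation H := (h%:MP : S).

(* Linear coordinates (pN, 'X_1, pZ) adapted to the point [cusp_pt (2 * h)]; the
   lines through that point are the pN = n pZ, and the line through [cusp_pt t]
   is the one with n = (t + h)^2. *)
Definition pZ : S := 'X_(2%:R) - 2 * H * 'X_1.
Definition pN : S := 'X_0 - 2 * H ^+ 3 * 'X_1 - 3 * H ^+ 2 * 'X_(2%:R).
(** On the cubic [pS / 'X_1] is [t + h], a square root of the parameter of the pencil; it serves as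
    coordinate on the lines. *)
Definition pS : S := 'X_(2%:R) + H * 'X_1.

Lemma pSE : pS = pZ + 3 * H * 'X_1.
Proof. by rewrite /pS /pZ; ring. Qed.

Lemma pZ_homog : pZ \is 1.-homog.
Proof.
rewrite /pZ -mulrA mulr_natl mul_mpolyC.
by rewrite rpredB ?rpredMn ?dhomogZ ?mpolyXU_homog.
Qed.

Lemma pN_homog : pN \is 1.-homog.
Proof.
rewrite /pN -!rmorphXn -!mulrA !mulr_natl !mul_mpolyC.
by rewrite !rpredB ?rpredMn ?dhomogZ ?mpolyXU_homog.
Qed.

Lemma pS_homog : pS \is 1.-homog.
Proof.
rewrite /pS mul_mpolyC.
by rewrite rpredD ?dhomogZ ?mpolyXU_homog.
Qed.

Definition pencil_line (n : k) : S := pN - n%:MP * pZ.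

Lemma prime_pencil_line n : prime_elt (pencil_line n).
Proof.
suff -> : pencil_line n = lin_form (2 * h ^+ 3 - 2 * h * n) (3 * h ^+ 2 + n).
  exact: prime_lin_form.
rewrite /lin_form -!mul_mpolyC /pencil_line /pN /pZ.
by rewrite !(rmorphB, rmorphD, rmorphXn, rmorphM, rmorph_nat); ring.
Qed.

Lemma pencil_line_homog n : pencil_line n \is 1.-homog.
Proof.
by rewrite rpredB ?pN_homog // mul_mpolyC dhomogZ // pZ_homog.
Qed.

Section Morphism.
Variables (A : comNzRingType) (g : {rmorphism S -> A}).

Lemma rmorph_pZ : g pZ = g 'X_(2%:R) - 2 * g H * g 'X_1.
Proof. by rewrite rmorphB !rmorphM rmorph_nat. Qed.

Lemma rmorph_pS : g pS = g 'X_(2%:R) + g H * g 'X_1.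
Proof. by rewrite rmorphD rmorphM. Qed.

Lemma rmorph_pN :
  g pN = g 'X_0 - 2 * g H ^+ 3 * g 'X_1 - 3 * g H ^+ 2 * g 'X_(2%:R).
Proof. by rewrite !(rmorphB, rmorphXn, rmorphM, rmorph_nat). Qed.

Lemma rmorph_pencil_line n : g (pencil_line n) = g pN - g n%:MP * g pZ.
Proof. by rewrite rmorphB rmorphM. Qed.

End Morphism.

Lemma pZ_neq0 : pZ != 0.
Proof.
apply/eqP=> /(congr1 (mmap idfun (vec3 0 0 1))).
rewrite rmorph_pZ /= !mmapXU raddf0 !vec3E mulr0 subr0 => /eqP.
by rewrite oner_eq0.
Qed.

(* The generic point of the plane. *)
Lemma pencil_generic : exists (L : fieldType) (g : {rmorphism S -> L}) (nu : L),
  [/\ injective g, g pZ != 0 & g pN = nu * g pZ].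
Proof.
exists {fraction S}, (@tofrac S), (tofrac pN / tofrac pZ).
have Z0 : tofrac pZ != 0 :> {fraction S} by rewrite tofrac_eq0 pZ_neq0.
by split=> //; [move=> x y /eqP; rewrite tofrac_eq => /eqP|rewrite divfK].
Qed.

End Pencil.

(* With c = l * h - h', a map of this form restricts to t |-> l * t + c on the
   cuspidal cubic, and its base points are the [cusp_pt] of 2 * h and of the
   s_i - h. *)
Record dJ_data (k : fieldType) (I : finType) := DJData {
  dj_l : k; dj_h : k; dj_h' : k; dj_s : I -> k }.

Section DeJonquieresForms.
Variables (k : fieldType) (I : finType) (e : nat) (D : dJ_data k I).
Local Notation S := {mpoly k[3]}.
Local Notation l := (dj_l D).
Local Notation h := (dj_h D).
Local Notation h' := (dj_h' D).
Local Notation s := (dj_s D).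
Local Notation N := (pN h).
Local Notation Z := (pZ h).

(** The line through the centre and the simple base point [s i - h] meets the cubic again at
    [- s i - h]. So [dj_inj] and [dj_opp] put the simple base points on distinct lines, and [dj_opp]
    with [i = j] says that the line is not tangent there. [dj_src] and [dj_tgt] separate the simple
    base points from the centre, for the map and for its inverse. [dj_sum] is the divisibility by
    [pZ] of [dJ_UE]. *)
Record dJ_good : Prop := DJGood {
  dj_card : #|I| = e.+1.*2;
  dj_l0 : l != 0;
  dj_inj : injective s;
  dj_opp : forall i j, s i + s j != 0;
  dj_src : forall i, s i != 3 * h;
  dj_tgt : forall i, - (l * s i) != 3 * h';
  dj_sum : 3 * h' = l * (3 * h + odd_lead e s) }.

Definition evenF : S := bform N Z e.+1 (even_part s).
Definition oddF : S := bform N Z e (odd_part s).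
Definition resF : S := bform N Z e (residual_part e s).

(** [dJ_U / l] and [dJ_V] are the coordinates of the product of [E + u O] and [pS + u * 'X_1],
    cleared of denominators. [dJ_W] is the quotient of [dJ_U - 3 h' dJ_V] by [pZ]. The image has
    coordinates [pN h' = l^2 N W], ['X_1 = V], [pZ h' = Z W] for the target pencil, and [dJ_F2],
    [dJ_F0] solve these equations for ['X_2] and ['X_0]. *)
Definition dJ_V : S := oddF * Z * pS h + evenF * 'X_1.
Definition dJ_W : S :=
  l%:MP * evenF - 3 * h'%:MP * oddF * pS h + l%:MP * 'X_1 * resF.
Definition dJ_U : S := l%:MP * (evenF * pS h + N * oddF * 'X_1).
Definition dJ_F2 : S := Z * dJ_W + 2 * h'%:MP * dJ_V.
Definition dJ_F0 : S :=
  l%:MP ^+ 2 * N * dJ_W + 2 * h'%:MP ^+ 3 * dJ_V + 3 * h'%:MP ^+ 2 * dJ_F2.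

Definition dJ_map : 3.-tuple S := [tuple dJ_F0; dJ_V; dJ_F2].

Lemma dJ_map0 : tnth dJ_map 0 = dJ_F0. Proof. by []. Qed.
Lemma dJ_map1 : tnth dJ_map 1 = dJ_V. Proof. by []. Qed.
Lemma dJ_map2 : tnth dJ_map 2%:R = dJ_F2. Proof. by []. Qed.
Definition dJ_mapE := (dJ_map0, dJ_map1, dJ_map2).

Definition dJ_line i : S := pencil_line h (s i ^+ 2).

Section Morphism.
Variables (A : comNzRingType) (g : {rmorphism S -> A}).
Local Notation gc c := (g c%:MP).

Lemma rmorph_dJ_V : g dJ_V = g oddF * g Z * g (pS h) + g evenF * g 'X_1.
Proof. by rewrite rmorphD !rmorphM. Qed.

Lemma rmorph_dJ_W : g dJ_W =
  gc l * g evenF - 3 * gc h' * g oddF * g (pS h) + gc l * g 'X_1 * g resF.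
Proof. by rewrite rmorphD rmorphB !(rmorph_nat, rmorphM). Qed.

Lemma rmorph_dJ_U : g dJ_U =
  gc l * (g evenF * g (pS h) + g N * g oddF * g 'X_1).
Proof. by rewrite rmorphM rmorphD !rmorphM. Qed.

Lemma rmorph_dJ_F2 : g dJ_F2 = g Z * g dJ_W + 2 * gc h' * g dJ_V.
Proof. by rewrite rmorphD !(rmorph_nat, rmorphM). Qed.

Lemma rmorph_dJ_F0 : g dJ_F0 = gc l ^+ 2 * g N * g dJ_W +
  2 * gc h' ^+ 3 * g dJ_V + 3 * gc h' ^+ 2 * g dJ_F2.
Proof. by rewrite rmorphD rmorphD !(rmorph_nat, rmorphXn, rmorphM). Qed.

End Morphism.

Hypothesis good : dJ_good.
Let cardI := dj_card good.
Local Notation gc := (odd_lead e s).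

(** Identities between homogenised forms are checked at the generic point, where [pZ] is invertible
    and they become identities in the parameter [nu = pN / pZ]. *)
Lemma resF_E : Z * resF = N * oddF - gc%:MP * evenF.
Proof.
have [L [g [nu [ginj Z0 gN]]]] := pencil_generic h; apply: ginj.
rewrite rmorphB !rmorphM /= (bform_eval (size_residual_part s cardI) gN).
rewrite (bform_eval (size_odd_part s cardI) gN).
rewrite (bform_eval (size_even_part s cardI) gN) gN.
by rewrite residual_part_eval exprS /=; ring.
Qed.

Lemma even_odd_normF :
  evenF ^+ 2 - N * Z * oddF ^+ 2 = \prod_i dJ_line i.
Proof.
have [L [g [nu [ginj Z0 gN]]]] := pencil_generic h; apply: ginj.
rewrite rmorphB rmorphXn rmorphM rmorphXn rmorphM rmorph_prod /=.
rewrite (bform_eval (size_odd_part s cardI) gN).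
rewrite (bform_eval (size_even_part s cardI) gN) gN.
rewrite (eq_bigr (fun i => g Z * (nu - g (s i)%:MP ^+ 2))); last first.
  by move=> i _; rewrite rmorph_pencil_line gN !rmorphXn; ring.
rewrite big_split prodr_const cardI.
rewrite -(even_odd_norm_eval s cardI (g \o @mpolyC 3 k)) /=.
by rewrite -muln2 exprM [g Z ^+ e.+1]exprS /=; ring.
Qed.

(** Modulo [pZ] one has [pS = 3 h 'X_1] and [N * oddF = odd_lead * evenF], so [dJ_U - 3 h' dJ_V]
    reduces to a multiple of [evenF * 'X_1] whose coefficient vanishes by [dj_sum]. *)
Lemma dJ_UE : dJ_U = Z * dJ_W + 3 * h'%:MP * dJ_V.
Proof.
have h'E : 3 * h'%:MP = l%:MP * (3 * h%:MP + gc%:MP) :> S.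
  have := congr1 (@mpolyC 3 k) (dj_sum good).
  by rewrite !(rmorph_nat, rmorphM, rmorphD).
have -> : Z * dJ_W = l%:MP * Z * evenF - 3 * h'%:MP * Z * oddF * pS h
    + l%:MP * 'X_1 * (Z * resF) by rewrite /dJ_W; ring.
by rewrite resF_E /dJ_U /dJ_V h'E pSE; ring.
Qed.

Section MorphismGood.
Variables (A : comNzRingType) (g : {rmorphism S -> A}).

Lemma rmorph_resF :
  g Z * g resF = g N * g oddF - g (odd_lead e s)%:MP * g evenF.
Proof.
by rewrite -(rmorphM g N) -(rmorphM g _ evenF) -(rmorphB g (N * _)) -resF_E rmorphM.
Qed.

Lemma rmorph_even_odd_normF :
  g evenF ^+ 2 - g N * g Z * g oddF ^+ 2 = \prod_i g (dJ_line i).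
Proof.
rewrite -(rmorph_prod g) -even_odd_normF (rmorphB g (evenF ^+ 2)) (rmorphXn g).
by rewrite (rmorphM g (N * Z)) (rmorphM g N) (rmorphXn g 2 oddF).
Qed.

Lemma rmorph_dj_sum :
  3 * g h'%:MP = g l%:MP * (3 * g h%:MP + g (odd_lead e s)%:MP).
Proof.
have := congr1 (g \o @mpolyC 3 k) (dj_sum good).
by rewrite !(rmorph_nat, rmorphM, rmorphD).
Qed.

End MorphismGood.

End DeJonquieresForms.

Lemma horner_map_DZ (k : fieldType) (A : comNzRingType)
    (g : {rmorphism k -> A}) (p q : {poly k}) c x :
  (map_poly g (p + c *: q)).[x]
  = (map_poly g p).[x] + g c * (map_poly g q).[x].
Proof. by rewrite raddfD /= map_polyZ hornerD hornerZ. Qed.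

Section DeJonquieresGeometry.
Variables (k : fieldType) (I : finType) (e : nat) (D : dJ_data k I).
Local Notation S := {mpoly k[3]}.
Local Notation l := (dj_l D).
Local Notation h := (dj_h D).
Local Notation h' := (dj_h' D).
Local Notation s := (dj_s D).
Local Notation N := (pN h).
Local Notation Z := (pZ h).
Local Notation W := (dJ_W e D).
Local Notation V := (dJ_V e D).
Local Notation Dh := (evenF e D).
Local Notation Ch := (oddF e D).
Local Notation Kh := (resF e D).

Lemma evenF_homog : Dh \is e.+1.-homog.
Proof. by apply: bform_homog; rewrite ?pN_homog ?pZ_homog. Qed.

Lemma oddF_homog : Ch \is e.-homog.
Proof. by apply: bform_homog; rewrite ?pN_homog ?pZ_homog. Qed.

Lemma resF_homog : Kh \is e.-homog.
Proof. by apply: bform_homog; rewrite ?pN_homog ?pZ_homog. Qed.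

Lemma dhomogM_eq n (P Q : S) i j : P \is i.-homog -> Q \is j.-homog ->
  n = (i + j)%N -> P * Q \is n.-homog.
Proof. by move=> hP hQ ->; apply: dhomogM. Qed.

Lemma dhomogCM n (c : k) (P : S) : P \is n.-homog -> c%:MP * P \is n.-homog.
Proof. by move=> hP; rewrite mul_mpolyC dhomogZ. Qed.

Lemma dhomog_natM n m (P : S) : P \is n.-homog -> m%:R * P \is n.-homog.
Proof. by move=> hP; rewrite mulr_natl rpredMn. Qed.

Lemma dJ_V_homog : V \is e.+2.-homog.
Proof.
apply: rpredD.
  apply: (dhomogM_eq (i := e.+1) (j := 1)); rewrite ?pS_homog ?addn1 //.
  by apply: (dhomogM_eq oddF_homog (pZ_homog h)); rewrite addn1.
by apply: (dhomogM_eq evenF_homog (mpolyXU_homog k 1)); rewrite addn1.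
Qed.

Lemma dJ_W_homog : W \is e.+1.-homog.
Proof.
rewrite /dJ_W; apply: rpredD; first apply: rpredB.
- exact: dhomogCM evenF_homog.
- rewrite -!mulrA; apply/dhomog_natM/dhomogCM.
  by apply: (dhomogM_eq oddF_homog (pS_homog h)); rewrite addn1.
- rewrite -mulrA; apply: dhomogCM.
  by apply: (dhomogM_eq (mpolyXU_homog k 1) resF_homog).
Qed.

Lemma dJ_F2_homog : dJ_F2 e D \is e.+2.-homog.
Proof.
apply: rpredD; first exact: (dhomogM_eq (pZ_homog h) dJ_W_homog).
by rewrite -mulrA; apply/dhomog_natM/dhomogCM/dJ_V_homog.
Qed.

Lemma dJ_map_homog i : tnth (dJ_map e D) i \is e.+2.-homog.
Proof.
move: i; apply: forall_I3; rewrite dJ_mapE ?dJ_V_homog ?dJ_F2_homog //.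
rewrite /dJ_F0 -!rmorphXn -!mulrA.
apply: rpredD; first apply: rpredD.
- by apply/dhomogCM/(dhomogM_eq (pN_homog h) dJ_W_homog).
- by apply/dhomog_natM/dhomogCM/dJ_V_homog.
- by apply/dhomog_natM/dhomogCM/dJ_F2_homog.
Qed.

Lemma dJ_line_homog i : dJ_line D i \is 1.-homog.
Proof. exact: pencil_line_homog. Qed.

Hypothesis good : dJ_good e D.
Let cardI := dj_card good.

Section OnCusp.
Variables (A : comNzRingType) (g : {rmorphism S -> A}) (t : A).
Hypotheses (g0 : g 'X_0 = t ^+ 3) (g1 : g 'X_1 = 1) (g2 : g 'X_(2%:R) = t).
Local Notation H := (g h%:MP).

Lemma cusp_pZ : g Z = t - 2 * H.
Proof. by rewrite rmorph_pZ g1 g2 mulr1. Qed.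

Lemma cusp_pN : g N = (t + H) ^+ 2 * g Z.
Proof. by rewrite rmorph_pN rmorph_pZ g0 g1 g2; ring. Qed.

Lemma cusp_pS : g (pS h) = t + H.
Proof. by rewrite rmorph_pS g1 g2 mulr1. Qed.

Lemma cusp_line i : g (dJ_line D i) =
  (t - 2 * H) * (t + H - g (s i)%:MP) * (t + H + g (s i)%:MP).
Proof. by rewrite rmorph_pencil_line cusp_pN cusp_pZ !rmorphXn; ring. Qed.

Lemma cusp_V : g V = (t - 2 * H) ^+ e.+1 * \prod_i (t + H - g (s i)%:MP).
Proof.
rewrite rmorph_dJ_V (bform_eval (size_odd_part s cardI) cusp_pN).
rewrite (bform_eval (size_even_part s cardI) cusp_pN) cusp_pS g1.
rewrite -(root_poly_eval s (g \o @mpolyC 3 k)) /= cusp_pZ [_ ^+ e.+1]exprS; ring.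
Qed.

Lemma cusp_W : g W = (t - 2 * H) ^+ e * (g l%:MP * (t + H) - 3 * g h'%:MP) *
  \prod_i (t + H - g (s i)%:MP).
Proof.
rewrite rmorph_dJ_W (bform_eval (size_odd_part s cardI) cusp_pN).
rewrite (bform_eval (size_even_part s cardI) cusp_pN) cusp_pS g1.
rewrite (bform_eval (size_residual_part s cardI) cusp_pN).
rewrite -(root_poly_eval s (g \o @mpolyC 3 k)) residual_part_eval /= [_ ^+ e.+1]exprS.
by rewrite (rmorph_dj_sum good g) cusp_pZ; ring.
Qed.

Local Notation t' := (g l%:MP * t + g (l * h - h')%:MP).

Lemma cusp_F2 : g (dJ_F2 e D) = g V * t'.
Proof.
rewrite rmorph_dJ_F2 cusp_W cusp_pZ cusp_V !(rmorphB, rmorphM) [_ ^+ e.+1]exprS.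
by ring.
Qed.

Lemma cusp_F0 : g (dJ_F0 e D) = g V * t' ^+ 3.
Proof.
rewrite rmorph_dJ_F0 cusp_F2 cusp_pN cusp_W cusp_pZ cusp_V [_ ^+ e.+1]exprS.
by rewrite !(rmorphB, rmorphM); ring.
Qed.

End OnCusp.

(** Modulo [W] the map is [V] times [cusp_pt (2 * h')]: the curve [W = 0] is contracted to the
    centre of the inverse. The shape is the one [vanish_subst] asks for. *)
Lemma contract_W : exists a b,
  dJ_F0 e D = (2 * h'%:MP) ^+ 3 * V + W * a /\
  dJ_F2 e D = (2 * h'%:MP) * V + W * b.
Proof.
exists (l%:MP ^+ 2 * N + 3 * h'%:MP ^+ 2 * Z), Z.
by rewrite /dJ_F0 /dJ_F2; split; ring.
Qed.

(** At [n = s_i^2] the polynomial [E + s_i O] takes the value of [root_poly] at its root [s_i]. *)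
Lemma even_odd_line i : exists B,
  Dh + (s i)%:MP * Z * Ch = dJ_line D i * B.
Proof.
set P := even_part s + s i *: odd_part s.
have sP : (size P <= e.+2)%N.
  rewrite (leq_trans (size_polyD _ _)) // geq_max size_even_part //=.
  by rewrite (leq_trans (size_scale_leq _ _)) // leqW // size_odd_part.
have [Q QE] : exists Q, P = ('X - (s i ^+ 2)%:P) * Q.
  suff /factor_theorem[Q ->] : root P (s i ^+ 2) by exists Q; rewrite mulrC.
  rewrite rootE hornerD hornerZ.
  have := root_poly_eval s idfun (s i); rewrite !map_poly_id // => ->.
  by apply/eqP; rewrite (bigD1 i) //= subrr mul0r.
have sQ : (size Q <= e.+1)%N.
  have [->|Q0] := eqVneq Q 0; first by rewrite size_poly0.
  by move: sP; rewrite QE mulrC size_Mmonic ?monicXsubC // size_XsubC addn2.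
exists (bform N Z e Q).
rewrite /dJ_line /pencil_line [in RHS]mul_mpolyC -bformXsubC // -QE.
have [L [g [nu [ginj Z0 gN]]]] := pencil_generic h; apply: ginj.
rewrite rmorphD !rmorphM /= (bform_eval (size_odd_part s cardI) gN).
rewrite (bform_eval (size_even_part s cardI) gN) (bform_eval _ gN) //.
by rewrite horner_map_DZ exprS /=; ring.
Qed.

(** The norm vanishes on this line, so the Moebius map is constant there: putting
    [evenF = - s_i Z oddF] and [N = s_i^2 Z] gives [dJ_U = - l s_i dJ_V], a point with
    [t + h' = - l s_i]. *)
Lemma contract_line i : exists a b,
  dJ_F0 e D = (- (l * s i) - h')%:MP ^+ 3 * V + dJ_line D i * a /\
  dJ_F2 e D = (- (l * s i) - h')%:MP * V + dJ_line D i * b.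
Proof.
set q := - (l * s i) - h'; have [B DC] := even_odd_line i.
have F2E : dJ_F2 e D - q%:MP * V = dJ_line D i *
    (l%:MP * (B * pS h + 'X_1 * ((s i)%:MP * B + Ch))).
  have -> : dJ_F2 e D = dJ_U e D - h'%:MP * V.
    by rewrite (dJ_UE good) /dJ_F2; ring.
  rewrite /q rmorphB rmorphN rmorphM /=.
  transitivity (l%:MP * ((Dh + (s i)%:MP * Z * Ch) * pS h + 'X_1 *
     ((s i)%:MP * (Dh + (s i)%:MP * Z * Ch) + Ch * dJ_line D i))).
    by rewrite /dJ_U /dJ_V /dJ_line /pencil_line rmorphXn; ring.
  by rewrite DC; ring.
set b := l%:MP * (_ + _) in F2E.
exists (l%:MP ^+ 2 * W + ((l%:MP * (s i)%:MP) ^+ 2 + 3 * h'%:MP ^+ 2) * b), b.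
have {}F2E : dJ_F2 e D = q%:MP * V + dJ_line D i * b by rewrite -F2E; ring.
split=> //; have ZW : Z * W = dJ_F2 e D - 2 * h'%:MP * V by rewrite /dJ_F2; ring.
have -> : dJ_F0 e D = l%:MP ^+ 2 * dJ_line D i * W + (l%:MP * (s i)%:MP) ^+ 2 * (Z * W)
    + 2 * h'%:MP ^+ 3 * V + 3 * h'%:MP ^+ 2 * dJ_F2 e D.
  by rewrite /dJ_F0 /dJ_line /pencil_line rmorphXn; ring.
by rewrite ZW F2E /q rmorphB rmorphN rmorphM /=; ring.
Qed.

End DeJonquieresGeometry.

(** * The inverse map *)

Definition inv_data (k : fieldType) (I : finType) (D : dJ_data k I) :=
  DJData (dj_l D)^-1 (dj_h' D) (dj_h D) (fun i => - (dj_l D * dj_s D i)).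

Lemma mulr_sum_eq (R : nzRingType) n (x y : R) (F G : 'I_n -> R) :
  (forall j, x * F j = y * G j) -> x * (\sum_j F j) = y * (\sum_j G j).
Proof. by move=> FG; rewrite !mulr_sumr; apply: eq_bigr => j _. Qed.

Section ScaledRoots.
Variables (k : fieldType) (I : finType) (c : k) (s : I -> k).

Lemma coef_comp_scaleX (p : {poly k}) j : (p \Po (c *: 'X))`_j = c ^+ j * p`_j.
Proof.
rewrite comp_polyE (eq_bigr (fun i : 'I_(size p) => (p`_i * c ^+ i) *: 'X^i)).
  rewrite -(poly_def (size p) (fun i => p`_i * c ^+ i)) coef_poly mulrC.
  by case: ltnP => // /(nth_default 0) ->; rewrite mulr0.
by move=> i _; rewrite exprZn scalerA.
Qed.

Lemma coef_root_poly_scale j :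
  c ^+ j * (root_poly (fun i => c * s i))`_j = c ^+ #|I| * (root_poly s)`_j.
Proof.
rewrite -coef_comp_scaleX -coefZ; congr (_`__).
rewrite /root_poly rmorph_prod.
rewrite (eq_bigr (fun i => c%:P * ('X - (s i)%:P))) => [|i _].
  by rewrite big_split prodr_const -mul_polyC polyC_exp.
by rewrite rmorphB /= comp_polyX comp_polyC -mul_polyC polyCM mulrBr.
Qed.

End ScaledRoots.

Section Inverse.
Variables (k : fieldType) (I : finType) (e : nat) (D : dJ_data k I).
Local Notation S := {mpoly k[3]}.
Local Notation l := (dj_l D).
Local Notation h := (dj_h D).
Local Notation h' := (dj_h' D).
Local Notation s := (dj_s D).
Local Notation N := (pN h).
Local Notation Z := (pZ h).
Local Notation W := (dJ_W e D).
Local Notation V := (dJ_V e D).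
Local Notation U := (dJ_U e D).
Local Notation Dh := (evenF e D).
Local Notation Ch := (oddF e D).
Local Notation D' := (inv_data D).
Hypothesis good : dJ_good e D.
Let cardI := dj_card good.

(** The inverse multiplies by the conjugate, whose roots are the [- s_i], and [u |-> l * u] turns
    these into [- l s_i]. The hypotheses on the source and on the target are exchanged. *)
Lemma inv_good : dJ_good e D'.
Proof.
have l0 := dj_l0 good; split=> //=.
- by rewrite invr_eq0.
- by move=> i j /oppr_inj/(mulfI l0)/(dj_inj good).
- by move=> i j; rewrite -opprD oppr_eq0 -mulrDr mulf_neq0 // (dj_opp good).
- exact: dj_tgt good.
- by move=> i; rewrite mulrN opprK mulKf // (dj_src good).
- rewrite (dj_sum good) !(odd_leadE _ cardI) sumrN opprK -mulr_sumr -mulrDr.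
  by rewrite mulKf // subrK.
Qed.

Lemma inv_dataK : inv_data D' = D.
Proof.
have l0 := dj_l0 good; rewrite /inv_data /= invrK.
rewrite (_ : (fun i => _) = dj_s D); first by case: D.
by apply: funext => i; rewrite mulrN opprK mulKf.
Qed.

Lemma dJ_W_neq0 : W != 0.
Proof.
apply/eqP=> /(congr1 (mmap idfun (vec3 1 0 0))).
set g := mmap _ _.
have g1 : g 'X_1 = 0 by rewrite /g mmapXU vec3E.
have g2 : g 'X_(2%:R) = 0 by rewrite /g mmapXU vec3E.
have gZ : g Z = 0 by rewrite /g rmorph_pZ /= -/g g1 g2 mulr0 subr0.
have gS : g (pS h) = 0 by rewrite /g rmorph_pS /= -/g g1 g2 mulr0 addr0.
have gN : g N = 1.
  rewrite /g rmorph_pN /= -/g g1 g2 !mulr0 !subr0.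
  by rewrite /g mmapXU vec3E.
rewrite /g rmorph_dJ_W /= -/g gS g1 !(mulr0, mul0r) subr0 addr0.
rewrite /g raddf0 (bform_Z0 _ _ _ gZ) /= -/g gN expr1n /g.
rewrite (even_part_monic s cardI) !mmapC mulr1 mulr1.
by apply/eqP/(dj_l0 good).
Qed.

Lemma dJ_norm_S : Dh * U - l%:MP * N * Ch * V = l%:MP * \prod_i dJ_line D i * pS h.
Proof. by rewrite -(even_odd_normF good) /dJ_U /dJ_V; ring. Qed.

Lemma dJ_norm_X1 :
  l%:MP * Dh * V - Ch * Z * U = l%:MP * \prod_i dJ_line D i * 'X_1.
Proof. by rewrite -(even_odd_normF good) /dJ_U /dJ_V; ring. Qed.

(** The common factor of the composite with the inverse: each contracted curve, to the power given
    by the multiplicity of the inverse at the point it goes to, hence [d - 1 = e + 1] for [W]. *)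
Definition dJ_jac : S := (- l)%:MP ^+ e.+1.*2 * W ^+ e.+1 * \prod_i dJ_line D i.

Section Pullback.
Variable g : {rmorphism S -> S}.
Hypothesis gC : forall c : k, g c%:MP = c%:MP.
Hypothesis g0 : g 'X_0 = dJ_F0 e D.
Hypothesis g1 : g 'X_1 = V.
Hypothesis g2 : g 'X_(2%:R) = dJ_F2 e D.
Local Notation c := ((- l)%:MP : S).

Lemma pull_pZ : g (pZ h') = Z * W.
Proof. by rewrite (rmorph_pZ _ g) g1 g2 gC /dJ_F2; ring. Qed.

Lemma pull_pN : g (pN h') = l%:MP ^+ 2 * N * W.
Proof. by rewrite (rmorph_pN _ g) g0 g1 g2 gC /dJ_F0; ring. Qed.

Lemma pull_pS : g (pS h') = U.
Proof. by rewrite (rmorph_pS _ g) g1 g2 gC (dJ_UE good) /dJ_F2; ring. Qed.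

Lemma pull_even : g (evenF e D') = c ^+ e.+1.*2 * W ^+ e.+1 * Dh.
Proof.
rewrite bform_rmorph /evenF /bform mulr_sumr; apply: eq_bigr => j _.
have cE : (- l) ^+ j.*2 * (even_part (dj_s D'))`_j
    = (- l) ^+ e.+1.*2 * (even_part s)`_j.
  rewrite !coef_even_poly -cardI -coef_root_poly_scale; congr (_ * _`__).
  by congr root_poly; apply: funext => i /=; rewrite mulNr.
have -> : W ^+ e.+1 = W ^+ j * W ^+ (e.+1 - j).
  by rewrite -exprD subnKC // -ltnS.
rewrite pull_pN pull_pZ gC -!mul_mpolyC !exprMn -rmorphXn.
transitivity (((- l) ^+ j.*2 * (even_part (dj_s D'))`_j)%:MP *
    (N ^+ j * W ^+ j * (Z ^+ (e.+1 - j) * W ^+ (e.+1 - j)))).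
  rewrite rmorphM /= -mul2n exprM sqrrN expr2 exprMn rmorphM !rmorphXn /=.
  by ring.
by rewrite cE rmorphM /= !rmorphXn; ring.
Qed.

(** The coefficient of index [j] of the odd part has index [2 j + 1] in [root_poly]; the additional
    factor [- l] supplies the odd power that [coef_root_poly_scale] needs. *)
Lemma pull_odd : c * g (oddF e D') = c ^+ e.+1.*2 * W ^+ e * Ch.
Proof.
rewrite [g _]bform_rmorph /oddF /bform. apply: mulr_sum_eq => j.
have cE : (- l) ^+ j.*2.+1 * (odd_part (dj_s D'))`_j
    = (- l) ^+ e.+1.*2 * (odd_part s)`_j.
  rewrite !coef_odd_poly -cardI -coef_root_poly_scale; congr (_ * _`__).
  by congr root_poly; apply: funext => i /=; rewrite mulNr.
have -> : W ^+ e = W ^+ j * W ^+ (e - j) by rewrite -exprD subnKC // -ltnS.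
rewrite pull_pN pull_pZ gC -!mul_mpolyC !exprMn -rmorphXn.
transitivity (((- l) ^+ j.*2.+1 * (odd_part (dj_s D'))`_j)%:MP *
    (N ^+ j * W ^+ j * (Z ^+ (e - j) * W ^+ (e - j)))).
  rewrite rmorphM /= exprS -mul2n exprM sqrrN expr2 exprMn.
  by rewrite !(rmorphXn, rmorphM) /=; ring.
by rewrite cE rmorphM /= !rmorphXn; ring.
Qed.

Let c0 : c != 0.
Proof. by rewrite mpolyC_eq0 oppr_eq0 (dj_l0 good). Qed.

Let cE : c = - l%:MP. Proof. exact: rmorphN. Qed.

Lemma pull_V : g (dJ_V e D') = dJ_jac * 'X_1.
Proof.
apply: (mulfI c0); rewrite (rmorph_dJ_V e D' g) pull_pS pull_pZ g1 pull_even.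
transitivity ((c * g (oddF e D')) * (Z * W) * U
  + c * (c ^+ e.+1.*2 * W ^+ e.+1 * Dh) * V); first by ring.
rewrite pull_odd /dJ_jac; set cn := c ^+ _.
transitivity (- (cn * W ^+ e.+1 * (l%:MP * Dh * V - Ch * Z * U))).
  by rewrite cE exprS; ring.
by rewrite dJ_norm_X1 cE; ring.
Qed.

Lemma pull_U : g (dJ_U e D') = dJ_jac * pS h.
Proof.
have cl0 : c * l%:MP != 0 :> S.
  by rewrite mulf_neq0 // mpolyC_eq0 (dj_l0 good).
apply: (mulfI cl0); rewrite (rmorph_dJ_U e D' g) pull_pS pull_pN g1 pull_even gC /=.
have ll : l%:MP * (l^-1)%:MP = 1 :> S.
  by rewrite -rmorphM divff // (dj_l0 good).
transitivity (l%:MP * (l^-1)%:MP * (c * (c ^+ e.+1.*2 * W ^+ e.+1 * Dh) * U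
  + l%:MP ^+ 2 * N * W * (c * g (oddF e D')) * V)); first by ring.
rewrite ll mul1r pull_odd /dJ_jac; set cn := c ^+ _.
transitivity (- (l%:MP * cn * W ^+ e.+1 * (Dh * U - l%:MP * N * Ch * V))).
  by rewrite cE exprS; ring.
by rewrite dJ_norm_S cE; ring.
Qed.

Lemma pull_ZW : g (pZ h' * dJ_W e D') = dJ_jac * Z.
Proof.
have : dJ_jac * pS h = g (pZ h' * dJ_W e D') + 3 * h%:MP * (dJ_jac * 'X_1).
  rewrite -pull_U (dJ_UE inv_good) (rmorphD g) [g (_ * dJ_V _ _)](rmorphM g).
  by rewrite pull_V [g (3 * _)](rmorphM g) (rmorph_nat g) gC.
by rewrite pSE mulrDr => e1; apply: (addIr (3 * h%:MP * (dJ_jac * 'X_1))); rewrite -e1; ring.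
Qed.

Lemma pull_W : g (dJ_W e D') * W = dJ_jac.
Proof.
have := pull_ZW; rewrite (rmorphM g) pull_pZ => e1.
by apply: (mulfI (pZ_neq0 h)); rewrite [RHS]mulrC -e1; ring.
Qed.

Lemma pull_F2 : g (dJ_F2 e D') = dJ_jac * 'X_(2%:R).
Proof.
rewrite (rmorphD g) pull_ZW /= (rmorphM g) (rmorphM g) (rmorph_nat g) gC pull_V /pZ.
by ring.
Qed.

Lemma pull_F0 : g (dJ_F0 e D') = dJ_jac * 'X_0.
Proof.
rewrite (rmorph_dJ_F0 e D' g) pull_F2 pull_V !gC /= pull_pN.
have ll : (l^-1)%:MP ^+ 2 * l%:MP ^+ 2 = 1 :> S.
  by rewrite -exprMn -rmorphM mulVf ?(dj_l0 good) // expr1n.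
transitivity ((l^-1)%:MP ^+ 2 * l%:MP ^+ 2 * N * (g (dJ_W e D') * W)
  + 2 * h%:MP ^+ 3 * (dJ_jac * 'X_1) + 3 * h%:MP ^+ 2 * (dJ_jac * 'X_(2%:R))).
  by ring.
by rewrite ll pull_W /pN; ring.
Qed.

Lemma pull_map i : g (tnth (dJ_map e D') i) = dJ_jac * 'X_i.
Proof. by move: i; apply: forall_I3; rewrite dJ_mapE ?pull_F0 ?pull_V ?pull_F2. Qed.

End Pullback.

Lemma dJ_jac_neq0 : dJ_jac != 0.
Proof.
rewrite /dJ_jac; apply: mulf_neq0; first apply: mulf_neq0.
- by rewrite expf_neq0 // mpolyC_eq0 oppr_eq0 (dj_l0 good).
- by rewrite expf_neq0 // dJ_W_neq0.
- by apply/prodf_neq0 => i _; have [] := prime_pencil_line h (s i ^+ 2).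
Qed.

End Inverse.

(** * Base points *)

Section BasePoints.
Variables (k : fieldType) (I : finType) (e : nat) (D : dJ_data k I).
Local Notation S := {mpoly k[3]}.
Local Notation l := (dj_l D).
Local Notation h := (dj_h D).
Local Notation s := (dj_s D).
Local Notation N := (pN h).
Local Notation Z := (pZ h).
Local Notation W := (dJ_W e D).
Local Notation V := (dJ_V e D).
Local Notation U := (dJ_U e D).
Local Notation Dh := (evenF e D).
Local Notation Ch := (oddF e D).
Hypothesis good : dJ_good e D.
Let cardI := dj_card good.

Lemma line_V (A : comNzRingType) (g : {rmorphism S -> A}) i :
  g (dJ_line D i) = 0 ->
  g V = g Ch * g Z * (g (pS h) - g (s i)%:MP * g 'X_1).
Proof.
move=> gL; have [B /(congr1 g)] := even_odd_line good i.
rewrite (rmorphD g) (rmorphM g) (rmorphM g) (rmorphM g (dJ_line D i)) gL mul0r.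
by move=> /eqP; rewrite addr_eq0 (rmorph_dJ_V e D g) => /eqP ->; ring.
Qed.

Variables (L : fieldType) (g : {rmorphism S -> L}).

Lemma rmorphC_eq0 (c : k) : (g c%:MP == 0) = (c == 0).
Proof. exact: (fmorph_eq0 (g \o @mpolyC 3 k)). Qed.

(** If the odd part vanished at [s_i^2], so would the even part, and [- s_i] would also be a root,
    against [dj_opp]. *)
Lemma line_oddF_neq0 i : g (dJ_line D i) = 0 -> g Z != 0 -> g Ch != 0.
Proof.
move=> gL Z0; have gN : g N = g (s i)%:MP ^+ 2 * g Z.
  move/eqP: gL; rewrite (rmorph_pencil_line h g) subr_eq0 => /eqP ->.
  by rewrite -(rmorphXn g) -rmorphXn.
rewrite (bform_eval (size_odd_part s cardI) gN) mulf_neq0 ?expf_neq0 //.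
apply/eqP=> C0.
have := root_poly_eval s (g \o @mpolyC 3 k) (g (s i)%:MP).
rewrite C0 mulr0 addr0 (bigD1 i) //= subrr mul0r => E0.
have := root_poly_eval s (g \o @mpolyC 3 k) (- g (s i)%:MP).
rewrite sqrrN C0 E0 mulr0 addr0 => /esym/eqP; apply/negP/prodf_neq0 => j _ /=.
rewrite -opprD oppr_eq0 -(rmorphD g) -rmorphD /= rmorphC_eq0.
exact: dj_opp good _ _.
Qed.

(** At a zero, [V], [Z W] and [N W] vanish. Away from the centre this gives [W = 0], hence
    [U = V = 0], and Cramer's rule ([dJ_norm_S], [dJ_norm_X1]) makes the norm vanish. So the zero
    lies on some line [n = s_i^2], where [V = 0] reads [pS = s_i 'X_1]. *)
Lemma dJ_zeros : (exists i, g 'X_i != 0) ->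
    (forall i, g (tnth (dJ_map e D) i) = 0) ->
  exists tau, [/\ tau = 2 * h \/ exists i, tau = s i - h,
    g 'X_1 != 0, g 'X_0 = g tau%:MP ^+ 3 * g 'X_1
    & g 'X_(2%:R) = g tau%:MP * g 'X_1].
Proof.
move=> x0 gF.
have gV : g V = 0 by rewrite -(gF 1) dJ_mapE.
have gF2 : g (dJ_F2 e D) = 0 by rewrite -(gF 2%:R) dJ_mapE.
have gZW : g Z * g W = 0.
  by move: gF2; rewrite (rmorph_dJ_F2 e D g) gV mulr0 addr0.
have gNW : g N * g W = 0.
  have := gF 0; rewrite dJ_mapE (rmorph_dJ_F0 e D g) gV gF2 !mulr0 !addr0 -mulrA.
  move/eqP; rewrite mulf_eq0 expf_eq0 /= rmorphC_eq0 (negPf (dj_l0 good)) /=.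
  by move/eqP.
have [NZ|NZ] := boolP ((g N == 0) && (g Z == 0)).
  have /andP[/eqP gN /eqP gZ] := NZ; exists (2 * h).
  have x2 : g 'X_(2%:R) = g (2 * h)%:MP * g 'X_1.
    move/eqP: gZ; rewrite (rmorph_pZ h g) subr_eq0 => /eqP ->.
    by rewrite rmorphM (rmorphM g) rmorph_nat (rmorph_nat g).
  have xx0 : g 'X_0 = g (2 * h)%:MP ^+ 3 * g 'X_1.
    move/eqP: gN; rewrite (rmorph_pN h g) x2 -addrA -opprD subr_eq0 => /eqP ->.
    by rewrite rmorphM (rmorphM g) rmorph_nat (rmorph_nat g); ring.
  split=> //; first by left.
  apply: contraTneq isT => x1; case: x0; apply: forall_I3.
  - by rewrite xx0 x1 mulr0 eqxx.
  - by rewrite x1 eqxx.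
  - by rewrite x2 x1 mulr0 eqxx.
have gW : g W = 0.
  apply/eqP; apply: contraNT NZ => W0.
  move/eqP: gNW; rewrite mulf_eq0 (negPf W0) orbF => ->.
  by move/eqP: gZW; rewrite mulf_eq0 (negPf W0) orbF.
have gU : g U = 0.
  rewrite (dJ_UE good) (rmorphD g) (rmorphM g) gW mulr0 add0r.
  by rewrite (rmorphM g) gV mulr0.
have l0 : g l%:MP != 0 by rewrite rmorphC_eq0 (dj_l0 good).
have PS : g (\prod_i dJ_line D i) * g (pS h) = 0.
  apply: (mulfI l0); rewrite mulr0 -!(rmorphM g) mulrA -(dJ_norm_S good).
  by rewrite (rmorphB g) (rmorphM g) gU (rmorphM g _ V) gV !mulr0 subrr.
have P1 : g (\prod_i dJ_line D i) * g 'X_1 = 0.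
  apply: (mulfI l0); rewrite mulr0 -!(rmorphM g) mulrA -(dJ_norm_X1 good).
  by rewrite (rmorphB g) (rmorphM g _ V) (rmorphM g _ U) gU gV !mulr0 subrr.
have SZ : g (pS h) = g Z + 3 * g h%:MP * g 'X_1.
  by rewrite pSE (rmorphD g) (rmorphM g) (rmorphM g) (rmorph_nat g).
(* On [pZ = 0] the form [evenF] is [N^(e+1)], because the even part is monic; then [V = W = 0]
   leaves only the centre. *)
have Z0 : g Z != 0.
  apply: contraNneq NZ => gZ; rewrite gZ eqxx andbT.
  have C0 : g Dh = g N ^+ e.+1.
    rewrite (bform_Z0 _ _ _ gZ) (even_part_monic s cardI).
    by rewrite mpolyC1 (rmorph1 g) mul1r.
  have /eqP := gV; rewrite (rmorph_dJ_V e D g) gZ mulr0 mul0r add0r C0.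
  rewrite mulf_eq0 expf_eq0 /= => /orP[//|/eqP x1].
  have /eqP := gW; rewrite (rmorph_dJ_W e D g) SZ gZ x1 !mulr0 addr0 mulr0 mul0r.
  by rewrite subr0 addr0 mulf_eq0 (negPf l0) C0 expf_eq0.
have /eqP : g (\prod_i dJ_line D i) = 0.
  apply/eqP; apply: contraNT Z0 => Pi0.
  move/eqP: PS; rewrite mulf_eq0 (negPf Pi0) SZ /=.
  by move/eqP: P1; rewrite mulf_eq0 (negPf Pi0) /= => /eqP ->; rewrite mulr0 addr0.
rewrite (rmorph_prod g) => /prodf_eq0[i _ /eqP gL].
have gN : g N = g (s i)%:MP ^+ 2 * g Z.
  move/eqP: gL; rewrite (rmorph_pencil_line h g) subr_eq0 => /eqP ->.
  by rewrite -(rmorphXn g) -rmorphXn.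
have Si : g (pS h) = g (s i)%:MP * g 'X_1.
  have /eqP := gV; rewrite (line_V gL) !mulf_eq0 (negPf Z0) orbF.
  by rewrite (negPf (line_oddF_neq0 gL Z0)) subr_eq0 => /eqP.
exists (s i - h).
have tE : g (s i - h)%:MP = g (s i)%:MP - g h%:MP by rewrite rmorphB (rmorphB g).
have x2 : g 'X_(2%:R) = g (s i - h)%:MP * g 'X_1.
  by rewrite tE mulrBl -Si (rmorph_pS h g); ring.
split=> //; first by right; exists i.
  apply: contraNneq Z0 => x1; move: Si; rewrite SZ x1 !mulr0 addr0.
  by move=> ->.
transitivity (g N + 2 * g h%:MP ^+ 3 * g 'X_1 + 3 * g h%:MP ^+ 2 * g 'X_(2%:R)).
  by rewrite (rmorph_pN h g); ring.
by rewrite gN (rmorph_pZ h g) x2 tE; ring.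
Qed.

End BasePoints.

Section Germ.
Variables (k : fieldType) (R : comNzRingType) (f : {rmorphism k -> R}).
Variables (x : 'rV[k]_3) (v : 'I_3 -> R).

(* Restriction to the line through x with direction v. *)
Definition germ : {mpoly k[3]} -> {poly R} :=
  mmap (polyC \o f) (fun i => (f (x 0 i))%:P + 'X * (v i)%:P).

HB.instance Definition _ := GRing.RMorphism.copy germ
  (mmap (polyC \o f) (fun i => (f (x 0 i))%:P + 'X * (v i)%:P)).

Lemma germ_C c : germ c%:MP = (f c)%:P.
Proof. by rewrite /germ mmapC. Qed.

Lemma germ_X i : germ 'X_i = (f (x 0 i))%:P + 'X * (v i)%:P.
Proof. by rewrite /germ mmapXU. Qed.

End Germ.

Section Taylor.
Variable k : fieldType.

Lemma dilate_taylor (x : 'rV[k]_3) (P : {mpoly k[3]}) :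
  dilate (taylor x P) = germ (@mpolyC 3 k) x (fun i => 'X_i) P.
Proof.
rewrite /dilate /taylor /comp_mpoly rmorph_mmap; apply: eq_mmap => [c|i] /=.
  by rewrite mmapC.
by rewrite tnth_mktuple raddfD /= mmapXU mmapC addrC.
Qed.

Lemma taylor_coef (x : 'rV[k]_3) (P : {mpoly k[3]}) mu :
  (taylor x P)@_mu = (germ (@mpolyC 3 k) x (fun i => 'X_i) P)`_(mdeg mu)@_mu.
Proof.
rewrite -dilate_taylor dilateE /pihomog.
rewrite {1}[taylor x P]mpolyE !raddf_sum [RHS]big_mkcond; apply: eq_bigr => m _ /=.
case: eqP => // mm; rewrite mcoeffZ mcoeffX; case: eqP => [e|]; rewrite ?mulr0 //.
by rewrite e in mm.
Qed.

End Taylor.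

Section TaylorMap.
Variables (k L : fieldType) (f : {rmorphism k -> L}).

(** The part of degree [m] at [v] is the coefficient of index [m] along the line through [x] with
    direction [v]; infinitely near base points are thus read off univariate germs. *)
Lemma taylor_map_eval (x : 'rV[k]_3) (v : 'rV[L]_3) (P : {mpoly k[3]}) m :
  (pihomog mdeg m (taylor (map_mx f x) (map_mpoly f P))).@[v 0]
  = (germ f x (v 0) P)`_m.
Proof.
rewrite -dilateE -[LHS](coef_map (meval (v 0))).
rewrite dilate_taylor.
pose g := map_poly (meval (v 0)) \o germ (@mpolyC 3 L) (map_mx f x) (fun i => 'X_i).
suff e : g (map_mpoly f P) = germ f x (v 0) P by rewrite -e.
rewrite /g /map_mpoly (rmorph_mmap _ _ (_ \o _)).
apply: eq_mmap => [c|i]; rewrite /g /=.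
  by rewrite germ_C map_polyC /= mevalC.
rewrite germ_X rmorphD rmorphM /= !map_polyC map_polyX /=.
by rewrite mevalC mevalXU mxE.
Qed.

Lemma evalT_map (T : triple k) (x : 'rV[L]_3) i :
  evalT (mapT f T) x 0 i = mmap f (x 0) (tnth T i).
Proof.
rewrite mxE tnth_map /map_mpoly /meval rmorph_mmap.
by apply: eq_mmap => [c|j] /=; rewrite ?mmapC ?mmapXU.
Qed.

End TaylorMap.

Lemma cusp_pt0 (k : fieldType) (t : k) : cusp_pt t 0 0 = t ^+ 3.
Proof. by rewrite mxE. Qed.
Lemma cusp_pt1 (k : fieldType) (t : k) : cusp_pt t 0 1 = 1.
Proof. by rewrite mxE. Qed.
Lemma cusp_pt2 (k : fieldType) (t : k) : cusp_pt t 0 2%:R = t.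
Proof. by rewrite mxE. Qed.
Definition cusp_ptE := (cusp_pt0, cusp_pt1, cusp_pt2).

Lemma cusp_pt_neq0 (k : fieldType) (t : k) : cusp_pt t != 0.
Proof.
apply/eqP=> /rowP/(_ 1); rewrite cusp_pt1 mxE => /eqP; by rewrite oner_eq0.
Qed.

Lemma proj_eq_cusp_pt (k : fieldType) (t t' : k) :
  proj_eq (cusp_pt t) (cusp_pt t') -> t = t'.
Proof.
case=> c _ /rowP e; have := e 1; have := e 2%:R.
by rewrite !mxE /= mulr1 => -> <-; rewrite mul1r.
Qed.

Section GermAtCusp.
Variables (k : fieldType) (I : finType) (e : nat) (D : dJ_data k I).
Local Notation l := (dj_l D).
Local Notation h := (dj_h D).
Local Notation h' := (dj_h' D).
Local Notation N := (pN h).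
Local Notation Z := (pZ h).
Local Notation W := (dJ_W e D).
Local Notation V := (dJ_V e D).
Local Notation Dh := (evenF e D).
Local Notation Ch := (oddF e D).
Local Notation Kh := (resF e D).
Hypothesis good : dJ_good e D.

Section Center.
Variables (R : comNzRingType) (f : {rmorphism k -> R}) (v : 'I_3 -> R).
Local Notation g := (germ f (cusp_pt (2 * h)) v).
Local Notation d := (mmap f v).

Lemma germ_center_X1 : g 'X_1 = 1 + 'X * (d 'X_1)%:P.
Proof. by rewrite germ_X cusp_pt1 rmorph1 mmapXU. Qed.

Lemma germ_center_pZ : g Z = 'X * (d Z)%:P.
Proof.
rewrite (rmorph_pZ h (germ _ _ _)) (rmorph_pZ h (mmap _ _)) /=.
rewrite !germ_X germ_C !cusp_ptE mmapC !mmapXU.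
by rewrite !(rmorphB, rmorph_nat, rmorphM) rmorph1; ring.
Qed.

Lemma germ_center_pN : g N = 'X * (d N)%:P.
Proof.
rewrite (rmorph_pN h (germ _ _ _)) (rmorph_pN h (mmap _ _)) /=.
rewrite !germ_X germ_C !cusp_ptE mmapC !mmapXU.
by rewrite !(rmorphB, rmorph_nat, rmorphXn, rmorphM) rmorph1; ring.
Qed.

Lemma germ_center_pS : g (pS h) = (3 * f h)%:P + 'X * (d (pS h))%:P.
Proof.
rewrite (rmorph_pS h (germ _ _ _)) (rmorph_pS h (mmap _ _)) /=.
rewrite !germ_X germ_C !cusp_ptE mmapC !mmapXU.
by rewrite !(rmorphD, rmorph_nat, rmorphM) rmorph1; ring.
Qed.

Lemma germ_center_bform n P :
  g (bform N Z n P) = 'X ^+ n * (d (bform N Z n P))%:P.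
Proof.
apply: (@bform_scale _ _ (germ _ _ _) (polyC \o mmap f v)) => [c||] /=.
- by rewrite germ_C mmapC.
- exact: germ_center_pN.
- exact: germ_center_pZ.
Qed.

Lemma germ_center_V : g V = 'X^(e.+1) * ((d Ch * d Z)%:P *
  ((3 * f h)%:P + 'X * (d (pS h))%:P) + (d Dh)%:P * (1 + 'X * (d 'X_1)%:P)).
Proof.
rewrite (rmorph_dJ_V e D (germ _ _ _)) /= !germ_center_bform germ_center_pZ.
by rewrite germ_center_pS germ_center_X1 polyCM exprS; ring.
Qed.

Lemma germ_center_W : g W = 'X^e * ((f l)%:P * 'X * (d Dh)%:P
  - (3 * f h')%:P * (d Ch)%:P * ((3 * f h)%:P + 'X * (d (pS h))%:P)
  + (f l)%:P * (1 + 'X * (d 'X_1)%:P) * (d Kh)%:P).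
Proof.
rewrite (rmorph_dJ_W e D (germ _ _ _)) /= !germ_center_bform.
rewrite germ_center_pS germ_center_X1 !germ_C exprS.
by rewrite !(rmorphM, rmorph_nat); ring.
Qed.

End Center.
End GermAtCusp.

Section Multiplicities.
Variables (k : fieldType) (I : finType) (e : nat) (D : dJ_data k I).
Local Notation l := (dj_l D).
Local Notation h := (dj_h D).
Local Notation h' := (dj_h' D).
Local Notation s := (dj_s D).
Local Notation N := (pN h).
Local Notation Z := (pZ h).
Local Notation Dh := (evenF e D).
Local Notation Ch := (oddF e D).
Local Notation Kh := (resF e D).
Hypothesis good : dJ_good e D.
Let cardI := dj_card good.

(** [N] and [Z] have order one at the centre and [W] has order [e], so every form acquires the
    factor ['X^(e+1)]. [w0] and [v0] are the germs of [W] and [V] without their powers of ['X], and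
    their values at 0 give the tangent cones. *)
Lemma germ_center_map (R : comNzRingType) (f : {rmorphism k -> R})
    (v : 'I_3 -> R) : exists w0 v0 : {poly R},
  [/\ w0.[0] = f l * mmap f v Kh - 9 * f h * f h' * mmap f v Ch,
      v0.[0] = 3 * f h * mmap f v Ch * mmap f v Z + mmap f v Dh
    & forall i, germ f (cusp_pt (2 * h)) v (tnth (dJ_map e D) i) = 'X^(e.+1) *
      vec3 ((f l)%:P ^+ 2 * (mmap f v N)%:P * w0 + 2 * (f h')%:P ^+ 3 * v0 +
            3 * (f h')%:P ^+ 2 * ((mmap f v Z)%:P * w0 + 2 * (f h')%:P * v0))
        v0 ((mmap f v Z)%:P * w0 + 2 * (f h')%:P * v0) i].
Proof.
pose d := mmap f v.
pose w0 := (f l)%:P * 'X * (d Dh)%:P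
  - (3 * f h')%:P * (d Ch)%:P * ((3 * f h)%:P + 'X * (d (pS h))%:P)
  + (f l)%:P * (1 + 'X * (d 'X_1)%:P) * (d Kh)%:P.
pose v0 := (d Ch * d Z)%:P * ((3 * f h)%:P + 'X * (d (pS h))%:P)
  + (d Dh)%:P * (1 + 'X * (d 'X_1)%:P).
have gW := germ_center_W e D f v; rewrite -[X in _ = _ * X]/w0 in gW.
have gV := germ_center_V e D f v; rewrite -[X in _ = _ * X]/v0 in gV.
exists w0, v0; split.
- by rewrite /w0 !(hornerD, hornerN, hornerM, hornerX, hornerC) /d; ring.
- by rewrite /v0 !(hornerD, hornerN, hornerM, hornerX, hornerC) /d; ring.
have gF2 : germ f (cusp_pt (2 * h)) v (dJ_F2 e D)
    = 'X^(e.+1) * ((d Z)%:P * w0 + 2 * (f h')%:P * v0).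
  rewrite (rmorph_dJ_F2 e D (germ _ _ _)) /= gW gV germ_center_pZ germ_C [_ ^+ e.+1]exprS.
  by rewrite /d; ring.
apply: forall_I3; rewrite !vec3E dJ_mapE // (rmorph_dJ_F0 e D (germ _ _ _)) /=.
by rewrite gF2 gW gV germ_center_pN !germ_C [_ ^+ e.+1]exprS /d; ring.
Qed.

(** If [w0] does not vanish at 0, then [N = Z = 0] at once. Otherwise the two leading terms combine
    to [O (N - (3 h)^2 Z) = 0]: the case [O = 0] contradicts [line_oddF_neq0], and [n = (3 h)^2]
    makes [3 h] a root of [root_poly], against [dj_src]. *)
Lemma dJ_center_tangent (L : fieldType) (f : {rmorphism k -> L})
    (v : 'I_3 -> L) :
    (forall i, (germ f (cusp_pt (2 * h)) v (tnth (dJ_map e D) i))`_e.+1 = 0) ->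
  mmap f v N = 0 /\ mmap f v Z = 0.
Proof.
move=> gF; have [w0 [v0 [w00 v00 FE]]] := germ_center_map f v.
pose d := mmap f v.
have d_C c : d c%:MP = f c by rewrite /d mmapC.
have c0 (p : {poly L}) : ('X^(e.+1) * p)`_e.+1 = p.[0].
  by rewrite coefXnM ltnn subnn horner_coef0.
have v0E : v0.[0] = 0 by have := gF 1; rewrite FE c0 vec3E.
have ZW : d Z * w0.[0] = 0.
  have := gF 2%:R; rewrite FE c0 vec3E !(hornerD, hornerM, hornerC) v0E.
  by rewrite mulr0 addr0.
have NW : d N * w0.[0] = 0.
  have := gF 0; rewrite FE c0 vec3E !(hornerD, horner_exp, hornerM, hornerC).
  rewrite v0E ZW !mulr0 !addr0 mulr0 addr0 -mulrA => /eqP.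
  by rewrite mulf_eq0 expf_eq0 /= fmorph_eq0 (negPf (dj_l0 good)) => /eqP.
have [W0|W0] := eqVneq w0.[0] 0; last first.
  by split; apply: (mulIf W0); rewrite mul0r.
rewrite {}W0 in w00; rewrite {}v0E in v00.
have dDh : d Dh = - (3 * f h * d Ch * d Z).
  by apply/eqP; rewrite -addr_eq0 addrC /d -v00.
have [Z0|Z0] := eqVneq (d Z) 0.
  split=> //; apply/eqP; move/eqP: dDh; rewrite Z0 mulr0 oppr0 /d.
  rewrite (bform_Z0 (g := mmap f v) _ _ _ Z0) (even_part_monic s cardI) mpolyC1.
  by rewrite rmorph1 mul1r expf_eq0 /=.
have h'E : 3 * f h' = f l * (3 * f h + f (odd_lead e s)).
  by have := rmorph_dj_sum good (mmap f v); rewrite /= !mmapC.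
have : f l * d Ch * (d N - (3 * f h) ^+ 2 * d Z) = 0.
  have ZK : d Z * d Kh = d N * d Ch - f (odd_lead e s) * d Dh.
    by have := rmorph_resF good (mmap f v); rewrite /= mmapC.
  transitivity (d Z * (f l * d Kh - 9 * f h * f h' * d Ch)); last first.
    by rewrite -w00 mulr0.
  transitivity (f l * (d Z * d Kh) - 3 * f h * (3 * f h') * d Ch * d Z).
    by rewrite ZK h'E dDh; ring.
  by ring.
move/eqP; rewrite !mulf_eq0 fmorph_eq0 (negPf (dj_l0 good)) /=.
case/orP => [/eqP C0|].
  have := rmorph_even_odd_normF good (mmap f v); rewrite /= -/d dDh C0.
  rewrite mulr0 mul0r oppr0 !expr0n mulr0 subr0.
  move/esym/eqP => /prodf_eq0[i _ /eqP Li].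
  by have := line_oddF_neq0 good Li Z0; rewrite /= -/d C0 eqxx.
rewrite subr_eq0 => /eqP dN.
have dN' : mmap f v N = (3 * f h) ^+ 2 * mmap f v Z by [].
have : d Dh + 3 * f h * (d Ch * d Z) = 0 by rewrite dDh; ring.
rewrite /d (bform_eval (g := mmap f v) (size_odd_part s cardI) dN').
rewrite (bform_eval (g := mmap f v) (size_even_part s cardI) dN') /=.
set E := (_.[_]); set O := (_.[_]) => EO.
have : mmap f v Z ^+ e.+1 * (E + 3 * f h * O) = 0.
  by rewrite -EO exprS; ring.
have -> : E + 3 * f h * O = \prod_i (3 * f h - f (s i)).
  rewrite -(root_poly_eval s f); congr (_.[_] + _ * _.[_]);
    by apply: eq_map_poly => c /=; rewrite mmapC.
move/eqP; rewrite mulf_eq0 expf_eq0 (negPf Z0) /=.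
case/prodf_eq0 => i _; rewrite -[3](rmorph_nat f) -rmorphM -rmorphB fmorph_eq0.
by rewrite subr_eq0 eq_sym (negPf (dj_src good i)).
Qed.

End Multiplicities.

Section SimpleBasePoints.
Variables (k : fieldType) (I : finType) (e : nat) (D : dJ_data k I).
Local Notation l := (dj_l D).
Local Notation h := (dj_h D).
Local Notation h' := (dj_h' D).
Local Notation s := (dj_s D).
Local Notation Z := (pZ h).
Local Notation W := (dJ_W e D).
Local Notation V := (dJ_V e D).
Local Notation U := (dJ_U e D).
Local Notation Dh := (evenF e D).
Local Notation Ch := (oddF e D).
Hypothesis good : dJ_good e D.

Section Germ.
Variables (R : comNzRingType) (f : {rmorphism k -> R}) (v : 'I_3 -> R).
Variable tau : k.
Local Notation g := (germ f (cusp_pt tau) v).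

Lemma germ_pencil_line n : g (pencil_line h n) =
  (f ((tau - 2 * h) * ((tau + h) ^+ 2 - n)))%:P
   + 'X * (mmap f v (pencil_line h n))%:P.
Proof.
rewrite (rmorph_pencil_line h (germ _ _ _)) (rmorph_pencil_line h (mmap _ _)).
rewrite (rmorph_pN h (germ _ _ _)) (rmorph_pN h (mmap _ _)).
rewrite (rmorph_pZ h (germ _ _ _)) (rmorph_pZ h (mmap _ _)) /=.
rewrite !germ_X !germ_C !cusp_ptE !mmapC !mmapXU.
rewrite !(rmorphB, rmorph_nat, rmorphD, rmorphXn, rmorphM) rmorph1.
by ring.
Qed.

Lemma germ0 P : (g P).[0] = f (mmap idfun (cusp_pt tau 0) P).
Proof.
rewrite rmorph_mmap -[LHS]/(horner_eval 0 (mmap (polyC \o f)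
  (fun i => (f (cusp_pt tau 0 i))%:P + 'X * (v i)%:P) P)) rmorph_mmap.
apply: eq_mmap => [c|i] /=; first by rewrite /horner_eval hornerC.
by rewrite /horner_eval !(hornerD, hornerM, hornerX, hornerC) mul0r addr0.
Qed.

End Germ.

Lemma cusp_value_map tau i : mmap idfun (cusp_pt tau 0) (tnth (dJ_map e D) i) =
  (tau - 2 * h) ^+ e.+1 * \prod_j (tau + h - s j)
   * cusp_pt (l * tau + (l * h - h')) 0 i.
Proof.
have x0 : mmap idfun (cusp_pt tau 0) 'X_0 = tau ^+ 3 by rewrite mmapXU cusp_pt0.
have x1 : mmap idfun (cusp_pt tau 0) 'X_1 = 1 by rewrite mmapXU cusp_pt1.
have x2 : mmap idfun (cusp_pt tau 0) 'X_(2%:R) = tau by rewrite mmapXU cusp_pt2.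
have VE := cusp_V good x0 x1 x2; have F2E := cusp_F2 good x0 x1 x2.
have F0E := cusp_F0 good x0 x1 x2.
have C c : mmap idfun (cusp_pt tau 0) c%:MP = c by rewrite mmapC.
rewrite /= !C in VE F2E F0E; rewrite VE in F2E F0E.
have PE : \prod_j (tau + h - mmap idfun (cusp_pt tau 0) (s j)%:MP)
   = \prod_j (tau + h - s j) by apply: eq_bigr => j _; rewrite C.
rewrite PE in VE F2E F0E.
by move: i; apply: forall_I3; rewrite dJ_mapE cusp_ptE ?VE ?F2E ?F0E ?mulr1.
Qed.

Lemma dJ_simple_value (R : comNzRingType) (f : {rmorphism k -> R}) v i j :
  (germ f (cusp_pt (s i - h)) v (tnth (dJ_map e D) j)).[0] = 0.
Proof.
by rewrite germ0 cusp_value_map (bigD1 i) //= subrK subrr mul0r mulr0 mul0r rmorph0.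
Qed.

Section Tangent.
Variables (L : fieldType) (f : {rmorphism k -> L}) (v : 'I_3 -> L) (i : I).
Local Notation g := (germ f (cusp_pt (s i - h)) v).
Local Notation d := (mmap f v).

(** The argument of [dJ_zeros] modulo ['X^2]: [U] and [V] vanish to order two, hence so does the
    norm. Only its [i]-th line passes through the point, so [v] lies on that line, and [V] then puts
    [v] on [pS = s_i 'X_1] too. *)
Lemma dJ_simple_tangent : (forall j, (g (tnth (dJ_map e D) j))`_1 = 0) ->
  d 'X_0 = f (s i - h) ^+ 3 * d 'X_1 /\ d 'X_(2%:R) = f (s i - h) * d 'X_1.
Proof.
move=> gF; pose dvd2 (p : {poly L}) := exists q, p = q * 'X^2.
have dM p q : dvd2 q -> dvd2 (p * q).
  by case=> r ->; exists (p * r); rewrite mulrA.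
have dB p q : dvd2 p -> dvd2 q -> dvd2 (p - q).
  by case=> r -> [r' ->]; exists (r - r'); rewrite mulrBl.
have cancel2 (p q : {poly L}) : p.[0] != 0 -> dvd2 (p * q) -> dvd2 q.
  by move=> p0 [r]; apply: mulrXn_coprime.
have dF j : dvd2 (g (tnth (dJ_map e D) j)).
  apply: dvdXn_coef => -[|[|//]] _; last exact: gF.
  by rewrite -horner_coef0 dJ_simple_value.
have dV : dvd2 (g V) by have := dF 1; rewrite dJ_mapE.
have s3h : s i - h - 2 * h != 0.
  rewrite (_ : _ - _ = s i - 3 * h); last by ring.
  by rewrite subr_eq0 (dj_src good).
have gZ0 : (g Z).[0] != 0.
  rewrite germ0 (rmorph_pZ h (mmap _ _)) /= !mmapXU !cusp_ptE mmapC mulr1.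
  by rewrite fmorph_eq0.
have dW : dvd2 (g W).
  apply: (cancel2 (g Z)) => //.
  have -> : g Z * g W = g (dJ_F2 e D) - 2 * (f h')%:P * g V.
    by rewrite (rmorph_dJ_F2 e D (germ _ _ _)) /= germ_C; ring.
  by apply: dB; [have := dF 2%:R; rewrite dJ_mapE|apply: dM].
have dU : dvd2 (g U).
  have -> : g U = g Z * g W - (- (3 * (f h')%:P)) * g V.
    have := congr1 g (dJ_UE good); rewrite (rmorphD (germ _ _ _) (Z * W)) /=.
    rewrite (rmorphM (germ _ _ _) Z) (rmorphM (germ _ _ _) _ V) /= => ->.
    rewrite (rmorphM (germ _ _ _) 3) (rmorph_nat (germ _ _ _)) /= germ_C.
    by ring.
  by apply: dB; apply: dM.
have gl0 : ((f l)%:P : {poly L}).[0] != 0.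
  by rewrite hornerC fmorph_eq0 (dj_l0 good).
have gX1 : (g 'X_1).[0] = 1 by rewrite germ0 mmapXU cusp_pt1 rmorph1.
have dPi : dvd2 (g (\prod_j dJ_line D j)).
  apply: (cancel2 (g 'X_1)); first by rewrite gX1 oner_eq0.
  rewrite mulrC; apply: (cancel2 (f l)%:P) => //; rewrite mulrA.
  have := congr1 g (dJ_norm_X1 good).
  rewrite (rmorphB (germ _ _ _) (l%:MP * Dh * V)) /=.
  rewrite (rmorphM (germ _ _ _) _ V) (rmorphM (germ _ _ _) _ U) /=.
  rewrite (rmorphM (germ _ _ _) _ 'X_1) (rmorphM (germ _ _ _) l%:MP (\prod__ _)).
  by rewrite /= germ_C => <-; apply: dB; apply: dM.
have gline j : (g (dJ_line D j)).[0]
    = f ((s i - h - 2 * h) * ((s i) ^+ 2 - (s j) ^+ 2)).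
  rewrite /dJ_line germ_pencil_line subrK.
  by rewrite !(hornerD, hornerM, hornerX, hornerC) mul0r addr0.
have dLi : dvd2 (g (dJ_line D i)).
  apply: (cancel2 (\prod_(j | j != i) g (dJ_line D j))).
    rewrite -[_.[0]]/(horner_eval 0 _) rmorph_prod; apply/prodf_neq0 => j ji.
    rewrite /= /horner_eval gline fmorph_eq0 mulf_neq0 // subr_sqr mulf_neq0 //.
      by rewrite subr_eq0 (inj_eq (dj_inj good)) eq_sym.
    exact: dj_opp good _ _.
  by rewrite mulrC; move: dPi; rewrite (rmorph_prod (germ _ _ _)) (bigD1 i).
have dX (c : L) : dvd2 ('X * c%:P) -> c = 0.
  case=> r /(congr1 (coefp 1)) /=.
  by rewrite coefXM coefC /= -['X^2]/('X * 'X) mulrA coefMX /= mulrC coefXM.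
have dLi0 : d (dJ_line D i) = 0.
  apply: dX; move: dLi; rewrite /dJ_line germ_pencil_line subrK subrr mulr0.
  by rewrite rmorph0 add0r.
have gLi0 : g (dJ_line D i) = 0.
  rewrite /dJ_line germ_pencil_line subrK subrr mulr0 rmorph0 add0r.
  by rewrite -/(dJ_line D i) dLi0 mulr0.
have gCh0 : (g Ch).[0] != 0.
  pose g0 := horner_eval 0 \o germ f (cusp_pt (s i - h)) v.
  apply: (@line_oddF_neq0 _ _ _ _ good L g0 i); last exact: gZ0.
  by rewrite /g0 /= gLi0 rmorph0.
have dSX : dvd2 (g (pS h) - (f (s i))%:P * g 'X_1).
  apply: (cancel2 (g Ch * g Z)); first by rewrite hornerM mulf_neq0.
  by move: dV; rewrite (line_V good gLi0) /= germ_C.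
have dS : d (pS h) = f (s i) * d 'X_1.
  apply/eqP; rewrite -subr_eq0; apply/eqP/dX; move: dSX.
  rewrite (rmorph_pS h (germ _ _ _)) (rmorph_pS h (mmap _ _)) /=.
  rewrite !germ_X !germ_C !cusp_ptE mmapC !mmapXU.
  rewrite (_ : _ - _ = 'X * (v 2%:R + f h * v 1 - f (s i) * v 1)%:P) //.
  by rewrite !(rmorphB, rmorphD, rmorphM) rmorph1; ring.
have x2 : d 'X_(2%:R) = f (s i - h) * d 'X_1.
  rewrite rmorphB mulrBl -dS (rmorph_pS h (mmap _ _)) /= mmapC; ring.
split=> //; move: dLi0; rewrite (rmorph_pencil_line h (mmap _ _)).
rewrite (rmorph_pN h (mmap _ _)) (rmorph_pZ h (mmap _ _)) /= x2 !mmapC.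
move/eqP => e0; apply/eqP; rewrite -subr_eq0; move: e0; congr (_ == 0).
by rewrite !(rmorphB, rmorphXn); ring.
Qed.

End Tangent.
End SimpleBasePoints.

Section ProperBasePoints.
Variables (k : fieldType) (I : finType) (e : nat) (D : dJ_data k I).
Local Notation h := (dj_h D).
Local Notation s := (dj_s D).

Definition base_param (i : option I) : k := if i is Some j then s j - h else 2 * h.
Definition base_mult (i : option I) : nat := if i is Some _ then 1 else e.+1.

Hypothesis good : dJ_good e D.

Lemma base_param_inj : injective base_param.
Proof.
have b0 j : (s j - h == 2 * h) = false.
  rewrite -subr_eq0 (_ : _ - _ = s j - 3 * h); last by ring.
  by rewrite subr_eq0 (negPf (dj_src good j)).
move=> [i|] [j|] //= /eqP; rewrite ?b0 1?eq_sym ?b0 //.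
by rewrite (inj_eq (addIr _)) => /eqP/(dj_inj good) ->.
Qed.

Lemma dJ_base_pt i : base_pt (dJ_map e D) (cusp_pt (base_param i)).
Proof.
apply/rowP=> j; rewrite !mxE -[LHS]/(mmap idfun _ _) (cusp_value_map good).
case: i => [i|] /=; last by rewrite subrr expr0n !mul0r.
by rewrite (bigD1 i) //= subrK subrr mul0r mulr0 mul0r.
Qed.

Lemma dJ_not_inf_near (L : fieldType) (f : {rmorphism k -> L}) i (v : 'rV[L]_3) :
  ~ inf_near_base_pt (mapT f (dJ_map e D)) (map_mx f (cusp_pt (base_param i)))
      (base_mult i) v.
Proof.
case=> vx inf; set tau := base_param i in vx inf.
have gF j : (germ f (cusp_pt tau) (v 0) (tnth (dJ_map e D) j))`_(base_mult i) = 0.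
  by rewrite -taylor_map_eval; have := inf j; rewrite tnth_map.
suff [v0 v2] : v 0 0 = f tau ^+ 3 * v 0 1 /\ v 0 2%:R = f tau * v 0 1.
  apply: (vx (v 0 1)); apply/rowP; apply: forall_I3; rewrite !mxE /=.
  - by rewrite v0 rmorphXn mulrC.
  - by rewrite rmorph1 mulr1.
  - by rewrite v2 mulrC.
move: @tau vx inf gF; case: i => [i|] /= _ _ gF.
  by have := dJ_simple_tangent good gF; rewrite !mmapXU.
have [] := dJ_center_tangent good gF.
rewrite (rmorph_pN h (mmap _ _)) (rmorph_pZ h (mmap _ _)) /= !mmapC !mmapXU.
rewrite !(rmorphM, rmorph_nat) => + /eqP; rewrite subr_eq0 => e0 /eqP e2.
rewrite e2 in e0 *; split=> //.
by apply/eqP; rewrite -subr_eq0; apply/eqP; rewrite -e0; ring.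
Qed.

Lemma mapT_id (T : triple k) : mapT idfun T = T.
Proof.
apply: eq_from_tnth => i; rewrite tnth_map /map_mpoly -[RHS]mmap_idE.
by apply: eq_mmap.
Qed.

Lemma dJ_mult_at i : mult_at (dJ_map e D) (cusp_pt (base_param i)) (base_mult i).
Proof.
split=> [j mu mui|van].
  rewrite taylor_coef; case: i mui => [i|] /= mui.
    move: mui; rewrite ltnS leqn0 => /eqP ->; rewrite -horner_coef0.
    by rewrite (dJ_simple_value good) mcoeff0.
  have [w0 [v0 [_ _ ->]]] := germ_center_map e D (@mpolyC 3 k) (fun i => 'X_i).
  by rewrite coefXnM mui mcoeff0.
(* One more order of vanishing would make every direction an infinitely near base point, for
   instance that of the cusp. *)
have := @dJ_not_inf_near k idfun i (proj_pt 1 0 0); apply.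
rewrite mapT_id map_mx_id; split=> [c /rowP e1|j].
  have := e1 1; rewrite !mxE /= mulr1 => c0.
  by have := e1 0; rewrite !mxE /= -c0 mul0r => /eqP; rewrite oner_eq0.
rewrite (_ : pihomog _ _ _ = 0) ?meval0 // pihomogE big1 // => mu /eqP mui.
by rewrite van ?scale0r // mui.
Qed.

Lemma dJ_proper_base_points : proper_base_points (dJ_map e D)
  (fun i => cusp_pt (base_param i)) base_mult.
Proof.
split=> [i|i j|i|L f x x0 bx|L f i v].
- by split; [apply: cusp_pt_neq0|apply: dJ_mult_at].
- by move/proj_eq_cusp_pt/base_param_inj.
- exact: dJ_base_pt.
- have [||tau [tauE x1 e0 e2]] := dJ_zeros good (g := mmap f (x 0)).
  + have [i xi] : exists i, x 0 i != 0.
      apply: contrapT => nx; case/eqP: x0; apply/rowP => i; rewrite mxE.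
      by apply/eqP; apply: contrapT => /negP xi; apply: nx; exists i.
    by exists i; rewrite /= mmapXU.
  + by move=> i; rewrite /= -evalT_map bx mxE.
  have [i iE] : exists i, base_param i = tau.
    by case: tauE => [->|[i ->]]; [exists None|exists (Some i)].
  exists i; rewrite iE; rewrite /= !mmapXU mmapC in x1 e0 e2.
  exists (x 0 1) => //; apply/rowP; apply: forall_I3; rewrite !mxE /=.
  + by rewrite e0 rmorphXn mulrC.
  + by rewrite rmorph1 mulr1.
  + by rewrite e2 mulrC.
- exact: dJ_not_inf_near.
Qed.

End ProperBasePoints.

(** * Zeros of forms on the contracted curves *)

Section ContractedCurves.
Variables (k : fieldType) (I : finType) (e : nat) (D : dJ_data k I).
Local Notation S := {mpoly k[3]}.
Local Notation h := (dj_h D).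
Local Notation s := (dj_s D).
Local Notation N := (pN h).
Local Notation Z := (pZ h).
Hypothesis good : dJ_good e D.

Section PencilPoint.
Variables (A : comNzRingType) (g : {rmorphism k -> A}).

(* The point with pencil coordinates (n, y, z). *)
Definition pencil_pt (n y z : A) : 'I_3 -> A :=
  vec3 (n + 2 * g h ^+ 3 * y + 3 * g h ^+ 2 * (z + 2 * g h * y)) y
    (z + 2 * g h * y).

Lemma pencil_ptE (v : 'I_3 -> A) :
  v =1 pencil_pt (mmap g v N) (v 1) (mmap g v Z).
Proof.
apply: forall_I3; rewrite /pencil_pt !vec3E // (rmorph_pZ h (mmap _ _)) /= ?mmapC ?mmapXU.
  by rewrite (rmorph_pN h (mmap _ _)) /= mmapC !mmapXU; ring.
by ring.
Qed.

Lemma pencil_pt_scale a n y z i :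
  pencil_pt (a * n) (a * y) (a * z) i = a * pencil_pt n y z i.
Proof. by move: i; apply: forall_I3; rewrite /pencil_pt !vec3E; ring. Qed.

End PencilPoint.

Lemma rmorph_pencil_pt (A B : comNzRingType) (g : {rmorphism k -> A})
    (g' : {rmorphism k -> B}) (psi : {rmorphism A -> B}) n y z i :
  (forall c, psi (g c) = g' c) ->
  psi (pencil_pt g n y z i) = pencil_pt g' (psi n) (psi y) (psi z) i.
Proof.
move=> gg; move: i; apply: forall_I3; rewrite /pencil_pt !vec3E //.
  rewrite 2!rmorphD !(rmorph_nat, rmorphXn, rmorphM) rmorphD.
  by rewrite !(rmorph_nat, rmorphM) gg.
by rewrite rmorphD !(rmorph_nat, rmorphM) gg.
Qed.

Section Field.
Variables (L : fieldType) (f : {rmorphism k -> L}).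

Lemma algebraic_pencil_pt n y z : algebraicOver f n -> algebraicOver f y ->
  algebraicOver f z -> forall i, algebraicOver f (pencil_pt f n y z i).
Proof.
move=> an ay az.
have az' : algebraicOver f (z + 2 * f h * y).
  apply: algebraic_add => //; apply: algebraic_mul => //.
  by rewrite -(rmorph_nat f) -rmorphM; apply: algebraic_id.
apply: forall_I3; rewrite /pencil_pt vec3E //.
apply: algebraic_add; first (apply: algebraic_add => //); apply: algebraic_mul => //;
  by rewrite -(rmorph_nat f) -rmorphXn -rmorphM; apply: algebraic_id.
Qed.

Lemma algebraic_pencil v : algebraicOver f (mmap f v N / mmap f v Z) ->
    algebraicOver f (v 1 / mmap f v Z) -> mmap f v Z != 0 ->
  proj_algebraic f v.
Proof.
move=> an ay Z0; pose z := mmap f v Z.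
apply: (@proj_algebraic_scale _ _ _ _ (pencil_pt f (mmap f v N / z) (v 1 / z) 1) z).
  move=> i; rewrite -pencil_pt_scale mulr1 ![z * (_ / z)]mulrC !divfK //.
  exact: pencil_ptE.
by apply: algebraic_pencil_pt => //; apply: algebraic1.
Qed.

Lemma algebraic_center v : mmap f v N = 0 -> mmap f v Z = 0 ->
  proj_algebraic f v.
Proof.
move=> N0 Z0.
apply: (@proj_algebraic_scale _ _ _ _ (pencil_pt f 0 1 0) (v 1)).
  move=> i; rewrite -pencil_pt_scale mulr0 mulr1 -{1}N0 -Z0.
  exact: pencil_ptE.
by apply: algebraic_pencil_pt; [apply: algebraic0|apply: algebraic1|apply: algebraic0].
Qed.

End Field.

Lemma algebraic_root (L : fieldType) (f : {rmorphism k -> L}) (R : {poly k}) u u0 :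
  (map_poly f R).[u] = 0 -> R.[u0] != 0 -> algebraicOver f u.
Proof.
move=> Ru Ru0; exists R; last by rewrite rootE Ru.
by apply: contraNneq Ru0 => ->; rewrite horner0.
Qed.

Definition cusp_at (tau : k) : 'I_3 -> k := vec3 (tau ^+ 3) 1 tau.

Lemma cusp_at_pZ tau : mmap idfun (cusp_at tau) Z = tau - 2 * h.
Proof.
by rewrite (cusp_pZ (g := mmap idfun _) D (t := tau)) /= ?mmapC // mmapXU.
Qed.

Lemma cusp_at_pN tau :
  mmap idfun (cusp_at tau) N = (tau + h) ^+ 2 * (tau - 2 * h).
Proof.
rewrite (cusp_pN (g := mmap idfun _) D (t := tau)) /= ?mmapXU ?mmapC //.
by rewrite cusp_at_pZ.
Qed.

(* A form that does not vanish identically on the contracted line has finitely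
   many zeros there, all of them algebraic. *)
Lemma algebraic_zero_line i m (P : S) tau : P \is m.-homog ->
    tau != 2 * h -> (tau + h) ^+ 2 = s i ^+ 2 ->
    mmap idfun (cusp_at tau) P != 0 ->
  forall (L : fieldType) (f : {rmorphism k -> L}) v,
    mmap f v (dJ_line D i) = 0 -> mmap f v P = 0 -> proj_algebraic f v.
Proof.
move=> hP tau2 taus P0 L f v Li Pv.
have vN : mmap f v N = f (s i ^+ 2) * mmap f v Z.
  move/eqP: Li; rewrite (rmorph_pencil_line h (mmap _ _)) /= mmapC subr_eq0.
  by move/eqP.
have [Z0|Z0] := eqVneq (mmap f v Z) 0.
  by apply: algebraic_center => //; rewrite vN Z0 mulr0.
set z := mmap f v Z in vN Z0.
pose R := mmap polyC (pencil_pt polyC ((s i ^+ 2)%:P) 'X 1) P.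
apply: algebraic_pencil => //; first by rewrite vN mulfK //; apply: algebraic_id.
have RE (K : fieldType) (f' : {rmorphism k -> K}) u :
    (map_poly f' R).[u] = mmap f' (pencil_pt f' (f' (s i ^+ 2)) u 1) P.
  pose psi : {rmorphism {poly k} -> K} := horner_eval u \o map_poly f'.
  have psiC c : psi c%:P = f' c by rewrite /= map_polyC /horner_eval hornerC.
  have psiX : psi 'X = u by rewrite /= map_polyX /horner_eval hornerX.
  rewrite -[LHS]/(psi R) /R (rmorph_mmap _ _ psi); apply: eq_mmap => [c|j].
    exact: psiC.
  by rewrite -[LHS]/(psi _) (rmorph_pencil_pt (g' := f')) // psiC rmorph1 psiX.
have t2 : tau - 2 * h != 0 by rewrite subr_eq0.
apply: (@algebraic_root _ _ R _ (tau - 2 * h)^-1).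
  rewrite RE; apply: (mulfI (expf_neq0 m Z0)); rewrite mulr0 -(dhomog_mmap _ _ _ hP).
  rewrite -Pv; apply: eq_mmap => // j; rewrite -pencil_pt_scale mulr1.
  by rewrite [z * (_ / _)]mulrC divfK // mulrC -vN [RHS](pencil_ptE f).
have -> : R = map_poly (idfun : {rmorphism k -> k}) R by rewrite map_poly_id.
rewrite RE.
suff : (tau - 2 * h) ^+ m * mmap idfun
    (pencil_pt idfun (s i ^+ 2) (tau - 2 * h)^-1 1) P != 0.
  by rewrite mulf_eq0 negb_or => /andP[].
rewrite -(dhomog_mmap _ _ _ hP); apply: contraNneq P0 => <-; apply/eqP.
apply: eq_mmap => // j; rewrite -pencil_pt_scale mulr1 divff // -taus.
rewrite [LHS](pencil_ptE idfun) cusp_at_pZ cusp_at_pN; congr pencil_pt.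
by rewrite mulrC.
Qed.

End ContractedCurves.

Section ContractedCurve.
Variables (k : fieldType) (I : finType) (e : nat) (D : dJ_data k I).
Local Notation S := {mpoly k[3]}.
Local Notation l := (dj_l D).
Local Notation h := (dj_h D).
Local Notation h' := (dj_h' D).
Local Notation s := (dj_s D).
Local Notation N := (pN h).
Local Notation Z := (pZ h).
Local Notation W := (dJ_W e D).
Hypothesis good : dJ_good e D.
Let cardI := dj_card good.

(* On pZ != 0 the curve W = 0 is W1(n) + y W2(n) = 0, with y = 'X_1 / pZ. *)
Definition dJ_W1 : {poly k} := l *: even_part s - (3 * h') *: odd_part s.
Definition dJ_W2 : {poly k} :=
  l *: residual_part e s - (9 * h * h') *: odd_part s.

Lemma dJ_W12 (A : comNzRingType) (g : {rmorphism S -> A}) nu :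
  g N = nu * g Z -> g W = g Z ^+ e *
    (g Z * (map_poly (g \o @mpolyC 3 k) dJ_W1).[nu]
     + g 'X_1 * (map_poly (g \o @mpolyC 3 k) dJ_W2).[nu]).
Proof.
move=> gN; rewrite (rmorph_dJ_W e D g) (bform_eval (size_even_part s cardI) gN).
rewrite (bform_eval (size_odd_part s cardI) gN).
rewrite (bform_eval (size_residual_part s cardI) gN).
rewrite (_ : g (pS h) = g Z + 3 * g h%:MP * g 'X_1); last first.
  by rewrite pSE (rmorphD g) (rmorphM g) (rmorphM g) (rmorph_nat g).
rewrite /dJ_W1 /dJ_W2 -!scaleNr !horner_map_DZ !map_polyZ !hornerZ /=.
rewrite !(rmorphN, rmorph_nat, rmorphM) [_ ^+ e.+1]exprS.
by ring.
Qed.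

Section Field.
Variables (L : fieldType) (f : {rmorphism k -> L}).
Local Notation "p @@ x" := ((map_poly f p).[x]) (at level 20).

(** No line of the pencil other than [pZ = 0] lies in [W = 0]. A common zero gives [l E = 3 h' O]
    and [O (l^2 nu - (3 h')^2) = 0]; either [E = O = 0], excluded by [dj_opp], or [- 3 h' / l] is a
    root of [root_poly], excluded by [dj_tgt]. *)
Lemma dJ_W12_coprime nu : dJ_W1 @@ nu = 0 -> dJ_W2 @@ nu != 0.
Proof.
rewrite /dJ_W1 /dJ_W2 -!scaleNr !horner_map_DZ !map_polyZ !hornerZ => W1.
apply/eqP => W2; rewrite residual_part_eval in W2.
set C := (map_poly f (odd_part s)).[nu] in W1 W2.
set E := (map_poly f (even_part s)).[nu] in W1 W2.
have l0 : f l != 0 by rewrite fmorph_eq0 (dj_l0 good).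
have h'E : 3 * f h' = f l * (3 * f h + f (odd_lead e s)).
  by have := congr1 f (dj_sum good); rewrite !(rmorph_nat, rmorphM, rmorphD).
rewrite !(rmorphN, rmorph_nat, rmorphM) in W1 W2.
have C2 : C * (f l ^+ 2 * nu - (3 * f h') ^+ 2) = 0.
  transitivity (f l * (f l * (nu * C - f (odd_lead e s) * E)
      + - (9 * f h * f h') * C)
    + f l * f (odd_lead e s) * (f l * E + - (3 * f h') * C)).
    rewrite (_ : 9 * f h * f h' = 3 * f h * (3 * f h')); last by ring.
    by rewrite h'E; ring.
  by rewrite W1 W2 !mulr0 addr0.
have E0 : f l * E = 3 * f h' * C by rewrite -[RHS]addr0 -W1; ring.
have [C0|C0] := eqVneq C 0.
  have {}E0 : E = 0 by apply: (mulfI l0); rewrite E0 C0 !mulr0.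
  have /eqP := even_odd_norm_eval s cardI f nu.
  rewrite -/C -/E E0 C0 expr0n mulr0 subr0 eq_sym => /prodf_eq0[i _].
  rewrite subr_eq0 => /eqP nuE.
  have := root_poly_eval s f (- f (s i)); rewrite sqrrN -nuE -/E -/C E0 C0.
  rewrite mulr0 addr0 => /esym/eqP; apply/negP/prodf_neq0 => j _.
  by rewrite -opprD oppr_eq0 -rmorphD fmorph_eq0 (dj_opp good).
have nuE : nu = (- (3 * f h' / f l)) ^+ 2.
  move/eqP: C2; rewrite mulf_eq0 (negPf C0) /= subr_eq0 sqrrN expr_div_n.
  by move/eqP => <-; rewrite mulrAC divff ?mul1r // expf_neq0.
have := root_poly_eval s f (- (3 * f h' / f l)); rewrite -nuE -/E -/C.
have -> : E = 3 * f h' / f l * C.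
  by apply: (mulfI l0); rewrite E0; field.
rewrite mulNr subrr => /esym/eqP; apply/negP/prodf_neq0 => j _.
rewrite -opprD oppr_eq0 addrC.
rewrite (_ : _ + _ = f (l * s j + 3 * h') / f l); last first.
  by rewrite rmorphD !rmorphM rmorph_nat; field.
rewrite mulf_neq0 ?invr_eq0 // fmorph_eq0 addrC.
by have := dj_tgt good j; rewrite -subr_eq0 -opprD oppr_eq0 addrC.
Qed.

End Field.

(** By [dJ_W12_coprime] the curve is parametrised by [n], with [y = - W1(n) / W2(n)], so [P]
    restricts to a univariate polynomial. It is nonzero because of its value at [n = (tau + h)^2],
    where the curve meets the cubic. *)
Lemma algebraic_zero_W m (P : S) tau : P \is m.-homog ->
    tau != 2 * h -> l * (tau + h) = 3 * h' -> mmap idfun (cusp_at tau) P != 0 ->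
  forall (L : fieldType) (f : {rmorphism k -> L}) v,
    mmap f v W = 0 -> mmap f v P = 0 -> proj_algebraic f v.
Proof.
move=> hP tau2 tauE P0 L f v Wv Pv.
(* On [pZ = 0] the form [W] is [N^e] times a linear form in [N] and ['X_1], so besides the centre it
   vanishes at a single point, which is defined over [k]. *)
have [Z0|Z0] := eqVneq (mmap f v Z) 0.
  have [N0|N0] := eqVneq (mmap f v N) 0; first exact: algebraic_center N0 Z0.
  have SE : mmap f v (pS h) = 3 * f h * v 1.
    have := congr1 (mmap f v) (pSE h); rewrite (rmorphD (mmap f v) Z) /= Z0 add0r.
    by rewrite !(rmorphM (mmap f v), rmorph_nat (mmap f v)) /= mmapC mmapXU.
  have := Wv; rewrite (rmorph_dJ_W e D (mmap _ _)) !(bform_Z0 _ _ _ Z0) /= SE.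
  rewrite (even_part_monic s cardI) mpolyC1 (rmorph1 (mmap f v)) !mmapC mmapXU exprS.
  set r := (residual_part _ _)`_e; set o := (odd_part _)`_e.
  move=> WE; have NE : f l * mmap f v N = f (9 * h' * o * h - l * r) * v 1.
    apply: (mulfI (expf_neq0 e N0)); apply/eqP; rewrite -subr_eq0 -WE; apply/eqP.
    by rewrite rmorphB !(rmorph_nat, rmorphM); ring.
  apply: (@proj_algebraic_scale _ _ _ _ (pencil_pt D f
    (f ((9 * h' * o * h - l * r) / l)) 1 0) (v 1)).
    move=> i; rewrite -pencil_pt_scale mulr0 mulr1 -{1}Z0 [LHS](pencil_ptE D f).
    congr (pencil_pt _ _ _ _ _ i).
    apply: (@mulfI _ (f l)); first by rewrite fmorph_eq0 (dj_l0 good).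
    rewrite NE mulrCA -rmorphM mulrCA divff ?(dj_l0 good) // mulr1 mulrC.
    by [].
  apply: algebraic_pencil_pt; by [apply: algebraic_id|apply: algebraic1|apply: algebraic0].
set z := mmap f v Z in Z0; pose nu := mmap f v N / z; pose y := v 1 / z.
have vN : mmap f v N = nu * z by rewrite divfK.
pose Pt := pencil_pt D polyC ('X * dJ_W2) (- dJ_W1) dJ_W2.
pose R := mmap polyC Pt P.
have RE (K : fieldType) (f' : {rmorphism k -> K}) u : (map_poly f' R).[u]
  = mmap f' (pencil_pt D f' (u * (map_poly f' dJ_W2).[u])
     (- (map_poly f' dJ_W1).[u]) (map_poly f' dJ_W2).[u]) P.
  pose psi : {rmorphism {poly k} -> K} := horner_eval u \o map_poly f'.
  have psiC c : psi c%:P = f' c by rewrite /= map_polyC /horner_eval hornerC.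
  have psiX : psi 'X = u by rewrite /= map_polyX /horner_eval hornerX.
  rewrite -[LHS]/(psi R) /R (rmorph_mmap _ _ psi); apply: eq_mmap => [c|j].
    exact: psiC.
  by rewrite -[LHS]/(psi _) (rmorph_pencil_pt D (g' := f')) // rmorphM rmorphN psiX.
have on_W (K : fieldType) (f' : {rmorphism k -> K}) (v' : 'I_3 -> K) nu' :
    mmap f' v' N = nu' * mmap f' v' Z -> mmap f' v' Z != 0 -> mmap f' v' W = 0 ->
    (map_poly f' dJ_W2).[nu'] != 0 /\ v' 1 / mmap f' v' Z
      = - (map_poly f' dJ_W1).[nu'] / (map_poly f' dJ_W2).[nu'].
  move=> N' Z' W'; have := dJ_W12 (g := mmap f' v') N'; rewrite /= W'.
  have mE p : map_poly (mmap f' v' \o @mpolyC 3 k) p = map_poly f' p.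
    by apply: eq_map_poly => c /=; rewrite mmapC.
  rewrite !mE mmapXU => /esym/eqP; rewrite mulf_eq0 expf_eq0 (negPf Z') andbF /=.
  rewrite addr_eq0 => /eqP WE.
  have W2 : (map_poly f' dJ_W2).[nu'] != 0.
    apply/negP => /eqP W2; have /eqP := WE; rewrite W2 mulr0 oppr0 mulf_eq0.
    by rewrite (negPf Z') /= => /eqP/dJ_W12_coprime; rewrite W2 eqxx.
  split=> //; apply: (mulIf W2); rewrite divfK //; apply: (mulfI Z').
  by rewrite mulrN WE opprK; field.
have [W2 yE] := on_W _ _ _ _ vN Z0 Wv.
have nualg : algebraicOver f nu.
  pose n0 := (tau + h) ^+ 2; have t2 : tau - 2 * h != 0 by rewrite subr_eq0.
  have N' := cusp_at_pN D tau; have Z' := cusp_at_pZ D tau.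
  rewrite -Z' in N'.
  have [||W2' yE'] := on_W k idfun (cusp_at tau) n0 N'.
  - by rewrite Z'.
  - rewrite (cusp_W good (g := mmap idfun _) (t := tau)) /= ?mmapXU ?mmapC //.
    by rewrite tauE subrr mulr0 mul0r.
  rewrite /cusp_at vec3_1 Z' in yE'.
  apply: (@algebraic_root _ _ _ R nu n0).
    rewrite RE; apply: (mulfI (expf_neq0 m (mulf_neq0 Z0 (invr_neq0 W2)))).
    rewrite mulr0 -(dhomog_mmap _ _ _ hP) -Pv; apply: eq_mmap => // j.
    rewrite -pencil_pt_scale [RHS](pencil_ptE D f) vN -/z.
    congr (pencil_pt _ _ _ _ _ j).
    - by field.
    - by rewrite -mulrA [_^-1 * _]mulrC -yE mulrC divfK.
    - by field.
  have -> : R = map_poly (idfun : {rmorphism k -> k}) R by rewrite map_poly_id.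
  rewrite RE.
  set w2 := (map_poly _ dJ_W2).[n0] in W2' yE' *.
  set w1 := (map_poly _ dJ_W1).[n0] in yE' *.
  suff : ((tau - 2 * h) / w2) ^+ m *
      mmap idfun (pencil_pt D idfun (n0 * w2) (- w1) w2) P != 0.
    by rewrite mulf_eq0 negb_or => /andP[].
  rewrite -(dhomog_mmap _ _ _ hP); apply: contraNneq P0 => <-; apply/eqP.
  apply: eq_mmap => // j; rewrite -pencil_pt_scale [LHS](pencil_ptE D idfun) N' Z'.
  congr (pencil_pt _ _ _ _ _ j).
  - by rewrite /n0; field.
  - by rewrite -mulrA [_^-1 * _]mulrC -yE' /cusp_at vec3_1 mulrC divfK.
  - by field.
apply: (algebraic_pencil nualg _ Z0); rewrite yE.
have aW p : algebraicOver f (map_poly f p).[nu].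
  rewrite horner_coef; apply: algebraic_sum => i _; rewrite coef_map.
  apply: algebraic_mul; first exact: algebraic_id.
  by elim: (i : nat) => [|j IH]; [apply: algebraic1|rewrite exprS; apply: algebraic_mul].
by apply: algebraic_div => //; apply: algebraic_opp.
Qed.

End ContractedCurve.

(** * Iterates *)

Section VanishComp.
Variable k : fieldType.
Local Notation S := {mpoly k[3]}.
Implicit Types (P : S) (F : 3.-tuple S) (tau : k).

Lemma comp_mpolyE_mmap P F : P \mPo F = mmap (@mpolyC 3 k) (tnth F) P.
Proof. by []. Qed.

Lemma dhomog_comp d m P F : (forall i, tnth F i \is d.-homog) ->
  P \is m.-homog -> P \mPo F \is (d * m).-homog.
Proof.
move=> hF hP; apply/dilate_homog; rewrite comp_mpolyE_mmap.
rewrite /dilate (rmorph_mmap _ _ (mmap _ _)).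
transitivity (mmap (polyC \o @mpolyC 3 k) (fun i => 'X^d * (tnth F i)%:P) P).
  apply: eq_mmap => [c|i] /=; first by rewrite mmapC.
  exact/dilate_homog.
rewrite (dhomog_mmap _ (fun i => (tnth F i)%:P) ('X^d) hP) exprM.
congr (_ * _); exact: esym (rmorph_mmap _ _ polyC _).
Qed.

Lemma expand_at_C tau c : expand_at tau c%:MP = c%:MP%:P.
Proof. by rewrite /expand_at mmapC. Qed.

Lemma expand_at0 tau m P : P \is m.-homog ->
  (expand_at tau P)`_0 = 'X_1 ^+ m * (mmap idfun (cusp_at tau) P)%:MP.
Proof.
move=> hP; rewrite -horner_coef0 -[LHS]/(horner_eval 0 _) /expand_at.
rewrite (rmorph_mmap _ _ (horner_eval 0)).
rewrite (rmorph_mmap _ _ (@mpolyC 3 k)) -(dhomog_mmap _ _ _ hP).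
apply: eq_mmap => [c|] /=; first by rewrite /horner_eval hornerC.
apply: forall_I3; rewrite /= /cusp_germ /cusp_at !vec3E /horner_eval.
- rewrite hornerD [(_ * _).[0] in X in X + _]hornerM hornerC hornerC.
  by rewrite [(_ * _).[0]]hornerM hornerX mul0r addr0 rmorphXn mulrC.
- by rewrite hornerC mpolyC1 mulr1.
- rewrite hornerD [(_ * _).[0] in X in X + _]hornerM hornerC hornerC.
  by rewrite [(_ * _).[0]]hornerM hornerX mul0r addr0 mulrC.
Qed.

Lemma vanish_zero tau m P : P \is m.-homog -> mmap idfun (cusp_at tau) P = 0 ->
  vanish tau 1 P.
Proof.
move=> hP P0; have [|q qE] := @dvdXn_coef _ (expand_at tau P) 1; last by exists q.
by case=> // _; rewrite (expand_at0 tau hP) P0 mpolyC0 mulr0.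
Qed.

Lemma vanish_comp tau tau' nu m P F : (forall i, tnth F i \is m.-homog) ->
    mmap idfun (cusp_at tau) (tnth F 0)
      = tau' ^+ 3 * mmap idfun (cusp_at tau) (tnth F 1) ->
    mmap idfun (cusp_at tau) (tnth F 2%:R)
      = tau' * mmap idfun (cusp_at tau) (tnth F 1) ->
  vanish tau' nu P -> vanish tau nu (P \mPo F).
Proof.
move=> hF F0 F2 vP; pose x := expand_at tau \o tnth F.
have diff j (c : k) : mmap idfun (cusp_at tau) (tnth F j)
      = c * mmap idfun (cusp_at tau) (tnth F 1) ->
    exists a, x j = c%:MP%:P * x 1 + 'X * a.
  move=> Fj; have [||q] := @vanish_zero tau m (tnth F j - c%:MP * tnth F 1).
  - by apply: rpredB; [exact: hF|rewrite mul_mpolyC dhomogZ].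
  - by rewrite (rmorphB (mmap _ _)) (rmorphM (mmap _ _)) /= mmapC Fj subrr.
  rewrite (rmorphB (expand_at tau)) (rmorphM (expand_at tau)) /= => e.
  exists q; rewrite [X in _ + X]mulrC -[X in _ + X]e addrC /x /=.
  by rewrite expand_at_C subrK.
have [a x0] := diff 0 _ F0; have [b x2] := diff 2%:R _ F2.
have [||q qE] := @vanish_subst _ _ (polyC \o @mpolyC 3 k) tau' nu P x 'X a b vP.
- by rewrite x0 /= !rmorphXn.
- by rewrite x2.
have e1 : expand_at tau (P \mPo F) = mmap (polyC \o @mpolyC 3 k) x P.
  rewrite comp_mpolyE_mmap {1}/expand_at (rmorph_mmap _ _ (mmap _ _)).
  by apply: eq_mmap => // c; rewrite /= mmapC.
by exists q; apply: etrans e1 qE.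
Qed.

Lemma vanish_comp_base tau m n P F : (forall i, vanish tau m (tnth F i)) ->
  P \is n.-homog -> vanish tau (m * n) (P \mPo F).
Proof.
move=> vF hP.
have /choice[q qE] i : exists q : {poly S}, expand_at tau (tnth F i) = 'X^m * q.
  by have [q ->] := vF i; exists q; rewrite mulrC.
have e1 : expand_at tau (P \mPo F)
    = mmap (polyC \o @mpolyC 3 k) (fun i => 'X^m * q i) P.
  rewrite comp_mpolyE_mmap {1}/expand_at (rmorph_mmap _ _ (mmap _ _)).
  by apply: eq_mmap => // c; rewrite /= mmapC.
exists (mmap (polyC \o @mpolyC 3 k) q P).
by rewrite e1 (dhomog_mmap _ q ('X^m) hP) -exprM mulrC.
Qed.

Lemma mup_comp_affine (p : {poly k}) c d x : c != 0 -> p != 0 ->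
  mup x (p \Po (c%:P * 'X + d%:P)) = mup (c * x + d) p.
Proof.
move=> c0 p0; have [m [q]] := multiplicity_XsubC p (c * x + d).
rewrite p0 /= => qx ->.
rewrite mupMr // mup_XsubCX eqxx rmorphM rmorphXn rmorphB /= comp_polyX comp_polyC.
rewrite (_ : c%:P * 'X + d%:P - _ = c%:P * ('X - x%:P)); last first.
  by rewrite polyCD polyCM; ring.
rewrite mupMr; last by rewrite rootE horner_comp !hornerE.
by rewrite exprMn mupMr ?mup_XsubCX ?eqxx // -polyC_exp rootC expf_neq0.
Qed.

End VanishComp.

Section VanishClosure.
Variables (k : fieldType) (tau : k).
Local Notation S := {mpoly k[3]}.
Implicit Types P Q : S.

Lemma vanishD n P Q : vanish tau n P -> vanish tau n Q -> vanish tau n (P + Q).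
Proof.
by case=> p pE [q qE]; exists (p + q); rewrite (rmorphD (expand_at tau)) /= pE qE mulrDl.
Qed.

Lemma vanish_mull n P Q : vanish tau n Q -> vanish tau n (P * Q).
Proof. exact: vanish_mul (vanish0 tau P). Qed.

Lemma vanish_mulr n P Q : vanish tau n P -> vanish tau n (P * Q).
Proof. by rewrite mulrC; apply: vanish_mull. Qed.

Lemma vanishX n P : vanish tau 1 P -> vanish tau n (P ^+ n).
Proof.
move=> vP; elim: n => [|n IH]; first exact: vanish0.
by rewrite exprS -add1n; apply: vanish_mul.
Qed.

Lemma vanish_bform N Z n (p : {poly k}) : vanish tau 1 N -> vanish tau 1 Z ->
  vanish tau n (bform N Z n p).
Proof.
move=> vN vZ; rewrite /bform; elim/big_ind: _ => [||j _].
- by exists 0; rewrite mul0r (rmorph0 (expand_at tau)).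
- exact: vanishD.
rewrite -mul_mpolyC; apply: vanish_mull.
by rewrite -{1}(subnKC (n := n) (m := j)) -1?ltnS //; apply: vanish_mul; apply: vanishX.
Qed.

End VanishClosure.

Lemma cusp_ptE_at (k : fieldType) (tau : k) j : cusp_pt tau 0 j = cusp_at tau j.
Proof. by move: j; apply: forall_I3; rewrite cusp_ptE /cusp_at vec3E. Qed.

Section VanishBase.
Variables (k : fieldType) (I : finType) (e : nat) (D : dJ_data k I).
Local Notation l := (dj_l D).
Local Notation h := (dj_h D).
Local Notation h' := (dj_h' D).
Local Notation s := (dj_s D).
Local Notation N := (pN h).
Local Notation Z := (pZ h).
Local Notation W := (dJ_W e D).
Local Notation V := (dJ_V e D).
Hypothesis good : dJ_good e D.

Lemma cusp_at_map tau j : mmap idfun (cusp_at tau) (tnth (dJ_map e D) j) =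
  (tau - 2 * h) ^+ e.+1 * \prod_i (tau + h - s i)
   * cusp_at (l * tau + (l * h - h')) j.
Proof.
rewrite -cusp_ptE_at -(cusp_value_map good); apply: eq_mmap => // c.
by rewrite cusp_ptE_at.
Qed.

Lemma dJ_vanish_base i j :
  vanish (base_param D i) (base_mult e i) (tnth (dJ_map e D) j).
Proof.
case: i => [i|].
  apply: vanish_zero (dJ_map_homog _ _ _) _.
  by rewrite cusp_at_map /= (bigD1 i) //= subrK subrr mul0r mulr0 mul0r.
have vZ : vanish (2 * h) 1 Z.
  by apply: vanish_zero (pZ_homog h) _; rewrite cusp_at_pZ subrr.
have vN : vanish (2 * h) 1 N.
  by apply: vanish_zero (pN_homog h) _; rewrite cusp_at_pN subrr mulr0.
have vV : vanish (2 * h) e.+1 V.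
  apply: vanishD; apply: vanish_mulr; last exact: vanish_bform.
  by rewrite -[e.+1]addn1; apply: vanish_mul => //; apply: vanish_bform.
have vW : vanish (2 * h) e W.
  apply: vanishD; first apply: vanishD.
  - by apply: vanish_mull; apply: (vanish_le (leqnSn e)); apply: vanish_bform.
  - rewrite -mulNr; apply: vanish_mulr; rewrite -mulNr; apply: vanish_mull.
    exact: vanish_bform.
  - by apply: vanish_mull; apply: vanish_bform.
have vF2 : vanish (2 * h) e.+1 (dJ_F2 e D).
  apply: vanishD; last exact: vanish_mull.
  by rewrite -[e.+1]add1n; apply: vanish_mul.
move: j; apply: forall_I3; rewrite dJ_mapE; [|exact: vV|exact: vF2].
have vNW := vanish_mul (vanish_mull (l%:MP ^+ 2) vN) vW.
exact: vanishD (vanishD vNW (vanish_mull _ vV)) (vanish_mull _ vF2).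
Qed.

End VanishBase.

Lemma mup_prod (k : fieldType) (I : Type) (r : seq I) (F : I -> {poly k}) x :
  (forall i, F i != 0) -> mup x (\prod_(i <- r) F i) = (\sum_(i <- r) mup x (F i))%N.
Proof.
move=> F0; elim: r => [|i r IH]; first by rewrite !big_nil mupNroot ?root1.
rewrite !big_cons mupM ?IH //; apply: (big_ind (fun p => p != 0)) => //.
  exact: oner_neq0.
by move=> *; apply: mulf_neq0.
Qed.

Lemma mup_exp (k : fieldType) (p : {poly k}) n x : p != 0 ->
  mup x (p ^+ n) = (n * mup x p)%N.
Proof.
move=> p0; elim: n => [|n IH]; first by rewrite mupNroot ?root1.
by rewrite exprS mupM ?expf_neq0 // IH mulSn.
Qed.

Lemma mup_XsubC (k : fieldType) (x y : k) : mup x ('X - y%:P) = (y == x).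
Proof. by have := mup_XsubCX 1 x y; rewrite expr1 => ->; case: eqP. Qed.

(** * Orbits on the cubic and orders of the contracted curves along them *)

Section Orbits.
Variables (k : fieldType) (I : finType) (e : nat) (D : dJ_data k I).
Local Notation S := {mpoly k[3]}.
Local Notation l := (dj_l D).
Local Notation h := (dj_h D).
Local Notation h' := (dj_h' D).
Local Notation s := (dj_s D).
Hypothesis good : dJ_good e D.
Variables (n : option I -> nat) (Q : option I -> nat -> k).

(* [Q i a] is the parameter of the point q_i^(a - 1) of the cuspidal cubic; thus
   [Q i 0] lies on the curve contracted to q_i. *)
Record dJ_orbits : Prop := DJOrbits {
  orb_step : forall i a, Q i a.+1 = l * Q i a + (l * h - h');
  orb_inj : forall i j a b, Q i a = Q j b -> i = j /\ a = b;
  orb_start : forall i, Q i 1 = base_param (inv_data D) i;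
  orb_end : forall i, Q i (n i) = base_param D i;
  orb_len : forall i, (0 < n i)%N }.

Hypothesis orb : dJ_orbits.

Lemma orb_eq i j a b : (Q i a == Q j b) = (i == j) && (a == b).
Proof.
apply/eqP/andP => [/(orb_inj orb)[-> ->]|[/eqP -> /eqP ->]] //.
Qed.

Lemma orb_mup i j a b : mup (Q i a) ('X - (Q j b)%:P) = (j == i) && (b == a).
Proof. by rewrite mup_XsubC orb_eq. Qed.

Let l0 : l != 0. Proof. exact: dj_l0 good. Qed.

Lemma orb0_center : l * (Q None 0 + h) = 3 * h'.
Proof.
have := orb_start orb None; rewrite (orb_step orb) /= => e1.
rewrite (_ : 3 * h' = 2 * h' + h'); last by ring.
by rewrite -e1; ring.
Qed.

Lemma orb0_line i : Q (Some i) 0 = - s i - h.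
Proof.
have := orb_start orb (Some i); rewrite (orb_step orb) /= => e1.
apply: (mulfI l0); rewrite -[LHS](addrK (l * h - h')) e1; ring.
Qed.

Definition cusp_factor : {poly k} :=
  ('X - (Q None (n None))%:P) ^+ e.+1 * \prod_i ('X - (Q (Some i) (n (Some i)))%:P).

Lemma cusp_factor_neq0 : cusp_factor != 0.
Proof.
rewrite mulf_neq0 ?expf_neq0 ?polyXsubC_eq0 //.
by apply/prodf_neq0 => i _; rewrite polyXsubC_eq0.
Qed.

Definition cusp_action : {poly k} := l%:P * 'X + (l * h - h')%:P.

Lemma cusp_restr_map j : cusp_restr (tnth (dJ_map e D) j)
  = cusp_factor * vec3 (cusp_action ^+ 3) 1 cusp_action j.
Proof.
have x0 : cusp_restr 'X_0 = 'X ^+ 3 :> {poly k} by rewrite /cusp_restr mmapXU vec3E.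
have x1 : cusp_restr 'X_1 = 1 :> {poly k} by rewrite /cusp_restr mmapXU vec3E.
have x2 : cusp_restr 'X_(2%:R) = 'X :> {poly k} by rewrite /cusp_restr mmapXU vec3E.
have C (c : k) : cusp_restr c%:MP = c%:P by rewrite /cusp_restr mmapC.
have VE : cusp_restr (dJ_V e D) = cusp_factor.
  rewrite (cusp_V good (g := @cusp_restr k) x0 x1 x2) /cusp_factor /= !C.
  rewrite (orb_end orb) /= polyCM (_ : 2%:P = 2); last exact: (rmorph_nat polyC).
  congr (_ * _); apply: eq_bigr => i _.
  by rewrite !C (orb_end orb) /= polyCB; ring.
move: j; apply: forall_I3; rewrite dJ_mapE !vec3E ?mulr1 //.
  by rewrite (cusp_F0 good (g := @cusp_restr k) x0 x1 x2) /= VE !C.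
by rewrite (cusp_F2 good (g := @cusp_restr k) x0 x1 x2) /= VE !C.
Qed.

Lemma mup_cusp_factor i a : mup (Q i a) cusp_factor =
  if a == n i then base_mult e i else 0%N.
Proof.
rewrite mupM ?expf_neq0 ?polyXsubC_eq0 //; last first.
  by apply/prodf_neq0 => j _; rewrite polyXsubC_eq0.
rewrite mup_exp ?polyXsubC_eq0 // orb_mup mup_prod => [|j]; last first.
  by rewrite polyXsubC_eq0.
case: i => [i|] /=.
  rewrite muln0 add0n (bigD1 i) //= orb_mup eqxx /= big1 ?addn0 => [|j ji].
    by rewrite eq_sym; case: eqP.
  by rewrite orb_mup (inj_eq Some_inj) (negPf ji).
rewrite big1 => [|j _]; last by rewrite orb_mup.
by rewrite addn0 eq_sym; case: eqP; rewrite ?muln1 ?muln0.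
Qed.

Variable mu : option I -> nat.

Definition contracted : S :=
  dJ_W e D ^+ mu None * \prod_i dJ_line D i ^+ mu (Some i).

Lemma cusp_restr_W : cusp_restr (dJ_W e D) =
  ('X - (Q None (n None))%:P) ^+ e * (l%:P * ('X - (Q None 0)%:P))
   * \prod_i ('X - (Q (Some i) (n (Some i)))%:P).
Proof.
have x0 : cusp_restr 'X_0 = 'X ^+ 3 :> {poly k} by rewrite /cusp_restr mmapXU vec3E.
have x1 : cusp_restr 'X_1 = 1 :> {poly k} by rewrite /cusp_restr mmapXU vec3E.
have x2 : cusp_restr 'X_(2%:R) = 'X :> {poly k} by rewrite /cusp_restr mmapXU vec3E.
have C (c : k) : cusp_restr c%:MP = c%:P by rewrite /cusp_restr mmapC.
have C2 : 2%:P = 2 :> {poly k} by exact: (rmorph_nat polyC).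
have C3 : 3%:P = 3 :> {poly k} by exact: (rmorph_nat polyC).
rewrite (cusp_W good (g := @cusp_restr k) x0 x1 x2) /= !C (orb_end orb) /= polyCM C2.
congr (_ * _ * _).
  by rewrite -C3 -polyCM -orb0_center polyCM polyCD; ring.
by apply: eq_bigr => i _; rewrite !C (orb_end orb) /= polyCB; ring.
Qed.

Lemma cusp_restr_line i : cusp_restr (dJ_line D i) =
  ('X - (Q None (n None))%:P) * ('X - (Q (Some i) (n (Some i)))%:P)
   * ('X - (Q (Some i) 0)%:P).
Proof.
have x0 : cusp_restr 'X_0 = 'X ^+ 3 :> {poly k} by rewrite /cusp_restr mmapXU vec3E.
have x1 : cusp_restr 'X_1 = 1 :> {poly k} by rewrite /cusp_restr mmapXU vec3E.
have x2 : cusp_restr 'X_(2%:R) = 'X :> {poly k} by rewrite /cusp_restr mmapXU vec3E.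
have C (c : k) : cusp_restr c%:MP = c%:P by rewrite /cusp_restr mmapC.
have C2 : 2%:P = 2 :> {poly k} by exact: (rmorph_nat polyC).
rewrite (cusp_line (g := @cusp_restr k) D x0 x1 x2) /= !C !(orb_end orb) /= orb0_line.
by rewrite polyCM C2 !polyCB polyCN; ring.
Qed.

Lemma cusp_restr_W_neq0 : cusp_restr (dJ_W e D) != 0.
Proof.
rewrite cusp_restr_W !mulf_neq0 ?expf_neq0 ?polyXsubC_eq0 ?polyC_eq0 //.
by apply/prodf_neq0 => i _; rewrite polyXsubC_eq0.
Qed.

Lemma cusp_restr_line_neq0 i : cusp_restr (dJ_line D i) != 0.
Proof. by rewrite cusp_restr_line !mulf_neq0 ?polyXsubC_eq0. Qed.

Lemma cusp_restr_contracted : cusp_restr contracted =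
  cusp_restr (dJ_W e D) ^+ mu None * \prod_i cusp_restr (dJ_line D i) ^+ mu (Some i).
Proof.
rewrite (rmorphM (@cusp_restr k)) (rmorphXn (@cusp_restr k)) (rmorph_prod (@cusp_restr k)).
by congr (_ * _); apply: eq_bigr => i _; rewrite (rmorphXn (@cusp_restr k)).
Qed.

Lemma cusp_restr_contracted_neq0 : cusp_restr contracted != 0.
Proof.
rewrite cusp_restr_contracted mulf_neq0 ?expf_neq0 ?cusp_restr_W_neq0 //.
by apply/prodf_neq0 => i _; rewrite expf_neq0 // cusp_restr_line_neq0.
Qed.

(** The multiplicity of [contracted] at p_i: the curve [W = 0] has multiplicity [e] at p_1 and 1 at
    the simple base points, and the [i]-th line passes simply through p_1 and p_i. *)
Definition contracted_mult (i : option I) : nat :=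
  (if i is Some _ then mu None + mu i else e * mu None + \sum_j mu (Some j))%N.

Lemma mup_contracted i a : mup (Q i a) (cusp_restr contracted) =
  ((a == 0) * mu i + (a == n i) * contracted_mult i)%N.
Proof.
have Xc0 j b : 'X - (Q j b)%:P != 0 :> {poly k} by rewrite polyXsubC_eq0.
have P0 : \prod_j ('X - (Q (Some j) (n (Some j)))%:P) != 0 :> {poly k}.
  by apply/prodf_neq0.
have mW : mup (Q i a) (cusp_restr (dJ_W e D)) =
    (e * ((i == None) && (a == n i)) + ((i == None) && (a == 0))
     + ((i != None) && (a == n i)))%N.
  rewrite cusp_restr_W.
  rewrite mupM ?mulf_neq0 ?expf_neq0 ?polyC_eq0 // mupM ?mulf_neq0 ?expf_neq0 ?polyC_eq0 //.
  rewrite mup_exp // mupMr ?rootC // !orb_mup mup_prod //.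
  case: i => [i|] /=.
    rewrite (bigD1 i) //= orb_mup eqxx /= big1 ?addn0 => [|j ji].
      by rewrite [n _ == _]eq_sym muln0; case: (a == _).
    by rewrite orb_mup (inj_eq Some_inj) (negPf ji).
  rewrite big1 => [|j _]; last by rewrite orb_mup.
  by rewrite [n _ == _]eq_sym [0%N == _]eq_sym.
have mL j : mup (Q i a) (cusp_restr (dJ_line D j)) =
    ((i == None) && (a == n i) + (i == Some j) * ((a == n i) + (a == 0)))%N.
  rewrite cusp_restr_line mupM ?mulf_neq0 // mupM // !orb_mup.
  rewrite [n None == a]eq_sym [n (Some j) == a]eq_sym [0%N == a]eq_sym.
  case: i {mW} => [i|] /=.
    by rewrite eq_sym; case: eqP => [[->]|_] /=; rewrite ?mul1n ?mul0n ?add0n.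
  by case: (a == _).
rewrite cusp_restr_contracted mupM ?expf_neq0 ?cusp_restr_W_neq0 //; last first.
  by apply/prodf_neq0 => j _; rewrite expf_neq0 // cusp_restr_line_neq0.
rewrite mup_exp ?cusp_restr_W_neq0 // mup_prod => [|j]; last first.
  by rewrite expf_neq0 // cusp_restr_line_neq0.
rewrite mW; under eq_bigr => j _ do rewrite mup_exp ?cusp_restr_line_neq0 // mL.
case: i {mW mL} => [i|] /=.
  rewrite (bigD1 i) //= eqxx /= mul1n big1 => [|j ji].
    by case: (a == n _); case: (a == 0); lia.
  by rewrite (inj_eq Some_inj) eq_sym (negPf ji) muln0.
under eq_bigr => j _ do rewrite addn0.
by rewrite -big_distrl /=; case: (a == n _); case: (a == 0%N); lia.
Qed.

End Orbits.

Section Iterates.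
Variables (k : fieldType) (I : finType) (e : nat) (D : dJ_data k I).
Local Notation S := {mpoly k[3]}.
Local Notation F := (dJ_map e D).
Hypothesis good : dJ_good e D.
Variables (n : option I -> nat) (Q : option I -> nat -> k).
Hypothesis orb : dJ_orbits D n Q.
Variables (deg : nat -> nat) (mu : option I -> nat -> nat).

(* [deg t] is the degree of the t-th iterate and [mu i (t + a)] its multiplicity at
   q_i^a, for a < n i. *)
Record dJ_degrees : Prop := DJDegrees {
  deg0 : deg 0 = 1%N;
  degS : forall t, (deg t.+1 + (e.+1 * mu None t + \sum_i mu (Some i) t)
    = e.+2 * deg t)%N;
  mu_small : forall i t, (t < n i)%N -> mu i t = 0%N;
  muS : forall i t, (mu i (t + n i) + contracted_mult e (mu^~ t) i
    = base_mult e i * deg t)%N }.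

Hypothesis degs : dJ_degrees.

(** [it_vanish] has only lower bounds, which suffice to split off the contracted curves. [it_cusp]
    has the exact orders along the cubic; the order 0 at [Q i 0] shows that no contracted curve
    divides all the forms. [it_zero] feeds [coprime_of_algebraic_zeros]. *)
Record dJ_iterate (t : nat) (T : triple k) : Prop := DJIterate {
  it_homog : forall j, tnth T j \is (deg t).-homog;
  it_comp : exists c, forall j, tnth (iterT F t) j = c * tnth T j;
  it_vanish : forall i a j, (a < n i)%N -> vanish (Q i a.+1) (mu i (t + a)) (tnth T j);
  it_cusp : exists A rho, [/\ rho != 0,
    forall j, cusp_restr (tnth T j) = rho * vec3 (A ^+ 3) 1 A j
    & forall i a, mup (Q i a) rho
        = (((0 < a <= n i) : nat) * mu i (t + a.-1))%N];
  it_zero : forall (L : fieldType) (f : {rmorphism k -> L}) (v : 'I_3 -> L),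
    (exists j, v j != 0) -> (forall j, mmap f v (tnth T j) = 0) ->
    proj_algebraic f v }.

(** The induction applies [F] first, since the curves contracted by [F] then meet the multiplicities
    of the previous iterate, whereas [iterT] applies [F] last. *)
Lemma iterTSr t : iterT F t.+1 = compT (iterT F t) F.
Proof.
have compA (T1 T2 T3 : triple k) :
    compT T1 (compT T2 T3) = compT (compT T1 T2) T3.
  apply: eq_from_tnth => i; rewrite !tnth_mktuple !comp_mpolyE_mmap.
  rewrite (rmorph_mmap _ _ (mmap _ _)); apply: eq_mmap => [c|j] /=.
    by rewrite mmapC.
  by rewrite tnth_mktuple.
elim: t => [|t IH].
  rewrite /iterT /=; apply: eq_from_tnth => i; rewrite !tnth_mktuple.
  by rewrite comp_mpoly_id comp_mpolyE_mmap mmapXU.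
transitivity (compT F (compT (iterT F t) F)); first by rewrite -IH.
by rewrite compA.
Qed.

Lemma iterate0 : dJ_iterate 0 (idT k).
Proof.
have X i : tnth (idT k) i = 'X_i by rewrite tnth_mktuple.
split.
- by move=> j; rewrite X (deg0 degs) mpolyXU_homog.
- by exists 1 => j; rewrite mul1r.
- by move=> i a j an; rewrite add0n (mu_small degs) //; apply: vanish0.
- exists 'X, 1; split=> [|j|i a]; first exact: oner_neq0.
    by rewrite X /cusp_restr mmapXU mul1r.
  rewrite mupNroot ?root1 //; case: andP => [[a0 an]|]; rewrite ?mul0n //.
  by rewrite add0n (mu_small degs) // -ltnS prednK.
- move=> L f v [j vj] /(_ j); rewrite X mmapXU => v0.
  by rewrite v0 eqxx in vj.
Qed.

Section Step.
Variables (t : nat) (T : triple k).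
Hypothesis itT : dJ_iterate t T.
Local Notation H := (contracted e D (mu^~ t)).

Lemma cusp_restr_comp (P : S) m : P \is m.-homog ->
  cusp_restr (P \mPo F) = cusp_factor e n Q ^+ m *
    (cusp_restr P \Po cusp_action D).
Proof.
move=> hP; rewrite /cusp_restr comp_mpolyE_mmap (rmorph_mmap _ _ (mmap _ _)).
transitivity (mmap (@polyC k) (fun i => cusp_factor e n Q *
    vec3 (cusp_action D ^+ 3) 1 (cusp_action D) i) P).
  apply: eq_mmap => [c|i]; first by rewrite /= mmapC.
  by rewrite -(cusp_restr_map good orb i).
rewrite (dhomog_mmap _ _ _ hP); congr (_ * _).
rewrite -[RHS]/(comp_poly _ _) (rmorph_mmap _ _ (comp_poly _)).
apply: eq_mmap => [c|] /=; first by rewrite comp_polyC.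
by apply: forall_I3; rewrite /= !vec3E ?rmorphXn /= ?comp_polyX ?rmorph1.
Qed.

Lemma mmap_cusp_at tau (P : S) : mmap idfun (cusp_at tau) P = (cusp_restr P).[tau].
Proof.
rewrite -[RHS]/(horner_eval tau _) /cusp_restr (rmorph_mmap _ _ (horner_eval tau)).
apply: eq_mmap => [c|] /=; first by rewrite /horner_eval hornerC.
by apply: forall_I3; rewrite /= /horner_eval !vec3E ?hornerXn ?hornerC ?hornerX.
Qed.

Lemma contracted_neq0 : H != 0.
Proof.
have H0 := cusp_restr_contracted_neq0 good orb (mu^~ t).
by apply: contraNneq H0 => ->; rewrite (rmorph0 (@cusp_restr k)).
Qed.

Lemma contracted_homog : H \is (e.+1 * mu None t + \sum_i mu (Some i) t).-homog.
Proof.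
apply: dhomogM; first exact: dhomogMn (dJ_W_homog _ _).
elim/big_ind2: _ => [|m1 P1 m2 P2 h1 h2|i _].
- exact: dhomog1.
- exact: dhomogM.
- by have := dhomogMn (mu (Some i) t) (dJ_line_homog D i); rewrite mul1n.
Qed.

(** [vanish_subst], with [contract_W] and [contract_line], gives each power separately. The lines,
    which are prime, are then added one by one to the power of [W]. *)
Lemma contracted_dvd j : exists P, tnth T j \mPo F = H * P.
Proof.
have hT := it_homog itT j.
have vT i := it_vanish itT j (orb_len orb i).
have [q qE] : exists q, tnth T j \mPo F = q * dJ_W e D ^+ mu None t.
  have [a [b [F0 F2]]] := contract_W e D.
  have := vT None; rewrite (orb_start orb) addn0 /= => /vanish_subst vs.
  by apply: (vs _ (@mpolyC 3 k) (tnth F) _ a b);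
    rewrite dJ_mapE ?F0 ?F2 rmorphM /= rmorph_nat.
have dvdL i : exists q, tnth T j \mPo F = q * dJ_line D i ^+ mu (Some i) t.
  have [a [b [F0 F2]]] := contract_line good i.
  have := vT (Some i); rewrite (orb_start orb) addn0 /= => /vanish_subst vs.
  by apply: (vs _ (@mpolyC 3 k) (tnth F) _ a b); rewrite dJ_mapE ?F0 ?F2.
suff [P PE] : exists P, tnth T j \mPo F = (dJ_W e D ^+ mu None t *
    \prod_(i <- index_enum I) dJ_line D i ^+ mu (Some i) t) * P.
  by exists P; rewrite PE.
have : uniq (index_enum I) by exact: index_enum_uniq.
elim: (index_enum I) => [_|i r IH /= /andP[ir ur]].
  by exists q; rewrite big_nil mulr1 qE mulrC.
have [P PE] := IH ur; have [q' q'E] := dvdL i.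
have [||P' P'E] := @prime_elt_cancel _ (dJ_line D i) (dJ_W e D ^+ mu None t *
    \prod_(i <- r) dJ_line D i ^+ mu (Some i) t) P q' (mu (Some i) t)
    (prime_pencil_line _ _).
(* The third point of the cubic on the [i]-th line; no other contracted curve passes through it. *)
- pose tau := Q (Some i) 0.
  have val_line i' : mmap idfun (cusp_at tau) (dJ_line D i') = 0 -> i' = i.
    rewrite mmap_cusp_at (cusp_restr_line good orb) !hornerM !hornerXsubC => /eqP.
    rewrite !mulf_eq0 !subr_eq0 /tau !(orb_eq orb) /=.
    by case/orP => /andP[/eqP[<-] _].
  apply: (not_divides_rmorph (g := mmap idfun (cusp_at tau))).
    rewrite /= mmap_cusp_at (cusp_restr_line good orb) hornerM hornerXsubC.
    by rewrite subrr mulr0.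
  rewrite (rmorphM (mmap _ _)) (rmorphXn (mmap _ _)) (rmorph_prod (mmap _ _)) /=.
  rewrite mulf_neq0 ?expf_neq0 //.
    rewrite mmap_cusp_at (cusp_restr_W good orb) !hornerM hornerC horner_exp.
    rewrite horner_prod !hornerXsubC !mulf_neq0 ?expf_neq0 ?(dj_l0 good) //.
    + by rewrite subr_eq0 (orb_eq orb).
    + by rewrite subr_eq0 (orb_eq orb).
    + apply/prodf_neq0 => i' _; rewrite hornerXsubC subr_eq0 (orb_eq orb).
      by rewrite (ltn_eqF (orb_len orb _)) andbF.
  rewrite prodf_seq_neq0; apply/allP => i' i'r /=.
  rewrite (rmorphXn (mmap _ _)) expf_neq0 //=; apply: contraNneq ir => /val_line <-.
  by [].
- by rewrite -PE q'E.
exists P'; rewrite PE P'E big_cons; ring.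
Qed.

End Step.
End Iterates.

Section IterateStep.
Variables (k : fieldType) (I : finType) (e : nat) (D : dJ_data k I).
Local Notation S := {mpoly k[3]}.
Local Notation l := (dj_l D).
Local Notation h := (dj_h D).
Local Notation h' := (dj_h' D).
Local Notation F := (dJ_map e D).
Hypothesis good : dJ_good e D.
Variables (n : option I -> nat) (Q : option I -> nat -> k).
Hypothesis orb : dJ_orbits D n Q.
Variables (deg : nat -> nat) (mu : option I -> nat -> nat).
Hypothesis degs : dJ_degrees e n deg mu.
Variables (t : nat) (T T' : triple k).
Hypothesis itT : dJ_iterate e D n Q deg mu t T.
Local Notation H := (contracted e D (mu^~ t)).
Hypothesis TT' : forall j, tnth T j \mPo F = H * tnth T' j.

Let H0 : H != 0. Proof. exact: (contracted_neq0 good orb mu t). Qed.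
Let cH0 : cusp_restr H != 0.
Proof. exact: (cusp_restr_contracted_neq0 good orb (mu^~ t)). Qed.

Lemma step_homog j : tnth T' j \is (deg t.+1).-homog.
Proof.
have dS := degS degs t.
have -> : deg t.+1 = (e.+2 * deg t - (e.+1 * mu None t + \sum_i mu (Some i) t))%N.
  by rewrite -dS addnK.
apply: (dhomog_div H0 (contracted_homog _ _ _ _)); last by rewrite -dS leq_addl.
by rewrite -TT'; apply: dhomog_comp (dJ_map_homog e D) (it_homog itT j).
Qed.

Lemma step_comp : exists c, forall j, tnth (iterT F t.+1) j = c * tnth T' j.
Proof.
have [c cE] := it_comp itT; exists ((c \mPo F) * H) => j.
rewrite iterTSr tnth_mktuple cE comp_mpolyE_mmap (rmorphM (mmap _ _)) /=.
by rewrite -!comp_mpolyE_mmap TT' mulrA.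
Qed.

(** Restriction to the cubic can only raise the order, so the order of the restriction bounds that
    of the form in the plane. *)
Lemma not_vanish_contracted i a :
  ~ vanish (Q i a) (mup (Q i a) (cusp_restr H)).+1 H.
Proof. by move/vanish_cusp_restr; rewrite -mup_geq // ltnn. Qed.

(** Before the end of the orbit the order is carried over from the next point, through which no
    contracted curve passes. At the end, [F] has a base point: the order is the base multiplicity
    times [deg t], less that of the contracted curves, which is [muS]. *)
Lemma step_vanish i a j : (a < n i)%N ->
  vanish (Q i a.+1) (mu i (t.+1 + a)) (tnth T' j).
Proof.
move=> an; have := @not_vanish_contracted i a.+1.
rewrite (mup_contracted good orb) /= mul0n add0n => nv.
have := vanish_div nv (P := tnth T' j); rewrite -TT'.
have [anE|anE] := eqVneq a.+1 (n i); last first.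
  rewrite mul0n => vd; rewrite -[mu _ _]subn0 addSnnS; apply: vd.
  apply: (@vanish_comp _ _ (Q i a.+2) _ e.+2); first exact: dJ_map_homog.
  - by rewrite !(cusp_at_map good) /cusp_at !vec3E mulr1 -(orb_step orb) mulrC.
  - by rewrite !(cusp_at_map good) /cusp_at !vec3E mulr1 -(orb_step orb) mulrC.
  - by apply: it_vanish itT _ _ _ _; rewrite ltn_neqAle anE.
rewrite mul1n addSnnS anE => vd.
have -> : mu i (t + n i) = (base_mult e i * deg t - contracted_mult e (mu^~ t) i)%N.
  by rewrite -(muS degs) addnK.
apply: vd; rewrite (orb_end orb).
apply: vanish_comp_base (it_homog itT j) => j'.
exact: dJ_vanish_base.
Qed.

Lemma step_cusp : exists A rho, [/\ rho != 0,
    forall j, cusp_restr (tnth T' j) = rho * vec3 (A ^+ 3) 1 A j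
    & forall i a, mup (Q i a) rho
        = (((0 < a <= n i) : nat) * mu i (t.+1 + a.-1))%N].
Proof.
have [A [rho [rho0 TE rhoE]]] := it_cusp itT; pose act := cusp_action D.
have l0 := dj_l0 good.
have act_inj p : p \Po act = 0 -> p = 0.
  move=> pa; rewrite -[p]comp_polyXr.
  rewrite (_ : 'X = act \Po (l^-1%:P * ('X - (l * h - h')%:P))).
    by rewrite comp_polyA pa comp_poly0.
  rewrite /act /cusp_action comp_polyD comp_polyM comp_polyX !comp_polyC mulrA.
  by rewrite -polyCM divff // mul1r subrK.
pose rho' := cusp_restr (tnth T' 1); pose fac := cusp_factor e n Q ^+ deg t.
have T'E j : cusp_restr H * cusp_restr (tnth T' j)
    = fac * ((rho \Po act) * vec3 ((A \Po act) ^+ 3) 1 (A \Po act) j).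
  rewrite -(rmorphM (@cusp_restr k)) /= -TT'.
  rewrite (cusp_restr_comp good orb (it_homog itT j)) TE; congr (_ * _).
  rewrite (rmorphM (comp_poly _)) /=; congr (_ * _).
  by move: j; apply: forall_I3; rewrite !vec3E ?rmorphXn ?rmorph1.
have rho'E : cusp_restr H * rho' = fac * (rho \Po act).
  by rewrite /rho' T'E vec3_1 mulr1.
have fac0 : fac != 0 by rewrite expf_neq0 // cusp_factor_neq0.
have rhoa0 : rho \Po act != 0 by apply: contra_neq rho0; apply: act_inj.
have rho'0 : rho' != 0.
  by apply: contraTneq (mulf_neq0 fac0 rhoa0) => r0; rewrite -rho'E r0 mulr0 eqxx.
exists (A \Po act), rho'; split=> // [j|i a].
  by apply: (mulfI cH0); rewrite T'E !mulrA rho'E.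
have := congr1 (mup (Q i a)) rho'E; rewrite !mupM // (mup_contracted good orb).
rewrite mup_exp ?cusp_factor_neq0 // (mup_cusp_factor e orb).
rewrite (mup_comp_affine _ _ l0 rho0) -(orb_step orb) rhoE.
have n0 := orb_len orb i.
case: (ltngtP a (n i)) => an; rewrite ?mul0n ?mul1n ?addn0 ?muln0 ?add0n.
- case: a an => [|a] an /=; rewrite ?mul0n ?mul1n ?add0n ?an ?(ltnW an) ?n0 ?mul1n.
    by rewrite addn0 => /eqP; rewrite -[X in _ == X]addn0 eqn_add2l => /eqP.
  by move->; rewrite addSnnS.
- rewrite (_ : (a == 0) = false) ?mul0n ?add0n; last first.
    by apply/eqP=> a0; move: an; rewrite a0.
  by move->; rewrite andbF.
- have a0 : (a == 0) = false by rewrite an; apply: gtn_eqF.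
  rewrite a0 an n0 /= mul0n add0n mul1n => e1.
  apply/eqP; rewrite -(eqn_add2l (contracted_mult e (mu^~ t) i)) e1 addSnnS prednK //.
  by rewrite addnC (muS degs) mulnC.
Qed.

(** A base point of [F] is defined over [k]. Elsewhere the image of [v] is a zero of [T], hence
    algebraic, and off [dJ_jac = 0] the inverse map recovers [v] from it. On a contracted curve
    [T' 1] does not vanish at [Q i 0], by [step_cusp], so its zeros there are algebraic. *)
Lemma step_zero (L : fieldType) (f : {rmorphism k -> L}) (v : 'I_3 -> L) :
  (exists j, v j != 0) -> (forall j, mmap f v (tnth T' j) = 0) ->
  proj_algebraic f v.
Proof.
move=> v0 Tv; pose y j := mmap f v (tnth F j).
have comp_v (P : S) : mmap f v (P \mPo F) = mmap f y P.
  rewrite comp_mpolyE_mmap (rmorph_mmap _ _ (mmap _ _)); apply: eq_mmap => // c.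
  by rewrite /= mmapC.
have Ty j : mmap f y (tnth T j) = 0.
  by rewrite -comp_v TT' (rmorphM (mmap _ _)) /= Tv mulr0.
have [y0|y0] := pselect (forall j, y j = 0).
  have [||tau [_ x1 x0 x2]] := dJ_zeros good (g := mmap f v).
  - by have [j vj] := v0; exists j; rewrite /= mmapXU.
  - exact: y0.
  rewrite /= !mmapXU mmapC in x1 x0 x2.
  apply: (@proj_algebraic_scale _ _ _ _ (fun j => f (cusp_at tau j)) (v 1)).
    apply: forall_I3; rewrite /cusp_at vec3E.
    + by rewrite x0 rmorphXn mulrC.
    + by rewrite rmorph1 mulr1.
    + by rewrite x2 mulrC.
  by move=> j; apply: algebraic_id.
have [A [rho [rho0 TE rhoE]]] := step_cusp.
have T1 i : mmap idfun (cusp_at (Q i 0)) (tnth T' 1) != 0.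
  rewrite mmap_cusp_at TE vec3_1 mulr1; have := rhoE i 0%N.
  rewrite mul0n => m0; apply/negP => /rootP r0.
  by have := XsubC_dvd (Q i 0) rho0; rewrite m0 ltnn dvdp_XsubCl rootE r0 eqxx.
have Q02 i : Q i 0 != 2 * h.
  rewrite -[2 * h]/(base_param D None) -(orb_end orb) (orb_eq orb).
  by rewrite (ltn_eqF (orb_len orb _)) andbF.
have [jac0|jac0] := eqVneq (mmap f v (dJ_jac e D)) 0.
  move: jac0; rewrite /dJ_jac (rmorphM (mmap _ _)) (rmorphM (mmap _ _)).
  rewrite (rmorphXn (mmap _ _)) (rmorphXn (mmap _ _)) (rmorph_prod (mmap _ _)) /= mmapC.
  move/eqP; rewrite mulf_eq0 mulf_eq0 expf_eq0 fmorph_eq0 oppr_eq0.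
  rewrite (negPf (dj_l0 good)) andbF expf_eq0 orFb.
  case/orP => [/andP[_ /eqP Wv]|/prodf_eq0[i _ /eqP Lv]].
    exact: (algebraic_zero_W good (step_homog 1) (Q02 None) (orb0_center orb) (T1 None) Wv (Tv 1)).
  have tauE : (Q (Some i) 0 + h) ^+ 2 = dj_s D i ^+ 2.
    by rewrite (orb0_line good orb) subrK sqrrN.
  exact: (algebraic_zero_line (step_homog 1) (Q02 (Some i)) tauE (T1 (Some i)) Lv (Tv 1)).
have [j yj] : exists j, y j != 0.
  apply: contrapT => nj; apply: y0 => j; have [//|yj] := eqVneq (y j) 0.
    by case: nj; exists j.
have yalg := it_zero itT (ex_intro _ j yj) Ty.
pose y' i := y i / y j.
have yE i : y i = y j * y' i by rewrite /y' mulrC divfK.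
pose G := dJ_map e (inv_data D).
have vE i : v i = (mmap f v (dJ_jac e D))^-1 * y j ^+ e.+2 * mmap f y' (tnth G i).
  rewrite -mulrA -(dhomog_mmap _ _ _ (dJ_map_homog e (inv_data D) i)).
  apply: (mulfI jac0); rewrite mulVKf //.
  rewrite -(mmapXU f v i) -(rmorphM (mmap f v)) /=.
  rewrite -(@pull_map _ _ _ _ good (mmap (@mpolyC 3 k) (tnth F))).
  - rewrite -/G /= -comp_mpolyE_mmap comp_v.
    by apply: eq_mmap => // i'; exact: yE.
  - by move=> c; exact: mmapC.
  - by rewrite /= mmapXU dJ_mapE.
  - by rewrite /= mmapXU dJ_mapE.
  - by rewrite /= mmapXU dJ_mapE.
apply: proj_algebraic_scale vE _ => i; apply: algebraic_mmap => i'.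
exact: yalg.
Qed.

Lemma iterateS : dJ_iterate e D n Q deg mu t.+1 T'.
Proof.
split; [exact: step_homog|exact: step_comp|exact: step_vanish|exact: step_cusp|].
exact: step_zero.
Qed.

End IterateStep.

Lemma iterate_ex (k : fieldType) (I : finType) (e : nat) (D : dJ_data k I) n Q deg mu :
    dJ_good e D -> dJ_orbits D n Q -> dJ_degrees e n deg mu ->
  forall t, exists T, dJ_iterate e D n Q deg mu t T.
Proof.
move=> good orb degs; elim=> [|t [T itT]].
  by exists (idT k); apply: iterate0.
have /choice[P PE] := contracted_dvd good orb itT.
exists [tuple P i | i < 3]; apply: (iterateS good orb degs itT) => j.
by rewrite tnth_mktuple PE.
Qed.

(** * The birational map *)

Section BirationalMap.
Variables (k : fieldType) (I : finType) (e : nat).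

Lemma dJ_zero_algebraic (D : dJ_data k I) (L : fieldType) (f : {rmorphism k -> L})
    (v : 'I_3 -> L) : dJ_good e D ->
  (exists j, v j != 0) -> (forall j, mmap f v (tnth (dJ_map e D) j) = 0) ->
  proj_algebraic f v.
Proof.
move=> good [j vj] vF; have [||tau [_ x1 x0 x2]] := dJ_zeros good (g := mmap f v).
- by exists j; rewrite /= mmapXU.
- exact: vF.
rewrite /= !mmapXU mmapC in x1 x0 x2.
apply: (@proj_algebraic_scale _ _ _ _ (fun j => f (cusp_at tau j)) (v 1)).
  apply: forall_I3; rewrite /cusp_at vec3E.
  + by rewrite x0 rmorphXn mulrC.
  + by rewrite rmorph1 mulr1.
  + by rewrite x2 mulrC.
by move=> i; apply: algebraic_id.
Qed.

Definition dJ_ratmap (D : dJ_data k I) (good : dJ_good e D) : ratmap k :=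
  RatMap (dJ_map_homog e D)
    (coprime_of_algebraic_zeros
       (fun L f v => @dJ_zero_algebraic D L f v good)).

Lemma dJ_map_inv (D : dJ_data k I) : dJ_good e D ->
  same_map (compT (dJ_map e (inv_data D)) (dJ_map e D)) (idT k).
Proof.
move=> good; set T := compT _ _.
have TE i : tnth T i = dJ_jac e D * 'X_i.
  rewrite tnth_mktuple comp_mpolyE_mmap.
  apply: (@pull_map _ _ _ _ good (mmap (@mpolyC 3 k) (tnth (dJ_map e D)))).
  - by move=> c; exact: mmapC.
  - by rewrite /= mmapXU dJ_mapE.
  - by rewrite /= mmapXU dJ_mapE.
  - by rewrite /= mmapXU dJ_mapE.
split.
- by exists 0; rewrite TE mulf_neq0 ?mpolyXU_neq0 ?dJ_jac_neq0.
- by exists 0; rewrite tnth_mktuple mpolyXU_neq0.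
- by move=> i j; rewrite !TE !tnth_mktuple; ring.
Qed.

Lemma dJ_inv_map (D : dJ_data k I) : dJ_good e D ->
  same_map (compT (dJ_map e D) (dJ_map e (inv_data D))) (idT k).
Proof.
by move=> good; have := dJ_map_inv (inv_good good); rewrite (inv_dataK good).
Qed.

Variable D : dJ_data k I.
Hypothesis good : dJ_good e D.
Local Notation F := (dJ_map e D).

Definition dJ_birmap : birmap k :=
  @BirMap k (dJ_ratmap good) (dJ_ratmap (inv_good good))
    (dJ_map_inv good) (dJ_inv_map good).

Variables (n : option I -> nat) (Q : option I -> nat -> k).
Hypothesis orb : dJ_orbits D n Q.
Local Notation q i a := (cusp_pt (Q i a.+1)).

Lemma evalT_orbit i a c : a.+1 != n i -> c != 0 ->
  exists2 b, b != 0 & evalT F (c *: q i a) = b *: q i a.+1.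
Proof.
move=> an c0; exists (c ^+ e.+2 * ((Q i a.+1 - 2 * dj_h D) ^+ e.+1 *
    \prod_j (Q i a.+1 + dj_h D - dj_s D j))).
  have not_base i' : Q i a.+1 - base_param D i' != 0.
    rewrite subr_eq0 -(orb_end orb) (orb_eq orb).
    by apply/andP=> -[/eqP iN /eqP aE]; rewrite iN aE eqxx in an.
  apply: mulf_neq0; first by rewrite expf_neq0.
  apply: mulf_neq0; first by rewrite expf_neq0 // (not_base None).
  apply/prodf_neq0 => j _; have := not_base (Some j).
  by rewrite /= opprB addrA addrAC.
apply/rowP=> j; rewrite !mxE -/(cusp_pt _) -[LHS]/(mmap idfun _ _).
transitivity (mmap idfun (fun i' => c * cusp_at (Q i a.+1) i') (tnth F j)).
  by apply: eq_mmap => // i'; rewrite mxE cusp_ptE_at.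
rewrite (dhomog_mmap _ _ _ (dJ_map_homog e D j)) (cusp_at_map good).
by rewrite (orb_step orb i a.+1) !mulrA -cusp_ptE_at mxE.
Qed.

Lemma evalT_orbit_neq0 i a c : a.+1 != n i -> c != 0 -> ~ base_pt F (c *: q i a).
Proof.
move=> an c0; have [b b0 E] := evalT_orbit an c0.
by rewrite /base_pt E => /eqP; rewrite scaler_eq0 (negPf b0) (negPf (cusp_pt_neq0 _)).
Qed.

Lemma iter_at_orbit i a : (a < n i)%N -> iter_at dJ_birmap a (q i 0) (q i a).
Proof.
elim: a => [_|a IH an]; first by exists 1; rewrite ?scale1r ?oner_neq0.
exists (q i a); split; first exact: IH (ltnW an).
  by rewrite -[q i a]scale1r; apply: evalT_orbit_neq0; rewrite ?oner_neq0 ?ltn_eqF.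
have [|b b0] := @evalT_orbit i a 1 (negbT (ltn_eqF an)); first exact: oner_neq0.
rewrite scale1r => E; exists b^-1; rewrite ?invr_eq0 //.
by rewrite [evalT _ _]E scalerA mulVf // scale1r.
Qed.

Lemma iter_at_orbit_unique i a y : (a < n i)%N ->
  iter_at dJ_birmap a (q i 0) y -> proj_eq (q i a) y.
Proof.
elim: a y => [//|a IH] y an /= [z [/(IH _ (ltnW an))[c c0 ->] _ [c' c'0 ->]]].
have [b b0 E] := @evalT_orbit i a c (negbT (ltn_eqF an)) c0.
by exists (c' * b); rewrite ?mulf_neq0 // [evalT _ _]E scalerA.
Qed.

Lemma dJ_orbit_data : has_orbit_data dJ_birmap n
  (fun i => q i (n i).-1) (fun i => q i 0).
Proof.
split=> [i|i j a b x y an bn].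
  by apply: iter_at_orbit; rewrite prednK // (orb_len orb).
move=> /(iter_at_orbit_unique an)[c c0 ->] /(iter_at_orbit_unique bn)[c' c'0 ->].
case=> c'' c''0; rewrite scalerA => E.
have /proj_eq_cusp_pt/(orb_inj orb)[-> [->]] : proj_eq (q i a) (q j b); last by [].
exists (c'^-1 * (c'' * c)); first by rewrite !mulf_neq0 ?invr_eq0.
by rewrite -scalerA -E scalerA mulVf // scale1r.
Qed.

Variables (deg : nat -> nat) (mu : option I -> nat -> nat).
Hypothesis degs : dJ_degrees e n deg mu.

Lemma iterT_homog t j : tnth (iterT F t) j \is (e.+2 ^ t)%N.-homog.
Proof.
elim: t j => [|t IH] j; first by rewrite tnth_mktuple mpolyXU_homog.
rewrite iterTSr tnth_mktuple expnS.
exact: dhomog_comp (dJ_map_homog e D) (IH j).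
Qed.

Lemma cusp_restr_iterT_neq0 t : cusp_restr (tnth (iterT F t) 1) != 0.
Proof.
elim: t => [|t IH].
  by rewrite tnth_mktuple /cusp_restr mmapXU vec3E oner_neq0.
rewrite iterTSr tnth_mktuple (cusp_restr_comp good orb (iterT_homog t 1)).
rewrite mulf_neq0 ?expf_neq0 ?cusp_factor_neq0 // comp_poly2_eq0 //.
rewrite /cusp_action size_MXaddC polyC_eq0 (negPf (dj_l0 good)) /=.
by rewrite size_polyC (dj_l0 good).
Qed.

Lemma dJ_iter_degree t : iter_degree dJ_birmap t (deg t).
Proof.
have [T itT] := iterate_ex good orb degs t.
exists (RatMap (it_homog itT) (coprime_of_algebraic_zeros (it_zero itT))) => //.
have r0 := cusp_restr_iterT_neq0 t.
have iT0 : tnth (iterT F t) 1 != 0.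
  by apply: contraNneq r0 => ->; rewrite (rmorph0 (@cusp_restr k)).
have [c cE] := it_comp itT; split.
- by exists 1; apply: contraNneq iT0 => /= T0; rewrite cE T0 mulr0.
- by exists 1.
- by move=> i j /=; rewrite !cE; ring.
Qed.

End BirationalMap.

Lemma dJ_proper (k : fieldType) (d e : nat) (D : dJ_data k 'I_(2 * d - 2))
    (good : dJ_good e D) : d = e.+2 ->
  proper_de_Jonquieres (dJ_birmap good) (fun i => cusp_pt (base_param D i))
    (fun i => cusp_pt (base_param (inv_data D) i)).
Proof.
move=> dE; have mE : @dJ_mult d = base_mult e.
  by apply: funext; case=> [i|] //=; rewrite dE.
split; first exact: esym dE.
  by rewrite mE; apply: dJ_proper_base_points.
by rewrite mE; apply: dJ_proper_base_points (inv_good good).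
Qed.

End CuspidalMaps.
Import CuspidalMaps.

(** * Parameters of the orbits *)

Section OrbitParameters.
Variables (I : finType) (n : I -> nat).

(* The points [q_i^(a-1)] are affine functions of [l ^ a / orbit_den i]. *)
Definition orbit_den (K : fieldType) (l : K) (i : option I) : K :=
  if i is Some j then l ^+ n j + 1 else l.

(** The field [k] carries no order. What [2 < l] implies over the reals is recorded as equations and
    inequations that field morphisms both preserve and reflect. [adm_eq] is the characteristic
    equation divided by the product of the [l ^+ n i + 1], with [e.+1 = d - 1]. *)
Record dJ_admissible (K : fieldType) (e : nat) (l : K) : Prop := DJAdmissible {
  adm_2 : 2 != 0 :> K;
  adm_3 : 3 != 0 :> K;
  adm_l1 : l != 1;
  adm_den : forall i, orbit_den l i != 0;
  adm_inj : forall i j a b, l ^+ a * orbit_den l j = l ^+ b * orbit_den l i ->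
    i = j /\ a = b;
  adm_eq : l ^+ 2 - e.+1%:R * l - 1 + l * (\sum_i (l ^+ n i + 1)^-1) = 0 }.

Section Data.
Variables (K : fieldType) (e : nat) (l : K).
Hypothesis adm : dJ_admissible e l.

(** [- (l + 1) / (l - 1)] is the fixed point of [t |-> l t + l + 1], around which the orbits are
    geometric progressions. *)
Definition orbit_param i a : K := (l - 1)^-1 * (3 * (l ^+ a / orbit_den l i) - (l + 1)).

Definition orbit_len i := if i is Some j then n j else 2.

Definition orbit_data : dJ_data K I :=
  DJData l (orbit_param None 2 / 2) (orbit_param None 1 / 2)
    (fun i => orbit_param (Some i) (n i) + orbit_param None 2 / 2).

Local Notation D := orbit_data.

Let l0 : l != 0. Proof. exact: (adm_den adm None). Qed.
Let l1 : l - 1 != 0. Proof. by rewrite subr_eq0 (adm_l1 adm). Qed.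
Let two0 : 2 != 0 :> K := adm_2 adm.

Lemma orbit_data_h : dj_h D = (l - 1)^-1 * (2 * l - 1) / 2.
Proof. by rewrite /= /orbit_param /orbit_den; field; rewrite ?l0 ?l1 ?two0. Qed.

Lemma orbit_data_h' : dj_h' D = (l - 1)^-1 * (2 - l) / 2.
Proof. by rewrite /= /orbit_param /orbit_den; field; rewrite ?l0 ?l1 ?two0. Qed.

Lemma orbit_data_shift : l * dj_h D - dj_h' D = l + 1.
Proof. by rewrite orbit_data_h orbit_data_h'; field; rewrite ?l1 ?two0. Qed.

Lemma orbit_param_inj i j a b : orbit_param i a = orbit_param j b -> i = j /\ a = b.
Proof.
rewrite /orbit_param => /(mulfI (invr_neq0 l1))/addIr/(mulfI (adm_3 adm)) E.
move/eqP: E; rewrite eqr_div ?(adm_den adm) // => /eqP /(adm_inj adm) [-> ->].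
by [].
Qed.

Lemma orbit_data_orbits : (forall i, (0 < n i)%N) ->
  dJ_orbits D orbit_len orbit_param.
Proof.
move=> n0; have lD1 i := adm_den adm (Some i); rewrite /= in lD1.
split.
- move=> i a; rewrite orbit_data_shift /= /orbit_param exprS.
  by have := adm_den adm i; move: (orbit_den l i) => y y0; field; rewrite ?l1 ?y0.
- exact: orbit_param_inj.
- case=> [i|].
    rewrite [RHS]/= -/(dj_h D) -/(dj_h' D).
    rewrite -[orbit_param None 2 / 2]/(dj_h D) -[orbit_param None 1 / 2]/(dj_h' D).
    rewrite orbit_data_h orbit_data_h' /orbit_param expr1 /orbit_den.
    by have := lD1 i; move: (l ^+ n i) => y y0; field; rewrite ?l1 ?two0 ?y0.
  by rewrite /= mulrC divfK.
- case=> [i|] /=; first by rewrite addrK.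
  by rewrite mulrC divfK.
- by case=> [i|] /=.
Qed.

Lemma orbit_data_good : (forall i, (0 < n i)%N) -> #|I| = e.+1.*2 -> dJ_good e D.
Proof.
move=> n0 cardI; have orb := orbit_data_orbits n0.
have s_src i : dj_s D i = orbit_param (Some i) (n i) + dj_h D by [].
have h2 : 2 * dj_h D = orbit_param None 2 by rewrite /= mulrC divfK.
have h'2 : 2 * dj_h' D = orbit_param None 1 by rewrite /= mulrC divfK.
have lD1 i := adm_den adm (Some i); rewrite /= in lD1.
split=> //.
- by move=> i j /addIr/orbit_param_inj[[->]].
(* [- s_i - h] is the point preceding q_i and [s_j - h] is p_j, so [s_i + s_j = 0] would identify
   points of index 0 and [n j]. *)
- move=> i j; apply/eqP=> E; have : orbit_param (Some i) 0 = orbit_param (Some j) (n j).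
    have -> : orbit_param (Some i) 0 = - dj_s D i - dj_h D.
      rewrite s_src orbit_data_h /orbit_param /orbit_den.
      by have := lD1 i; move: (l ^+ n i) => y y0; field; rewrite ?l1 ?two0 ?y0.
    by apply: (addIr (dj_h D)); rewrite -s_src subrK; apply/esym/eqP; rewrite -addr_eq0 addrC E.
  by case/orbit_param_inj => _ n0'; have := n0 j; rewrite -n0'.
- move=> i; apply/eqP=> E; have : orbit_param (Some i) (n i) = orbit_param None 2.
    by rewrite -h2; apply: (addIr (dj_h D)); rewrite -s_src E; ring.
  by case/orbit_param_inj.
- move=> i; apply/eqP=> E; have : orbit_param (Some i) 1 = orbit_param None 1.
    by rewrite (orb_start orb) -h'2 -[LHS]/(- (dj_l D * dj_s D i) - dj_h' D) E; ring.
  by case/orbit_param_inj.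
- rewrite odd_leadE ?cardI // mulrBr -[l * (3 * _)]mulrCA.
  have l0' := l0; pose z := \sum_i (l ^+ n i + 1)^-1.
  (* Since [l h - h' = l + 1], this value is exactly [dj_sum]; it comes from [adm_eq] and from the
     number [2 (e + 1)] of terms. *)
  have -> : \sum_i dj_s D i = 3 * (l + 1) / l.
    transitivity (\sum_(i : I) ((l - 1)^-1 * (3 / 2) - (l - 1)^-1 * 3 * (l ^+ n i + 1)^-1)).
      apply: eq_bigr => i _; rewrite s_src orbit_data_h /orbit_param /orbit_den.
      by have := lD1 i; move: (l ^+ n i) => y y0; field; rewrite ?l1 ?two0 ?y0.
    rewrite sumrB sumr_const cardI -mulr_sumr -/z -[_ *+ e.+1.*2]mulr_natr -muln2 natrM.
    have -> : z = (1 + e.+1%:R * l - l ^+ 2) / l.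
      apply: (mulfI l0); rewrite mulrCA divff // mulr1.
      by apply/eqP; rewrite -subr_eq0 -(adm_eq adm) -/z; apply/eqP; ring.
    by field; rewrite ?l0 ?l1 ?two0.
  have -> : 3 * dj_h' D = 3 * (l * dj_h D) - 3 * (l + 1).
    by rewrite -orbit_data_shift; ring.
  by rewrite -[dj_l D]/l; field.
Qed.

End Data.
End OrbitParameters.

Section AdmissibleMorphism.
Variables (I : finType) (n : I -> nat) (K L : fieldType) (f : {rmorphism K -> L}).

Lemma rmorph_orbit_den l i : f (orbit_den n l i) = orbit_den n (f l) i.
Proof. by case: i => [i|] //=; rewrite rmorphD rmorphXn rmorph1. Qed.

Lemma rmorph_admissible e l :
  dJ_admissible n e (f l) <-> dJ_admissible n e l.
Proof.
have eqE : f l ^+ 2 - e.+1%:R * f l - 1 + f l * (\sum_i (f l ^+ n i + 1)^-1)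
    = f (l ^+ 2 - e.+1%:R * l - 1 + l * (\sum_i (l ^+ n i + 1)^-1)).
  rewrite rmorphD !rmorphB rmorphXn rmorph1 !rmorphM rmorph_nat rmorph_sum.
  congr (_ + _ * _); apply: eq_bigr => i _.
  by rewrite fmorphV rmorphD rmorphXn rmorph1.
have f0 x : (f x == 0) = (x == 0) := fmorph_eq0 f x.
split=> -[h2 h3 h1 hden hinj heq]; split.
- by rewrite -f0 rmorph_nat.
- by rewrite -f0 rmorph_nat.
- by rewrite -(fmorph_eq1 f).
- by move=> i; rewrite -f0 rmorph_orbit_den.
- move=> i j a b E; apply: hinj.
  by rewrite -!rmorph_orbit_den -!rmorphXn -!rmorphM E.
- by apply/eqP; rewrite -f0 -eqE heq.
- by rewrite -(rmorph_nat f) f0.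
- by rewrite -(rmorph_nat f) f0.
- by rewrite fmorph_eq1.
- by move=> i; rewrite -rmorph_orbit_den f0.
- move=> i j a b E; apply: hinj; apply: (fmorph_inj f).
  by rewrite !rmorphM !rmorphXn !rmorph_orbit_den.
- by rewrite eqE heq rmorph0.
Qed.

End AdmissibleMorphism.

Section AdmissibleReal.
Variables (R : realFieldType) (I : finType) (n : I -> nat) (l : R).
Hypotheses (n_inj : injective n) (n2 : forall i, (2 <= n i)%N) (l2 : 2 < l).

Let l0 : 0 < l. Proof. exact: lt_trans l2. Qed.
Let l1 : 1 < l. Proof. by apply: lt_trans l2; rewrite ltr1n. Qed.

Lemma ltr_exp_double a b : (a < b)%N -> 2 * l ^+ a < l ^+ b.
Proof.
move=> ab; apply: lt_le_trans (_ : l ^+ a.+1 <= _).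
  by rewrite exprS ltr_pM2r ?exprn_gt0.
by rewrite ler_eXn2l.
Qed.

(** As [2 < l], a sum of two powers is at most twice the larger one, hence below the next power. So
    the larger exponent is determined, and then the smaller one. *)
Lemma exp_sum_eq a b m p : (0 < m)%N -> (0 < p)%N ->
  l ^+ a * (l ^+ m + 1) = l ^+ b * (l ^+ p + 1) -> a = b /\ m = p.
Proof.
have lt_exp a' b' m' p' : (0 < p')%N -> (b' + p' < a' + m')%N ->
    l ^+ b' * (l ^+ p' + 1) < l ^+ a' * (l ^+ m' + 1).
  move=> p0 lt1; rewrite !mulrDr !mulr1 -!exprD.
  apply: lt_le_trans (_ : l ^+ (a' + m') <= _); last first.
    by rewrite lerDl exprn_ge0 // ltW.
  apply: le_lt_trans (ltr_exp_double lt1).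
  by rewrite mulr_natl mulr2n lerD2l ler_eXn2l // leq_addr.
move=> m0 p0 E; case: (ltngtP (a + m)%N (b + p)%N) => [lt1|lt1|eq1].
- by have := lt_exp _ _ _ _ m0 lt1; rewrite E ltxx.
- by have := lt_exp _ _ _ _ p0 lt1; rewrite E ltxx.
have eqa : a = b.
  move: E; rewrite !mulrDr !mulr1 -!exprD eq1 => /addrI E.
  by apply: (ieexprIn l0 (negbT (gt_eqF l1))).
by split=> //; move/eqP: eq1; rewrite eqa eqn_add2l => /eqP.
Qed.

Lemma exp_neq_sum a b m : (0 < m)%N -> l ^+ a != l ^+ b * (l ^+ m + 1).
Proof.
move=> m0; rewrite mulrDr mulr1 -exprD.
case: (ltnP (b + m) a) => h; [rewrite gt_eqF //|rewrite lt_eqF //].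
  apply: le_lt_trans (ltr_exp_double h).
  by rewrite mulr_natl mulr2n lerD2l ler_eXn2l // leq_addr.
apply: le_lt_trans (_ : l ^+ (b + m) < _); first by rewrite ler_eXn2l.
by rewrite ltrDl exprn_gt0.
Qed.

Lemma orbit_den_gt0 i : 0 < orbit_den n l i.
Proof. by case: i => [i|] //=; rewrite ltr_wpDl ?exprn_ge0 // ltW. Qed.

Lemma admissible_real e :
  l ^+ 2 - e.+1%:R * l - 1 + l * (\sum_i (l ^+ n i + 1)^-1) = 0 ->
  dJ_admissible n e l.
Proof.
have n0 i : (0 < n i)%N by exact: ltnW.
move=> leq; split=> //.
- by rewrite pnatr_eq0.
- by rewrite pnatr_eq0.
- by rewrite gt_eqF.
- by move=> i; rewrite gt_eqF ?orbit_den_gt0.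
move=> [i|] [j|] a b /=.
- by case/exp_sum_eq => // -> /n_inj ->.
- rewrite -exprSr => E; have := exp_neq_sum a.+1 b (n0 i).
  by rewrite E eqxx.
- rewrite -exprSr => /esym E; have := exp_neq_sum b.+1 a (n0 j).
  by rewrite E eqxx.
- by rewrite -!exprSr => /(ieexprIn l0 (negbT (gt_eqF l1)))[->].
Qed.

End AdmissibleReal.

(** * Eigenvectors of the de Jonquieres matrix *)

Section Functionals.
Variables (d : nat) (n : 'I_(2 * d - 2) -> nat).
Local Notation N := (dJ_size n).
Local Notation J := (dJ_matrix n).
Local Notation e0 := (dJ_e0 n).
Local Notation e1 := (dJ_e1 n).
Local Notation ei := (dJ_e n).

Lemma dJ_basis_ind (P : 'cV[int]_N -> Prop) :
  P e0 -> P (e1 0) -> P (e1 1) -> (forall i (a : 'I_(n i)), P (ei i a)) ->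
  forall c, P (delta_mx c 0).
Proof.
move=> P0 P10 P11 Pi c; case: (split_ordP c) => [a ->|s ->].
  case: a => -[|[|[|//]]] Ha.
  - by move: P0; congr (P (delta_mx _ 0)); apply: val_inj.
  - by move: P10; congr (P (delta_mx _ 0)); apply: val_inj.
  - by move: P11; congr (P (delta_mx _ 0)); apply: val_inj.
have := Pi (tagnat.sig1 s) (tagnat.sig2 s).
rewrite dJ_eE (_ : tagnat.Rank _ _ = s) // -[RHS](tagnat.sigK s).
rewrite /tagnat.Rank /tagnat.sig1 /tagnat.sig2; congr (tagnat.rank _).
by case: (tagnat.sig s).
Qed.

Section Pairing.
Variable (K : comNzRingType).
Implicit Types (v : 'rV[K]_N) (u : 'cV[int]_N).

Definition pairing v u : K := (v *m map_mx intr u) 0 0.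

Lemma pairingD v u u' : pairing v (u + u') = pairing v u + pairing v u'.
Proof. by rewrite /pairing map_mxD mulmxDr mxE. Qed.

Lemma pairingB v u u' : pairing v (u - u') = pairing v u - pairing v u'.
Proof. by rewrite /pairing map_mxB mulmxBr !mxE. Qed.

Lemma pairingZ v a u : pairing v (a *: u) = a%:~R * pairing v u.
Proof. by rewrite /pairing map_mxZ -scalemxAr mxE. Qed.

Lemma pairing_sum (I : Type) (r : seq I) (P : pred I) v (F : I -> 'cV[int]_N) :
  pairing v (\sum_(i <- r | P i) F i) = \sum_(i <- r | P i) pairing v (F i).
Proof.
elim/big_ind2: _ => [|u x u' x' <- <-|//]; last exact: pairingD.
by rewrite /pairing map_mx0 mulmx0 mxE.
Qed.

Lemma pairing_delta v c : pairing v (delta_mx c 0) = v 0 c.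
Proof.
rewrite /pairing mxE (bigD1 c) //= big1 => [|j jc].
  by rewrite !mxE !eqxx mulr1 addr0.
by rewrite !mxE (negPf jc) mulr0.
Qed.

Lemma pairing_mul v u : pairing v (J *m u) = pairing (v *m map_mx intr J) u.
Proof. by rewrite /pairing map_mxM mulmxA. Qed.

Lemma pairing_scale v x u : pairing (x *: v) u = x * pairing v u.
Proof. by rewrite /pairing -scalemxAl mxE. Qed.

Lemma eigen_pairing v x :
  (forall c, pairing v (J *m delta_mx c 0) = x * pairing v (delta_mx c 0)) ->
  v *m map_mx intr J = x *: v.
Proof.
by move=> h; apply/rowP => c; rewrite -!pairing_delta -pairing_mul h pairing_scale.
Qed.

Definition dJ_row (w0 w1 w2 : K) (w : 'I_(2 * d - 2) -> nat -> K) : 'rV[K]_N :=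
  \row_c match split c with
  | inl a => [:: w0; w1; w2]`_a
  | inr s => w (tagnat.sig1 s) (tagnat.sig2 s)
  end.

Variables (w0 w1 w2 : K) (w : 'I_(2 * d - 2) -> nat -> K).
Local Notation v := (dJ_row w0 w1 w2 w).

Lemma pairing_row_e0 : pairing v e0 = w0.
Proof. by rewrite pairing_delta mxE (unsplitK (inl _)). Qed.

Lemma pairing_row_e1 a : pairing v (e1 a) = [:: w1; w2]`_a.
Proof. by rewrite pairing_delta mxE (unsplitK (inl _)). Qed.

Lemma pairing_row_e i a : (a < n i)%N -> pairing v (ei i a) = w i a.
Proof.
move=> an; rewrite -[a]/(val (Ordinal an)) dJ_eE pairing_delta mxE (unsplitK (inr _)).
by rewrite /tagnat.sig1 /tagnat.sig2 /tagnat.Rank tagnat.rankK.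
Qed.

End Pairing.

Variable K : fieldType.
Hypothesis n0 : forall i, (0 < n i)%N.

Section CharacteristicEquation.
Variable x : K.
Hypothesis den0 : forall i, x ^+ n i + 1 != 0.
Local Notation sigma := (\sum_i (x ^+ n i + 1)^-1).
Local Notation g := (x ^+ 2 - (d%:R - 1) * x - 1 + x * sigma).

(** The same numbers place the orbits on the cubic: q_i^j is [(3 w - (x + 1)) / (x - 1)], where [w]
    is the coordinate at e_{i,j} and [x + 1] the one at e_0. *)
Definition dJ_left_eigenvector : 'rV[K]_N :=
  dJ_row (x + 1) 1 x (fun i a => x ^+ a.+1 / (x ^+ n i + 1)).
Local Notation v := dJ_left_eigenvector.

Lemma left_eigenvector_neq0 : v != 0.
Proof.
apply/eqP => v0; have := pairing_row_e1 (x + 1) 1 x (fun i a => x ^+ a.+1 / (x ^+ n i + 1)) 0.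
rewrite -/v v0 /= /pairing mul0mx mxE => /eqP; by rewrite eq_sym oner_eq0.
Qed.

Lemma left_eigenvector_eigen : g = 0 -> v *m map_mx intr J = x *: v.
Proof.
move=> gx; apply: eigen_pairing; have pe0 := @pairing_row_e0 K.
have ps : \sum_i pairing v (ei i 0) = x * sigma.
  by rewrite mulr_sumr; apply: eq_bigr => i _; rewrite pairing_row_e.
apply: (dJ_basis_ind (P := fun u => pairing v (J *m u) = x * pairing v u)).
- rewrite dJ_matrix_e0 !pairingB !pairingZ pairing_sum ps pairing_row_e0 pairing_row_e1 /=.
  rewrite rmorphB /=; apply/eqP; rewrite eq_sym -subr_eq0; apply/eqP; rewrite -[RHS]gx; ring.
- by rewrite dJ_matrix_e10 !pairing_row_e1 /=; ring.
- rewrite dJ_matrix_e11 !pairingB !pairingZ pairing_sum ps pairing_row_e0 !pairing_row_e1 /=.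
  rewrite !rmorphB /=; apply/eqP; rewrite eq_sym -subr_eq0; apply/eqP; rewrite -[RHS]gx; ring.
move=> i a; rewrite dJ_matrix_e (pairing_row_e _ _ _ _ (ltn_ord a)).
case: ltnP => an; first by rewrite pairing_row_e // mulrA -exprS.
have -> : nat_of_ord a = (n i).-1.
  by apply/eqP; rewrite eqn_leq -ltnS prednK // ltn_ord /= -ltnS prednK.
rewrite !pairingB pairing_row_e0 pairing_row_e1 pairing_row_e // prednK // expr1 /=.
by move: (x ^+ n i) (den0 i) => y y0; field.
Qed.

(** The equations at e_0 and e_{1,1} differ by [(x - 1) (p0 - (x + 1) p1) = 0]; with [x != 1] the
    vector is then determined by [p1], and the equation at e_{1,1} becomes [g = 0]. *)
Lemma left_eigenvector_equation (u : 'rV[K]_N) : x != 1 -> u != 0 ->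
  u *m map_mx intr J = x *: u -> g = 0.
Proof.
move=> x1 u0 uJ.
have E z : x * pairing u z = pairing u (J *m z).
  by rewrite pairing_mul uJ pairing_scale.
have E0 := E e0; have E10 := E (e1 0); have E11 := E (e1 1).
rewrite dJ_matrix_e0 !pairingB !pairingZ pairing_sum in E0.
rewrite dJ_matrix_e10 in E10.
rewrite dJ_matrix_e11 !pairingB !pairingZ pairing_sum in E11.
set s := \sum_i _ in E0 E11; rewrite !rmorphB /= in E0 E11.
set p0 := pairing u e0 in E0 E11; set p1 := pairing u (e1 0) in E0 E10 E11.
set p2 := pairing u (e1 1) in E0 E10 E11.
have p0E : p0 = (x + 1) * p1.
  have : (x - 1) * (p0 - (x + 1) * p1) = 0.
    transitivity (x * p0 - x * (x * p1) - (p0 - p1)); first by ring.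
    by rewrite E10 E0 E11; ring.
  by move/eqP; rewrite mulf_eq0 !subr_eq0 (negPf x1) => /eqP.
have Ei i a : (a < n i)%N -> pairing u (ei i a) = x ^+ a * pairing u (ei i 0).
  elim: a => [_|a IH an]; first by rewrite mul1r.
  by rewrite exprS -mulrA -IH ?(ltnW an) // E (dJ_matrix_e (Ordinal (ltnW an))) /= an.
have Ei0 i : pairing u (ei i 0) = x * p1 / (x ^+ n i + 1).
  have ln : ((n i).-1 < n i)%N by rewrite prednK.
  have := E (ei i (n i).-1); rewrite (dJ_matrix_e (Ordinal ln)) /= prednK // ltnn.
  rewrite !pairingB -/p0 -/p1 p0E Ei // mulrA -exprS prednK // => h.
  apply: (mulIf (den0 i)); rewrite divfK // mulrC mulrDl h; ring.
have sE : s = x * p1 * sigma.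
  by rewrite mulr_sumr /s; apply: eq_bigr => i _; rewrite Ei0.
have p10 : p1 != 0.
  apply: contraNneq u0 => p10; apply/eqP/rowP => c; rewrite mxE -pairing_delta.
  move: c; apply: (dJ_basis_ind (P := fun z => pairing u z = 0)).
  - by rewrite -/p0 p0E p10 mulr0.
  - by [].
  - by rewrite -/p2 -E10 p10 mulr0.
  - by move=> i a; rewrite Ei // Ei0 p10 mulr0 mul0r mulr0.
apply: (mulIf p10); rewrite mul0r.
transitivity (x * (x * p1) - ((d%:~R - 1) * ((x + 1) * p1) - (d%:~R - 2%:~R) * p1 - s)).
  by rewrite sE; ring.
by rewrite E10 E11 p0E; ring.
Qed.

End CharacteristicEquation.
End Functionals.

(** * The spectral radius exceeds 2 *)

Section Root.
Variables (R : rcfType) (d : nat) (n : 'I_(2 * d - 2) -> nat).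
Hypotheses (hd : (4 <= d)%N) (hn : forall i, (2 <= n i)%N).
Local Notation g x := (x ^+ 2 - (d%:R - 1) * x - 1 + x * (\sum_i (x ^+ n i + 1)^-1) : R).

(** The intermediate value theorem between 2 and [d], applied to [g] multiplied by the positive
    denominators. *)
Lemma characteristic_root_ex : exists2 x : R, 2 < x & g x = 0.
Proof.
pose y i : {poly R} := 'X^(n i) + 1.
pose q : {poly R} := 'X^2 - (d%:R - 1)%:P * 'X - 1.
pose p : {poly R} := q * \prod_i y i + 'X * \sum_i \prod_(j | j != i) y j.
have yE i x : (y i).[x] = x ^+ n i + 1 by rewrite /y hornerD hornerXn hornerC.
have y0 i (x : R) : 0 < x -> 0 < x ^+ n i + 1.
  by move=> x0; rewrite ltr_wpDl ?exprn_ge0 // ltW.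
have pE (x : R) : 0 < x -> p.[x] = g x * \prod_i (x ^+ n i + 1).
  move=> x0; rewrite /p hornerD (hornerM q) (hornerM 'X) hornerX horner_sum horner_prod.
  have -> : q.[x] = x ^+ 2 - (d%:R - 1) * x - 1.
    by rewrite /q !hornerD !hornerN hornerXn hornerM !hornerC hornerX.
  rewrite [RHS]mulrDl; under eq_bigr do rewrite yE.
  congr (_ + _); rewrite -[in RHS]mulrA mulr_suml; congr (_ * _); apply: eq_bigr => i _.
  rewrite horner_prod [in RHS](bigD1 i) //= mulKf ?gt_eqF ?y0 //.
  by apply: eq_bigr => j _; rewrite yE.
have d4 : 4 <= d%:R :> R by rewrite ler_nat.
have d0 : 0 < d%:R :> R by apply: lt_le_trans d4.
have prod0 (x : R) : 0 < x -> 0 < \prod_i (x ^+ n i + 1).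
  by move=> x0; apply: prodr_gt0 => i _; apply: y0.
(* Each denominator is at least [2^2 + 1 = 5], whence [g 2 <= (21 - 6 d) / 5], negative from [d = 4]
   on. *)
have g2 : g 2 < 0.
  have : \sum_i ((2 : R) ^+ n i + 1)^-1 <= (2 * d - 2)%:R * 5^-1.
    have -> : (2 * d - 2)%:R * 5^-1 = \sum_(i < 2 * d - 2) 5^-1 :> R.
      by rewrite sumr_const card_ord mulr_natl.
    apply: ler_sum => i _.
    rewrite lef_pV2 ?posrE ?ltr0n ?y0 //.
    have : 2 ^+ 2 <= (2 : R) ^+ n i by rewrite ler_eXn2l ?ltr1n.
    by rewrite expr2; lra.
  by rewrite natrB ?natrM; [lra | lia].
have gd : 0 <= g d%:R.
  have : 0 <= d%:R * \sum_i ((d%:R : R) ^+ n i + 1)^-1.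
    apply: mulr_ge0; first exact: ltW.
    by apply: sumr_ge0 => i _; rewrite ltW // invr_gt0 y0.
  rewrite expr2; set z := _ * \sum_i _; nra.
have [||x xI /rootP px] := @poly_ivt R p 2 d%:R.
- by apply: le_trans d4; rewrite ler_nat.
- by rewrite !pE // mulr_le0_ge0 ?mulr_ge0 // ltW ?prod0.
have [x2 xd] := andP xI.
have x0 : 0 < x by apply: lt_le_trans x2.
exists x.
  rewrite lt_neqAle x2 andbT; apply: contraTneq g2 => ->.
  have /eqP := px; rewrite pE // mulf_eq0 (gt_eqF (prod0 _ x0)) orbF => /eqP ->.
  by rewrite ltxx.
by have /eqP := px; rewrite pE // mulf_eq0 (gt_eqF (prod0 _ x0)) orbF => /eqP.
Qed.

End Root.

Section SpectralRadius.
Variables (R : realType) (d : nat) (n : 'I_(2 * d - 2) -> nat) (l : R).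
Hypotheses (hd : (4 <= d)%N) (hn : forall i, (2 <= n i)%N).
Hypothesis hl : spectral_radius_eigenvalue (dJ_matrix n) l.

Let n0 i : (0 < n i)%N. Proof. exact: ltnW (hn i). Qed.

Lemma spectral_radius_gt2 : 2 < l.
Proof.
have [x x2 gx] := characteristic_root_ex R hd hn.
have x0 : 0 < x by apply: lt_trans x2.
apply: lt_le_trans x2 _.
have [_ /(_ (x%:C)%C)] := hl.
rewrite -lecR normc_def /= expr0n addr0 sqrtr_sqr gtr0_norm //; apply.
have den0 i : x ^+ n i + 1 != 0.
  by rewrite gt_eqF // ltr_wpDl ?exprn_ge0 // ltW.
apply/eigenvalueP; exists (map_mx (real_complex R) (dJ_left_eigenvector n x)).
  have E := left_eigenvector_eigen n0 den0 gx.
  rewrite -map_mxZ -E map_mxM -map_mx_comp; congr (_ *m _).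
  by apply/matrixP => i j; rewrite !mxE; apply/esym; exact: (rmorph_int (real_complex R)).
by rewrite map_mx_eq0 left_eigenvector_neq0.
Qed.

Lemma spectral_radius_den_neq0 i : l ^+ n i + 1 != 0.
Proof.
have l0 : 0 < l by apply: lt_trans spectral_radius_gt2.
by rewrite gt_eqF // ltr_wpDl ?exprn_ge0 // ltW.
Qed.

Lemma spectral_radius_equation :
  l ^+ 2 - (d%:R - 1) * l - 1 + l * (\sum_i (l ^+ n i + 1)^-1) = 0.
Proof.
have [/eigenvalueP[v vJ v0] _] := hl.
apply: (left_eigenvector_equation n0 spectral_radius_den_neq0 _ v0 vJ).
by rewrite gt_eqF // (lt_trans _ spectral_radius_gt2) // ltr1n.
Qed.

Lemma spectral_radius_admissible e : injective n -> d = e.+2 -> dJ_admissible n e l.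
Proof.
move=> n_inj dE; apply: admissible_real n_inj hn spectral_radius_gt2 _ _.
rewrite -[RHS]spectral_radius_equation; congr (_ - _ * _ - _ + _).
by rewrite [in RHS]dE -[e.+2]addn1 natrD addrK.
Qed.

End SpectralRadius.

(** * Degrees and multiplicities of the iterates *)

Section OrbitClasses.
Variables (d : nat) (n : 'I_(2 * d - 2) -> nat).
Local Notation I := 'I_(2 * d - 2).
Local Notation J := (dJ_matrix n).

(* Coordinates of the class
   deg e_0 - m10 e_{1,0} - m11 e_{1,1} - \sum_(i, a) mi i a e_{i,a}. *)
Record dJ_class := DJClass { cls_deg : int; cls_m10 : int; cls_m11 : int;
  cls_mi : I -> nat -> int }.

Definition class_last (c : dJ_class) (i : I) : int := cls_mi c i (n i).-1.

Definition class_step (c : dJ_class) : dJ_class :=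
  let: DJClass D m10 m11 mi := c in
  let s := \sum_i class_last c i in
  DJClass (d%:Z * D - (d%:Z - 1) * m11 - s)
    ((d%:Z - 1) * D - (d%:Z - 2) * m11 - s) m10
    (fun i a => if a is a'.+1 then mi i a' else D - m11 - class_last c i).

Definition class_iter (t : nat) : dJ_class :=
  iter t class_step (DJClass 1 0 0 (fun _ _ => 0)).

Definition class_vector (c : dJ_class) : 'cV[int]_(dJ_size n) :=
  cls_deg c *: dJ_e0 n - cls_m10 c *: dJ_e1 n 0 - cls_m11 c *: dJ_e1 n 1
  - \sum_i \sum_(a < n i) cls_mi c i a *: dJ_e n i a.

Hypothesis n0 : forall i, (0 < n i)%N.

Lemma class_vector_step c : J *m class_vector c = class_vector (class_step c).
Proof.
case: c => D m10 m11 mi; rewrite /class_vector /=.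
rewrite /class_last /=; set s := \sum_i mi i (n i).-1.
rewrite !mulmxBr -!scalemxAr dJ_matrix_e0 dJ_matrix_e10 dJ_matrix_e11.
rewrite mulmx_sumr.
have -> : \sum_i J *m (\sum_(a < n i) mi i a *: dJ_e n i a)
    = \sum_i (\sum_(a < n i) (if val a is a'.+1 then mi i a' else 0) *: dJ_e n i a
        + mi i (n i).-1 *: (dJ_e0 n - dJ_e1 n 0 - dJ_e n i 0)).
  apply: eq_bigr => i _; rewrite mulmx_sumr.
  case: (n i) (n0 i) (@dJ_matrix_e d n i) => // p _ JE.
  rewrite big_ord_recr [X in _ = X + _]big_ord_recl /= scale0r add0r.
  rewrite -scalemxAr (JE ord_max) /= ltnn; congr (_ + _).
  apply: eq_bigr => a _.
  by rewrite -scalemxAr (JE (widen_ord (leqnSn p) a)) /= ltnS ltn_ord.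
rewrite big_split /=.
pose X := \sum_i \sum_(a < n i) (if val a is a'.+1 then mi i a' else 0) *: dJ_e n i a.
pose Y := \sum_i mi i (n i).-1 *: dJ_e n i 0; pose Z := \sum_i dJ_e n i 0.
rewrite -/X -/Z.
have -> : \sum_i mi i (n i).-1 *: (dJ_e0 n - dJ_e1 n 0 - dJ_e n i 0)
    = s *: dJ_e0 n - s *: dJ_e1 n 0 - Y.
  rewrite /s /Y !scaler_suml -!sumrB; apply: eq_bigr => i _.
  by rewrite !scalerBr.
have -> : \sum_i \sum_(a < n i)
      (match val a with 0%N => D - m11 - mi i (n i).-1 | a'.+1 => mi i a' end) *: dJ_e n i a
    = X
      + (D - m11) *: Z - Y.
  rewrite /X /Y /Z scaler_sumr -big_split -sumrB; apply: eq_bigr => i _ /=.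
  case: (n i) (n0 i) => // p _.
  by rewrite !big_ord_recl /= scale0r add0r scalerBl [LHS]addrC addrA.
move: X Y Z (dJ_e0 n) (dJ_e1 n 0) (dJ_e1 n 1) => X Y Z u0 u1 u2.
apply/colP => r; rewrite !mxE; ring.
Qed.

Lemma class_vector_iter t : class_vector (class_iter t) = iter t (mulmx J) (dJ_e0 n).
Proof.
elim: t => [|t IH]; last by rewrite /= -IH class_vector_step.
rewrite /class_vector /= scale1r !scale0r !subr0 big1 ?subr0 // => i _.
by rewrite big1 // => a _; rewrite scale0r.
Qed.

(** Only the last coordinate of each block is kept. By [class_mi_shift] the coordinate at e_{i,a} is
    the value [n i - 1 - a] steps later, that is, the multiplicity at q_i^(n_i - 1 - a). *)
Definition class_mult (i : option I) (t : nat) : int :=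
  if i is Some j then class_last (class_iter t) j else cls_m11 (class_iter t).
Local Notation D t := (cls_deg (class_iter t)).
Local Notation mu := class_mult.

Lemma class_degS t :
  D t.+1 = d%:Z * D t - (d%:Z - 1) * mu None t - \sum_i mu (Some i) t.
Proof. by rewrite /= /class_step /class_mult; case: (class_iter t). Qed.

Lemma class_mult_None t : mu None t.+2 =
  (d%:Z - 1) * D t - (d%:Z - 2) * mu None t - \sum_i mu (Some i) t.
Proof. by rewrite /= /class_step /class_mult; case: (class_iter t). Qed.

Lemma class_mi_shift t b i a : cls_mi (class_iter (t + b)) i (a + b) = cls_mi (class_iter t) i a.
Proof.
elim: b => [|b IH]; first by rewrite !addn0.
by rewrite !addnS -IH /= /class_step; case: (class_iter (t + b)).
Qed.

Lemma class_mult_Some t i : mu (Some i) (t + n i) = D t - mu None t - mu (Some i) t.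
Proof.
rewrite /class_mult /class_last -{1 2}(prednK (n0 i)) /= -addSnnS.
rewrite -[X in cls_mi _ _ X]add0n class_mi_shift /= /class_step.
by case: (class_iter t).
Qed.

Lemma class_mult_small t i : (t < n i)%N -> mu (Some i) t = 0.
Proof.
move=> tn; rewrite /class_mult /class_last -[t]add0n.
have -> : (n i).-1 = ((n i).-1 - t + t)%N by rewrite subnK // -ltnS prednK.
by rewrite class_mi_shift.
Qed.

Hypotheses (hd : (4 <= d)%N) (hn : forall i, (2 <= n i)%N).
Local Notation b t := (D t - mu None t).

Lemma class_gap t : b t.+2 = (d%:Z - 1) * b t.+1 + b t - \sum_i mu (Some i) t.+1.
Proof. by rewrite class_mult_None class_degS (class_degS t); ring. Qed.

(** The three claims feed each other. By [class_mult_Some] a multiplicity is at most the gap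
    [n i >= 2] steps earlier, hence at most half the next gap. The [2 d - 2] of them in [class_gap]
    then subtract at most [(d - 1) b t], which leaves at least [(d - 1) b t.+1 - (d - 2) b t >= (d /
    2) b t.+1], and [d / 2 >= 2]. *)
Lemma class_gap_mult t : [/\ 0 < b t, 2 * b t <= b t.+1
  & forall i, 0 <= mu (Some i) t <= b t].
Proof.
elim/ltn_ind: t => t IH.
have b0 : 0 < b t.
  case: t IH => [//|t] IH; have [b0 b2 _] := IH t (ltnSn t).
  by apply: lt_le_trans b2; rewrite mulr_gt0.
have mono r : (r <= t)%N -> b r <= b t.
  move=> rt; rewrite -(subnKC rt); have : (r + (t - r) <= t)%N by rewrite subnKC.
  elim: (t - r)%N => [|p IHp] pt; first by rewrite addn0.
  rewrite addnS in pt *; apply: le_trans (IHp (ltnW pt)) _.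
  by have [c0 c2 _] := IH _ pt; apply: le_trans c2; rewrite mulr_natl mulr2n lerDl ltW.
have bound i x : (x <= t.+1)%N -> 0 <= mu (Some i) x /\
    forall p, (x <= p.+2)%N -> (p <= t)%N -> mu (Some i) x <= b p.
  move=> xt; case: (ltnP x (n i)) => xn.
    rewrite class_mult_small //; split=> // p _ pt.
    have [->|np] := eqVneq p t; first exact: ltW.
    by have [|/ltW] := IH p; rewrite // ltn_neqAle np.
  have [r xE] : exists r, x = (r + n i)%N by exists (x - n i)%N; rewrite subnK.
  have rt : (r < t)%N by move: xt; have := hn i; rewrite xE; lia.
  have [_ _ /(_ i)/andP[m0 mr]] := IH r rt.
  rewrite xE class_mult_Some subr_ge0; split=> // p xp pt.
  have rp : (r <= p)%N by move: xp; have := hn i; lia.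
  apply: le_trans (_ : b r <= _); first by rewrite gerBl.
  elim: p {xp} pt rp => [|p IHp] pt; first by rewrite leqn0 => /eqP ->.
  rewrite leq_eqVlt => /orP[/eqP -> //|rp].
  have [c0 c2 _] := IH _ pt; apply: le_trans (IHp (ltnW pt) rp) _.
  by apply: le_trans c2; rewrite mulr_natl mulr2n lerDl ltW.
split=> // [|i]; last first.
  have [m0 ml] := bound i t (leqnSn t); rewrite m0 /=.
  by apply: ml; rewrite // -addn2 leq_addr.
case: t IH b0 mono bound => [|t] IH b0 mono bound.
  rewrite class_degS [cls_deg _]/= [mu None 1]/= [mu None 0]/=.
  rewrite big1 => [|i _]; [lia | exact: class_mult_small].
have [c0 c2 _] := IH t (ltnSn t); rewrite class_gap.
have mt i : 2 * mu (Some i) t.+1 <= b t.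
  case: t IH b0 mono bound c0 c2 => [|t] IH b0 mono bound c0 c2.
    by rewrite class_mult_small // mulr0 ltW.
  have [_ h] := bound i t.+2 (leqnSn _).
  have [_ c2' _] := IH t (leqnSn t.+1).
  apply: le_trans c2'; rewrite ler_pM2l //; apply: h => //.
  by rewrite -ltnS ltnS ltnW.
have : 2 * (\sum_i mu (Some i) t.+1) <= (2 * (d%:Z - 1)) * b t.
  rewrite mulr_sumr; apply: le_trans (ler_sum _ (fun i _ => mt i)) _.
  rewrite sumr_const card_ord -[X in X <= _]mulr_natl.
  rewrite (_ : (2 * d - 2)%:R = 2 * (d%:Z - 1)) //.
  by move: hd; rewrite natz; lia.
have d4 : 4 <= d%:Z by rewrite lez_nat.
move: (\sum_i _) c0 c2; set B := b t; set B' := b t.+1 => s c0 c2.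
by nia.
Qed.

Lemma class_mult_ge0 i t : 0 <= mu i t.
Proof.
case: i => [i|]; first by have [_ _ /(_ i)/andP[]] := class_gap_mult t.
elim/ltn_ind: t => -[|[|t]] IH //.
have -> : mu None t.+2 = mu None t.+1 + (b t.+1 - b t).
  by rewrite class_mult_None class_degS; ring.
have [b0 b2 _] := class_gap_mult t.
rewrite addr_ge0 ?IH // subr_ge0; apply: le_trans b2.
by rewrite mulr_natl mulr2n lerDl ltW.
Qed.

Lemma class_deg_gt0 t : 0 < D t.
Proof.
have [b0 _ _] := class_gap_mult t.
by rewrite -(subrK (mu None t) (D t)) ltr_pwDl ?class_mult_ge0.
Qed.

Lemma class_degrees e : d = e.+2 ->
  dJ_degrees e (orbit_len n) (fun t => `|D t|%N) (fun i t => `|mu i t|%N).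
Proof.
move=> dE; have dZ : d%:Z = e%:Z + 2 by rewrite dE; lia.
have DE t : `|D t|%N = D t :> int by rewrite gez0_abs // ltW ?class_deg_gt0.
have mE i t : `|mu i t|%N = mu i t :> int by rewrite gez0_abs // class_mult_ge0.
have sE t : (\sum_i `|mu (Some i) t|)%N = \sum_i mu (Some i) t :> int.
  by rewrite -natz natr_sum; apply: eq_bigr => i _; rewrite natz mE.
split=> // [t|[i|] t tn|[i|] t].
- apply/eqP; rewrite -eqz_nat !PoszD !PoszM DE DE mE sE class_degS dZ; apply/eqP. ring.
- by rewrite class_mult_small.
- by case: t tn => [|[|]].
- apply/eqP; rewrite -eqz_nat /contracted_mult /orbit_len /base_mult mul1n !PoszD DE !mE.
  by rewrite class_mult_Some; apply/eqP; ring.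
- apply/eqP; rewrite -eqz_nat /contracted_mult /orbit_len /base_mult addn2 !PoszD !PoszM DE sE !mE.
  by rewrite class_mult_None dZ; apply/eqP; ring.
Qed.

End OrbitClasses.

Lemma ler_sum_inj (R : numDomainType) (I : finType) (f : I -> nat) (F : nat -> R) M :
  injective f -> (forall m, 0 <= F m) -> (forall i, (f i < M)%N) ->
  \sum_i F (f i) <= \sum_(m < M) F m.
Proof.
move=> f_inj F0 fM; pose g i := Ordinal (fM i).
have g_inj : {in predT &, injective g} by move=> i j _ _ [/f_inj].
rewrite (bigID [in g @: predT] predT) /= big_imset //= lerDl.
by apply: sumr_ge0.
Qed.

(** * Growth of the degrees *)

Section Growth.
Variables (R : realFieldType) (d : nat) (n : 'I_(2 * d - 2) -> nat) (l : R).
Hypotheses (hd : (4 <= d)%N) (hn : forall i, (2 <= n i)%N) (n_inj : injective n).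
Hypotheses (l2 : 2 < l)
  (leq0 : l ^+ 2 - (d%:R - 1) * l - 1 + l * (\sum_i (l ^+ n i + 1)^-1) = 0).
Local Notation D t := (cls_deg (class_iter n t)).
Local Notation mu := (class_mult n).
Local Notation b t := (D t - mu None t).
Local Notation v := (dJ_left_eigenvector n l).

Let n0 i : (0 < n i)%N. Proof. exact: ltnW. Qed.
Let l0 : 0 < l. Proof. exact: lt_trans l2. Qed.

(** The [n i] are distinct and at least 2, so this is part of the series of the [m / 2^m] from
    [m = 2] on, whose sum is 3/2. *)
Lemma sum_half_le : \sum_i (n i)%:R * 2 ^- n i <= 3 / 2 :> R.
Proof.
pose F m : R := if (2 <= m)%N then m%:R * 2 ^- m else 0.
have F0 m : 0 <= F m.
  by rewrite /F; case: ifP => // _; rewrite mulr_ge0 // invr_ge0 exprn_ge0.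
have -> : \sum_i (n i)%:R * 2 ^- n i = \sum_i F (n i).
  by apply: eq_bigr => i _; rewrite /F hn.
pose M := (\max_i n i)%N.
apply: le_trans (ler_sum_inj (M := M.+1) n_inj F0 _) _.
  by move=> i; rewrite ltnS /M leq_bigmax.
have sE m : \sum_(j < m.+2) F j = 3 / 2 - (m.+3)%:R * 2 ^- m.+1 :> R.
  elim: m => [|m IH]; first by rewrite !big_ord_recr big_ord0 /F /=; lra.
  rewrite big_ord_recr IH /F /= !exprS -[m.+4]/(4 + m)%N -[m.+3]/(3 + m)%N -[m.+2]/(2 + m)%N !natrD.
  have : (2 : R) ^+ m != 0 by rewrite expf_neq0 ?pnatr_eq0.
  by move: (2 ^+ m) => z z0; field.
case: M => [|m]; first by rewrite big_ord1 /F /=; lra.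
by rewrite sE gerBl mulr_ge0 // invr_ge0 exprn_ge0.
Qed.

Lemma pairing_iter t : pairing v (class_vector n (class_iter n t)) = l ^+ t * (l + 1).
Proof.
rewrite class_vector_iter //.
have den0 i : l ^+ n i + 1 != 0 by rewrite gt_eqF // ltr_wpDl ?exprn_ge0 // ltW.
elim: t => [|t IH]; first by rewrite mul1r pairing_row_e0.
by rewrite /= pairing_mul left_eigenvector_eigen // pairing_scale IH exprS mulrA.
Qed.

Lemma class_mi_mult t i a : (a < n i)%N ->
  cls_mi (class_iter n t) i a = mu (Some i) (t + ((n i).-1 - a)).
Proof.
move=> an; have E : (n i).-1 = (a + ((n i).-1 - a))%N.
  by rewrite subnKC // -ltnS prednK.
by rewrite /mu /class_last [X in _ = cls_mi _ _ X]E class_mi_shift.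
Qed.

Lemma pairing_class t : pairing v (class_vector n (class_iter n t)) =
  (D t)%:~R * (l + 1) - (mu None t.+1)%:~R - (mu None t)%:~R * l
  - \sum_i \sum_(a < n i) (mu (Some i) (t + ((n i).-1 - a)))%:~R
      * (l ^+ a.+1 / (l ^+ n i + 1)).
Proof.
rewrite /class_vector !pairingB !pairingZ pairing_row_e0 !pairing_row_e1 pairing_sum /=.
rewrite mulr1 {1}/class_step; congr (_ - _ - _ - _).
  by case: (class_iter n t).
apply: eq_bigr => i _; rewrite pairing_sum; apply: eq_bigr => a _.
by rewrite pairingZ class_mi_mult // pairing_row_e.
Qed.

(** Weights and multiplicities are nonnegative, so the pairing is at most its term in e_0. *)
Lemma class_deg_lower t : l ^+ t <= (D t)%:~R.
Proof.
have l10 : 0 < l + 1 by rewrite addr_gt0.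
have m0 i s : 0 <= (mu i s)%:~R :> R by rewrite ler0z class_mult_ge0.
rewrite -(ler_pM2r l10) -pairing_iter pairing_class -!addrA gerDl !addrA.
have s0 : 0 <= \sum_i \sum_(a < n i) (mu (Some i) (t + ((n i).-1 - a)))%:~R
      * (l ^+ a.+1 / (l ^+ n i + 1)).
  apply: sumr_ge0 => i _; apply: sumr_ge0 => a _; rewrite mulr_ge0 //.
  by rewrite divr_ge0 ?addr_ge0 ?exprn_ge0 // ltW.
have := m0 None t.+1; have : 0 <= (mu None t)%:~R * l by rewrite mulr_ge0 // ltW.
by move: s0; set X := \sum_i _; lra.
Qed.

(** The multiplicity at time [t + 1] is at most [D t <= 2 b t <= b t.+1], and the degree is its sum
    with the gap. *)
Lemma class_deg_le_gap t : D t <= 2 * b t.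
Proof.
elim: t => [//|t IH]; have [b0 b2 _] := class_gap_mult n0 hd hn t.
have : mu None t.+1 <= D t.
  case: t {IH} b0 b2 => [//|t] _ _; have [b0 _ _] := class_gap_mult n0 hd hn t.
  have -> : mu None t.+2 = D t.+1 - b t by rewrite class_mult_None class_degS; ring.
  by rewrite gerBl ltW.
by move: (D t.+1) (mu None t.+1) b2 IH; lia.
Qed.

Lemma class_gap_exp s t : 2 ^+ s * b t <= b (t + s).
Proof.
elim: s => [|s IH]; first by rewrite mul1r addn0.
have [b0 b2 _] := class_gap_mult n0 hd hn (t + s).
by rewrite addnS; apply: le_trans b2; rewrite exprS -mulrA ler_pM2l.
Qed.

(** The multiplicity is at most the gap at [t - (s + 1)], so at most [b t / 2^(s+1)], and the weight
    is at most [2^(s + 1 - n i)]; the powers with exponent [s + 1] cancel. *)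
Lemma class_mult_le_gap t i s : (s < n i)%N ->
  (mu (Some i) (t + ((n i).-1 - s)))%:~R * (l ^+ s.+1 / (l ^+ n i + 1))
    <= 2 ^- n i * (b t)%:~R :> R.
Proof.
move=> sn; have [b0 _ _] := class_gap_mult n0 hd hn t.
have rhs0 : 0 <= 2 ^- n i * (b t)%:~R :> R.
  by rewrite mulr_ge0 ?invr_ge0 ?exprn_ge0 // ler0z ltW.
case: (ltnP t s.+1) => ts.
  by rewrite class_mult_small ?mul0r //; move: ts sn; lia.
pose r := (t - s.+1)%N.
have -> : (t + ((n i).-1 - s) = r + n i)%N by rewrite /r; lia.
have [_ _ /(_ i)/andP[m0 _]] := class_gap_mult n0 hd hn r.
have := class_gap_exp s.+1 r; rewrite {2}/r subnK // => bt.
have [br0 _ _] := class_gap_mult n0 hd hn r.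
rewrite class_mult_Some //.
have w0 : 0 <= l ^+ s.+1 / (l ^+ n i + 1).
  by rewrite divr_ge0 ?addr_ge0 ?exprn_ge0 // ltW.
apply: le_trans (_ : (b r)%:~R * (l ^+ s.+1 / (l ^+ n i + 1)) <= _).
  by rewrite ler_wpM2r // ler_int gerBl.
apply: le_trans (_ : (b r)%:~R * (2 ^+ s.+1 / 2 ^+ n i) <= _).
  rewrite ler_wpM2l ?ler0z ?(ltW br0) //.
  have ln0 : 0 < l ^+ n i by rewrite exprn_gt0.
  apply: le_trans (_ : l ^+ s.+1 / l ^+ n i <= _).
    rewrite ler_wpM2l ?exprn_ge0 ?(ltW l0) // lef_pV2 ?posrE //; last exact: addr_gt0.
    by rewrite lerDl.
  rewrite -(subnK sn) !exprD !invfM ![_ ^+ s.+1 * _]mulrCA !mulfV ?mulr1 ?expf_neq0 ?gt_eqF //.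
  by rewrite lef_pV2 ?posrE ?exprn_gt0 // lerXn2r ?nnegrE ?(ltW l0) // ltW.
rewrite mulrA mulrC ler_wpM2l ?invr_ge0 ?exprn_ge0 //.
by rewrite -(ler_int R) in bt; move: bt; rewrite rmorphM rmorphXn /= mulrC.
Qed.

(** The negative terms leave at least [(l - 3/2) b t >= b t / 2] of the pairing [l^t (l + 1)]. One
    factor 2 comes from here, the other from [D t <= 2 b t]. *)
Lemma class_deg_upper t : (D t)%:~R <= 4 * (l + 1) * l ^+ t.
Proof.
have D2 := class_deg_le_gap t; have [b0 _ _] := class_gap_mult n0 hd hn t.
have sum_le : \sum_i \sum_(a < n i) (mu (Some i) (t + ((n i).-1 - a)))%:~R
      * (l ^+ a.+1 / (l ^+ n i + 1)) <= 3 / 2 * (b t)%:~R.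
  apply: le_trans (_ : \sum_i (n i)%:R * 2 ^- n i * (b t)%:~R <= _); last first.
    by rewrite -mulr_suml ler_wpM2r ?sum_half_le // ler0z ltW.
  apply: ler_sum => i _.
  apply: le_trans (ler_sum _ (fun a _ => class_mult_le_gap t (ltn_ord a))) _.
  by rewrite sumr_const card_ord -mulrA mulr_natl.
have m1 : (mu None t.+1)%:~R <= (D t)%:~R :> R.
  rewrite ler_int; case: t {D2 b0 sum_le} => [//|t].
  have [b0 _ _] := class_gap_mult n0 hd hn t.
  have -> : mu None t.+2 = D t.+1 - b t by rewrite class_mult_None class_degS; ring.
  by rewrite gerBl ltW.
have := pairing_iter t; rewrite pairing_class => E.
have b0R : 0 < (b t)%:~R :> R by rewrite ltr0z.
rewrite -(ler_int R) rmorphM /= in D2; apply: le_trans D2 _.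
have E' : l * (b t)%:~R - 3 / 2 * (b t)%:~R <= l ^+ t * (l + 1).
  rewrite -E; move: sum_le; set X := \sum_i _.
  rewrite rmorphB /= in b0R *; move: m1; nra.
have : 2 * (b t)%:~R <= l * (b t)%:~R :> R by rewrite ler_wpM2r // ltW.
have -> : 4 * (l + 1) * l ^+ t = 4 * (l ^+ t * (l + 1)) by ring.
by move: E'; lra.
Qed.

End Growth.

Module GrowthRate.
Import classical_sets topology normedtype sequences exp.
Import numFieldNormedType.Exports.
Local Open Scope classical_set_scope.

Lemma root_cvg (R : realType) (u : nat -> R) (l C : R) : 0 < l -> 0 < C ->
  (forall s, l ^+ s <= u s) -> (forall s, u s <= C * l ^+ s) ->
  (fun s => u s `^ (s%:R^-1)) @ \oo --> l.
Proof.
move=> l0 C0 lu uC.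
(* At [s = 0] the exponent is [0^-1 = 0]; the shift discards this term. *)
rewrite -(cvg_shiftS (fun s => u s `^ (s%:R^-1))) /=.
have lroot s : (l ^+ s.+1) `^ (s.+1%:R^-1) = l.
  by rewrite -powR_mulrn ?ltW // -powRrM mulfV ?pnatr_eq0 // powRr1 // ltW.
have u0 s : 0 <= u s by apply: le_trans (lu s); rewrite exprn_ge0 // ltW.
apply: (@squeeze_cvgr _ _ _ _ (fun=> l) (fun s => C `^ (s.+1%:R^-1) * l)).
- near=> s; rewrite -{1}(lroot s) ge0_ler_powR ?nnegrE ?invr_ge0 ?exprn_ge0 ?(ltW l0) //=.
  rewrite -[X in _ * X](lroot s) -powRM ?exprn_ge0 ?(ltW l0) ?(ltW C0) //.
  by rewrite ge0_ler_powR ?nnegrE ?invr_ge0 ?mulr_ge0 ?exprn_ge0 ?(ltW l0) ?(ltW C0).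
- exact: cvg_cst.
rewrite -[X in _ --> X]mul1r; apply: cvgM; last exact: cvg_cst.
rewrite (_ : (fun s => C `^ (s.+1%:R^-1)) = (fun s => expR (harmonic s * ln C))); last first.
  by apply: funext => s; rewrite /powR gt_eqF.
rewrite -expR0 -(mul0r (ln C)); apply: continuous_cvg; first exact: continuous_expR.
by apply: cvgM; [exact: cvg_harmonic|exact: cvg_cst].
Unshelve. all: by end_near.
Qed.

End GrowthRate.

Lemma rmorph_dJ_param (K L : fieldType) (f : {rmorphism K -> L}) (d : nat)
    (n : 'I_(2 * d - 2) -> nat) l i j :
  f (dJ_param n l i j) = dJ_param n (f l) i j.
Proof.
have e3 : f 3 = 3 := rmorph_nat f 3; have e2 : f 2 = 2 := rmorph_nat f 2.
have e1 : f (l - 1)^-1 = (f l - 1)^-1 by rewrite fmorphV rmorphB rmorph1.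
case: i => [i|] /=.
  rewrite (rmorphM f) rmorphB (rmorphM f 3) e1 e3 (fmorph_div f).
  by rewrite !rmorphD !rmorphXn rmorph1.
by case: ifP => _; rewrite rmorphM rmorphB ?rmorphM ?rmorph1 e1 e2.
Qed.

Lemma dJ_param_orbit (K : fieldType) (d : nat) (n : 'I_(2 * d - 2) -> nat)
    (l : K) i j : l != 0 -> (j < dJ_orbit_length n i)%N ->
  dJ_param n l i j = orbit_param n l i j.+1.
Proof.
move=> l0; case: i => [i|] //=; case: j => [|[|//]] _; rewrite /orbit_param /=.
  by rewrite expr1 divff // mulr1; congr (_ * _); ring.
by rewrite -mulrA divff // mulr1; congr (_ * _); ring.
Qed.

Theorem proposition4p10 (R : realType) (k : fieldType)
    (iota : {rmorphism realAlg R -> k})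
    (d : nat) (n : 'I_(2 * d - 2) -> nat) (lambda : realAlg R)
    (hd : (4 <= d)%N)
    (hn : forall i, (2 <= n i)%N)
    (n_inj : injective n)
    (hlambda : spectral_radius_eigenvalue (dJ_matrix n) (val lambda)) :
  let N := dJ_orbit_length n in
  let q i j := cusp_pt (iota (dJ_param n lambda i j)) in
  exists f : birmap k,
    [/\ proper_de_Jonquieres f (fun i => q i (N i).-1) (fun i => q i 0%N),
        has_orbit_data f N (fun i => q i (N i).-1) (fun i => q i 0%N),
        forall i s, (s < N i)%N -> iter_at f s (q i 0%N) (q i s)
      & has_dynamical_degree f (val lambda)].
Proof.
move=> N q; pose e := (d - 2)%N.
have dE : d = e.+2 by rewrite /e; lia.
have n0 i : (0 < n i)%N by exact: ltnW.
have N0 i : (0 < N i)%N by case: i => [i|] /=.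
have cardI : #|'I_(2 * d - 2)| = e.+1.*2 by rewrite card_ord /e; lia.
have l2 := spectral_radius_gt2 hd hn hlambda.
have leq := spectral_radius_equation hd hn hlambda.
have l0 : 0 < val lambda by apply: lt_trans l2.
(* Admissibility is proved in [R], where [lambda] can be compared with 2, reflected to [realAlg R]
   along [val], and transported to [k] by [iota]. *)
have adm : dJ_admissible n e (iota lambda).
  apply/rmorph_admissible; pose f : {rmorphism realAlg R -> R} := val.
  apply/(rmorph_admissible n f).
  exact: spectral_radius_admissible hd hn hlambda e n_inj dE.
pose D := orbit_data n (iota lambda).
have good : dJ_good e D := orbit_data_good adm n0 cardI.
have orb : dJ_orbits D N (orbit_param n (iota lambda)) := orbit_data_orbits adm n0.
have degs := class_degrees n0 hd hn dE.
have qE i j : (j < N i)%N -> q i j = cusp_pt (orbit_param n (iota lambda) i j.+1).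
  by move=> jN; rewrite /q rmorph_dJ_param dJ_param_orbit // (adm_den adm None).
have q_end : (fun i => q i (N i).-1) =
    (fun i => cusp_pt (orbit_param n (iota lambda) i (N i).-1.+1)).
  by apply: funext => i; rewrite qE // prednK.
have q_start : (fun i => q i 0%N) =
    (fun i => cusp_pt (orbit_param n (iota lambda) i 1)).
  by apply: funext => i; rewrite qE.
exists (dJ_birmap good); split.
- have -> : (fun i => q i (N i).-1) = (fun i => cusp_pt (base_param D i)).
    by rewrite q_end; apply: funext => i; rewrite prednK // (orb_end orb).
  have -> : (fun i => q i 0%N) = (fun i => cusp_pt (base_param (inv_data D) i)).
    by rewrite q_start; apply: funext => i; rewrite (orb_start orb).
  exact: dJ_proper good dE.
- by rewrite q_end q_start; apply: dJ_orbit_data good _ _ orb.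
- by move=> i s sN; rewrite !qE //; apply: iter_at_orbit good _ _ orb _ _ sN.
exists (fun t => `|cls_deg (class_iter n t)|%N).
  by move=> s; apply: dJ_iter_degree good _ _ orb _ _ degs s.
have DE t : `|cls_deg (class_iter n t)|%N%:R = (cls_deg (class_iter n t))%:~R :> R.
  by rewrite -[RHS]/(_%:~R) -{2}[cls_deg _]gez0_abs // ltW // class_deg_gt0.
apply: (GrowthRate.root_cvg (C := 4 * (val lambda + 1))) => // [|s|s].
- by rewrite mulr_gt0 // addr_gt0.
- by rewrite DE; apply: class_deg_lower.
- by rewrite DE; apply: class_deg_upper.
Qed.
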